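(* There are only finitely many conjugacy classes (under conjugation in $\mathrm{PSL}(2,\mathbb{C})$) of arithmetic regular triangle Kleinian groups.
   Context: $\mathrm{PSL}(2,\mathbb{C})$ is identified with the group of orientation-preserving isometries of hyperbolic 3-space $\mathbb{H}^3$. A Kleinian group is a discrete subgroup of $\mathrm{PSL}(2,\mathbb{C})$ that is nonelementary, i.e. has no abelian subgroup of finite index. A half-turn in a hyperbolic line is the rotation by angle $\pi$ about that line (its axis). Complex distance: for two oriented hyperbolic lines, the complex distance is $\mu=x+iy$, $x\ge 0$, $y\in[0,2\pi)$, where $x$ is the length of their common perpendicular and $y$ is the angle between the lines, taken from the first to the second respecting orientations. A half-turn in an oriented line $m$ corresponds to a matrix $M\in\mathrm{SL}(2,\mathbb{C})$ with $\mathrm{tr}(M)=0$ (the two matrices $\pm M$ corresponding to the two orientations), and $\cosh\mu(m_1,m_2)=-\frac12\mathrm{tr}(M_1M_2)$. Regular triangle group: a group $\Gamma=\langle a,b,c\rangle\subset\mathrm{PSL}(2,\mathbb{C})$ generated by three half-turns $a,b,c$ whose axes can be oriented so that the three complex distances $\mu(a,b)$, $\mu(a,c)$, $\mu(c,b)$ between the oriented axes are all equal. Arithmetic: a subgroup $\Gamma$ of $\mathrm{PSL}(2,\mathbb{C})$ is arithmetic if there exist (i) a quaternion algebra $A$ over a number field $k\subset\mathbb{C}$ having exactly one complex place (one pair of complex conjugate embeddings, the inclusion $k\subset\mathbb{C}$ being one of them), such that $A\otimes_\phi\mathbb{R}$ is isomorphic to the Hamilton quaternions for every real place $\phi:k\to\mathbb{R}$,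 where $A$ is regarded as a $k$-subalgebra of $A\otimes_k\mathbb{C}\cong M(2,\mathbb{C})$; and (ii) an order $O$ of $A$ such that $\Gamma$ is commensurable with $p(O^1)$, where $O^1$ is the group of elements of $O$ of reduced norm $1$ and $p:\mathrm{SL}(2,\mathbb{C})\to\mathrm{PSL}(2,\mathbb{C})$ is the canonical projection; commensurable means that some finite index subgroup of $\Gamma$ is a finite index subgroup of $p(O^1)$. *)

(* Defs.v *)
From HB Require Import structures.
From mathcomp Require Import all_boot all_order all_algebra all_field.
From mathcomp Require Import generic_quotient ring complex.
From mathcomp Require Import all_classical all_reals all_analysis.

Set Implicit Arguments.
Unset Strict Implicit.
Unset Printing Implicit Defensive.

Import Order.TTheory GRing.Theory Num.Theory.
Import numFieldNormedType.Exports.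
Import ComplexField.

Local Open Scope classical_set_scope.
Local Open Scope quotient_scope.
Local Open Scope complex_scope.
Local Open Scope ring_scope.

Section Groups.
Variable gT : groupType.
Implicit Types (G H S : set gT) (g : gT).
Local Open Scope group_scope.

Definition is_subgroup G := G 1 /\ forall x y, G x -> G y -> G (x * y^-1).

Definition generated S := smallest is_subgroup S.

Definition left_cosets G H := [set [set x * h | h in H] | x in G].

Definition finite_index_subgroup H G :=
  [/\ is_subgroup H, H `<=` G & finite_set (left_cosets G H)].

Definition is_abelian G := forall x y, G x -> G y -> commute x y.

Definition commensurable G1 G2 :=
  exists2 H, finite_index_subgroup H G1 & finite_index_subgroup H G2.

Definition conj_class G := [set [set x ^ g | x in G] | g in [set: gT]].

End Groups.

Section SL2.
Variable R : realType.

Record SL2 := MkSL2 { sl2_mx : 'M[R[i]]_2; _ : \det sl2_mx == 1 }.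

HB.instance Definition _ := [isSub of SL2 for sl2_mx].
HB.instance Definition _ := [Choice of SL2 by <:].

Implicit Types M N P : SL2.

Lemma det_sl2 M : \det (sl2_mx M) = 1.
Proof. by apply/eqP; case: M. Qed.

Lemma unitmx_sl2 M : sl2_mx M \in unitmx.
Proof. by rewrite unitmxE det_sl2 unitr1. Qed.

Fact sl2_one_subproof : \det (1%:M : 'M[R[i]]_2) == 1.
Proof. by rewrite det1. Qed.
Definition sl2_one := MkSL2 sl2_one_subproof.

Fact sl2_mul_subproof M N : \det (sl2_mx M *m sl2_mx N) == 1.
Proof. by rewrite det_mulmx !det_sl2 mulr1. Qed.
Definition sl2_mul M N := MkSL2 (sl2_mul_subproof M N).

Fact sl2_inv_subproof M : \det (invmx (sl2_mx M)) == 1.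
Proof. by rewrite det_inv det_sl2 invr1. Qed.
Definition sl2_inv M := MkSL2 (sl2_inv_subproof M).

Fact sl2_mulA : associative sl2_mul.
Proof. by move=> M N P; apply: val_inj; rewrite /= mulmxA. Qed.
Fact sl2_mul1 : left_id sl2_one sl2_mul.
Proof. by move=> M; apply: val_inj; rewrite /= mul1mx. Qed.
Fact sl2_1mul : right_id sl2_one sl2_mul.
Proof. by move=> M; apply: val_inj; rewrite /= mulmx1. Qed.
Fact sl2_mulV : left_inverse sl2_one sl2_inv sl2_mul.
Proof. by move=> M; apply: val_inj; rewrite /= mulVmx// unitmx_sl2. Qed.
Fact sl2_Vmul : right_inverse sl2_one sl2_inv sl2_mul.
Proof. by move=> M; apply: val_inj; rewrite /= mulmxV// unitmx_sl2. Qed.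

HB.instance Definition _ :=
  isGroup.Build SL2 sl2_mulA sl2_mul1 sl2_1mul sl2_mulV sl2_Vmul.

(** The topology of SL(2,C) is induced by that of the space of matrices; the
    library puts the metric topology of C on the alias [R[i]^o]. *)
HB.instance Definition _ := Topological.copy SL2
  (initial_topology (sl2_mx : SL2 -> 'M[R[i]^o]_2)).

Definition sl2_eqv M N := (sl2_mx M == sl2_mx N) || (sl2_mx M == - sl2_mx N).

Lemma sl2_eqvP M N :
  reflect (sl2_mx M = sl2_mx N \/ sl2_mx M = - sl2_mx N) (sl2_eqv M N).
Proof. by apply: (iffP orP) => -[] /eqP; [left|right|left|right]. Qed.

Fact sl2_eqv_is_equiv : equiv_class_of sl2_eqv.
Proof.
split=> [M|M N|N M P]; first by rewrite /sl2_eqv eqxx.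
- by apply/sl2_eqvP/sl2_eqvP => -[->|->]; rewrite ?opprK; [left|right|left|right].
- move=> /sl2_eqvP MN /sl2_eqvP NP; apply/sl2_eqvP.
  by case: MN NP => -> [->|->]; rewrite ?opprK; [left|right|right|left].
Qed.

Canonical sl2_eqv_equiv := EquivRelPack sl2_eqv_is_equiv.

Definition PSL2 := {eq_quot sl2_eqv}.

HB.instance Definition _ := Topological.copy PSL2 (quotient_topology PSL2).
HB.instance Definition _ := Quotient.on PSL2.

Definition psl2_proj M : PSL2 := \pi_PSL2 M.

Lemma psl2_projP M N :
  psl2_proj M = psl2_proj N <-> sl2_mx M = sl2_mx N \/ sl2_mx M = - sl2_mx N.
Proof. by split=> [/eqmodP/sl2_eqvP//|h]; apply/eqmodP/sl2_eqvP. Qed.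

Lemma psl2_repr M :
  sl2_mx (repr (psl2_proj M)) = sl2_mx M \/
  sl2_mx (repr (psl2_proj M)) = - sl2_mx M.
Proof. by apply/psl2_projP; rewrite /psl2_proj reprK. Qed.

Definition psl2_one := psl2_proj 1%g.
Definition psl2_mul (x y : PSL2) := psl2_proj (repr x * repr y)%g.
Definition psl2_inv (x : PSL2) := psl2_proj (repr x)^-1%g.

Lemma psl2_mulE M N :
  psl2_mul (psl2_proj M) (psl2_proj N) = psl2_proj (M * N)%g.
Proof.
apply/psl2_projP => /=.
by case: (psl2_repr M) (psl2_repr N) => -> [->|->];
  rewrite ?mulmxN ?mulNmx ?opprK; [left|right|right|left].
Qed.

Lemma psl2_invE M : psl2_inv (psl2_proj M) = psl2_proj M^-1%g.
Proof.
apply/psl2_projP => /=.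
by case: (psl2_repr M) => ->; [left|right; exact: invrN].
Qed.

Lemma psl2_reprK (x : PSL2) : psl2_proj (repr x) = x.
Proof. exact: reprK. Qed.

Fact psl2_mulA : associative psl2_mul.
Proof.
move=> x y z; rewrite -(psl2_reprK x) -(psl2_reprK y) -(psl2_reprK z).
by rewrite !psl2_mulE mulgA.
Qed.
Fact psl2_mul1 : left_id psl2_one psl2_mul.
Proof. by move=> x; rewrite -(psl2_reprK x) psl2_mulE mul1g. Qed.
Fact psl2_1mul : right_id psl2_one psl2_mul.
Proof. by move=> x; rewrite -(psl2_reprK x) psl2_mulE mulg1. Qed.
Fact psl2_mulV : left_inverse psl2_one psl2_inv psl2_mul.
Proof. by move=> x; rewrite -(psl2_reprK x) psl2_invE psl2_mulE mulVg. Qed.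
Fact psl2_Vmul : right_inverse psl2_one psl2_inv psl2_mul.
Proof. by move=> x; rewrite -(psl2_reprK x) psl2_invE psl2_mulE mulgV. Qed.

HB.instance Definition _ :=
  isGroup.Build PSL2 psl2_mulA psl2_mul1 psl2_1mul psl2_mulV psl2_Vmul.

Definition is_discrete (G : set PSL2) := G `<=` isolated G.

Definition elementary (G : set PSL2) :=
  exists2 H, finite_index_subgroup H G & is_abelian H.

Definition kleinian (G : set PSL2) :=
  [/\ is_subgroup G, is_discrete G & ~ elementary G].

End SL2.

Section Lines.
Variable R : realType.
Local Notation C := R[i].

Definition expC (z : C) : C :=
  (expR (complex.Re z))%:C * (cos (complex.Im z) +i* sin (complex.Im z)).

(** The sphere at infinity of H^3 is the Riemann sphere, [None] being the
    point at infinity. *)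
Definition sphere := option C.

Definition mobius (M : SL2 R) (p : sphere) : sphere :=
  let a := sl2_mx M 0 0 in let b := sl2_mx M 0 1 in
  let c := sl2_mx M 1 0 in let d := sl2_mx M 1 1 in
  match p with
  | Some z => if c * z + d == 0 then None
              else Some ((a * z + b) / (c * z + d))
  | None => if c == 0 then None else Some (a / c)
  end.

Definition psl2_act (g : PSL2 R) (p : sphere) : sphere := mobius (repr g) p.

Lemma psl2_act_proj M p : psl2_act (psl2_proj M) p = mobius M p.
Proof.
rewrite /psl2_act /mobius; case: (psl2_repr M) => -> //.
case: p => [z|]; rewrite !mxE ?oppr_eq0 ?invrN ?mulrNN //.
by rewrite !mulNr -!opprD oppr_eq0 invrN mulrNN.
Qed.

(** A line of H^3, oriented, is given by its two endpoints at infinity. *)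
Record oriented_line := OrientedLine {
  line_tail : sphere;
  line_head : sphere;
  line_tail_neq_head : line_tail != line_head
}.

Implicit Types l : oriented_line.

Lemma expC_neq0 z : expC z != 0.
Proof.
rewrite mulf_neq0//; first by rewrite (inj_eq (@complexI _)) gt_eqF ?expR_gt0.
apply/eqP => -[c0 s0]; have := cos2Dsin2 (complex.Im z).
by rewrite c0 s0 expr0n addr0 => /eqP; rewrite eq_sym oner_eq0.
Qed.

Definition screw_mx (mu : C) : 'M[C]_2 :=
  diag_mx (\row_(i < 2) if i == 0 then expC (mu / 2) else (expC (mu / 2))^-1).

Fact screw_mx_det mu : \det (screw_mx mu) == 1.
Proof.
by rewrite det_diag !big_ord_recl big_ord0 !mxE /= mulr1 mulfV ?expC_neq0.
Qed.

(** z |-> e^mu z: the translation by Re mu along the line from 0 to infinity,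
    followed by the rotation by the angle Im mu about this line. *)
Definition screw (mu : C) : PSL2 R := psl2_proj (MkSL2 (screw_mx_det mu)).

(** [h] is the rotation by pi about [l], [g] carrying the line from 0 to
    infinity onto [l]. *)
Definition half_turn l (h : PSL2 R) := exists g : PSL2 R,
  [/\ psl2_act g (Some 0) = line_tail l, psl2_act g None = line_head l &
      h = (g * screw (pi *i) * g^-1)%g].

(** [g] normalizes the common perpendicular to the line from 0 to infinity and
    [l1] to the line from -1 to 1, which is then carried onto [l2] by the screw
    motion along the common perpendicular with parameter mu. *)
Definition perpendicular_distance l1 l2 (mu : C) := exists g : PSL2 R,
  [/\ psl2_act g (line_tail l1) = Some (-1), psl2_act g (line_head l1) = Some 1,
      psl2_act g (line_tail l2) = psl2_act (screw mu) (Some (-1)) &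
      psl2_act g (line_head l2) = psl2_act (screw mu) (Some 1)].

(** Distinct lines with a common endpoint have no common perpendicular: their
    distance is 0 and their angle is 0 or pi. *)
Definition asymptotic_distance l1 l2 (mu : C) :=
  [/\ (line_tail l1 == line_tail l2) (+) (line_head l1 == line_head l2) & mu = 0] \/
  [/\ (line_tail l1 == line_head l2) (+) (line_head l1 == line_tail l2) & mu = pi *i].

(** A relation: if [l1] and [l2] meet then their common perpendicular has no
    preferred orientation, and both y and 2 pi - y are admissible angles. *)
Definition complex_distance l1 l2 (mu : C) :=
  [/\ 0 <= complex.Re mu, 0 <= complex.Im mu < 2 * pi &
      perpendicular_distance l1 l2 mu \/ asymptotic_distance l1 l2 mu].

Definition regular_triangle_group (G : set (PSL2 R)) :=
  exists a b c : PSL2 R, exists la lb lc : oriented_line,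
    [/\ half_turn la a, half_turn lb b, half_turn lc c,
        (exists mu, [/\ complex_distance la lb mu,
                        complex_distance la lc mu &
                        complex_distance lc lb mu]) &
        G = generated [set a; b; c]].

End Lines.

(** The quaternion algebra (a,b/F): (x0,x1,x2,x3) stands for
    x0 + x1 i + x2 j + x3 ij, where i^2 = a, j^2 = b and ij = - ji. *)
Definition quat (F : fieldType) (a b : F) := (F * F * F * F)%type.

Section Quaternions.
Variables (F : fieldType) (a b : F).
Local Notation A := (quat a b).

HB.instance Definition _ := GRing.Zmodule.copy A (F * F * F * F)%type.

Definition quat_one : A := (1, 0, 0, 0).

Definition quat_mul (x y : A) : A :=
  let: (x0, x1, x2, x3) := x in let: (y0, y1, y2, y3) := y in
  (x0 * y0 + a * (x1 * y1) + b * (x2 * y2) - a * b * (x3 * y3),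
   x0 * y1 + x1 * y0 - b * (x2 * y3) + b * (x3 * y2),
   x0 * y2 + x2 * y0 + a * (x1 * y3) - a * (x3 * y1),
   x0 * y3 + x3 * y0 + x1 * y2 - x2 * y1).

Fact quat_mulA : associative quat_mul.
Proof.
move=> [[[x0 x1] x2] x3] [[[y0 y1] y2] y3] [[[z0 z1] z2] z3] /=.
by congr (_, _, _, _) => /=; ring.
Qed.
Fact quat_mul1 : left_id quat_one quat_mul.
Proof. by move=> [[[x0 x1] x2] x3] /=; congr (_, _, _, _) => /=; ring. Qed.
Fact quat_1mul : right_id quat_one quat_mul.
Proof. by move=> [[[x0 x1] x2] x3] /=; congr (_, _, _, _) => /=; ring. Qed.
Fact quat_mulDl : left_distributive quat_mul +%R.
Proof.
move=> [[[x0 x1] x2] x3] [[[y0 y1] y2] y3] [[[z0 z1] z2] z3] /=.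
by congr (_, _, _, _) => /=; ring.
Qed.
Fact quat_mulDr : right_distributive quat_mul +%R.
Proof.
move=> [[[x0 x1] x2] x3] [[[y0 y1] y2] y3] [[[z0 z1] z2] z3] /=.
by congr (_, _, _, _) => /=; ring.
Qed.
Fact quat_1neq0 : quat_one != 0.
Proof. by apply/eqP => -[/eqP]; rewrite oner_eq0. Qed.

HB.instance Definition _ := GRing.Zmodule_isNzRing.Build A
  quat_mulA quat_mul1 quat_1mul quat_mulDl quat_mulDr quat_1neq0.

Definition quat_scale (c : F) (x : A) : A :=
  let: (x0, x1, x2, x3) := x in (c * x0, c * x1, c * x2, c * x3).

Fact quat_scaleA (c d : F) (x : A) :
  quat_scale c (quat_scale d x) = quat_scale (c * d) x.
Proof. by case: x => [[[x0 x1] x2] x3] /=; rewrite !mulrA. Qed.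
Fact quat_scale1 : left_id 1 quat_scale.
Proof. by move=> [[[x0 x1] x2] x3] /=; rewrite !mul1r. Qed.
Fact quat_scaleDr : right_distributive quat_scale +%R.
Proof.
by move=> c [[[x0 x1] x2] x3] [[[y0 y1] y2] y3] /=; rewrite !mulrDr.
Qed.
Fact quat_scaleDl (x : A) : {morph quat_scale^~ x : c d / c + d}.
Proof. by move=> c d; case: x => [[[x0 x1] x2] x3] /=; rewrite !mulrDl. Qed.

HB.instance Definition _ := GRing.Zmodule_isLmodule.Build F A
  quat_scaleA quat_scale1 quat_scaleDr quat_scaleDl.

Fact quat_scaleAl (c : F) (x y : A) : c *: (x * y) = (c *: x) * y.
Proof.
case: x y => [[[x0 x1] x2] x3] [[[y0 y1] y2] y3].
by congr (_, _, _, _) => /=; ring.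
Qed.

HB.instance Definition _ := GRing.Lmodule_isLalgebra.Build F A quat_scaleAl.

Fact quat_scaleAr (c : F) (x y : A) : c *: (x * y) = x * (c *: y).
Proof.
case: x y => [[[x0 x1] x2] x3] [[[y0 y1] y2] y3].
by congr (_, _, _, _) => /=; ring.
Qed.

HB.instance Definition _ := GRing.Lalgebra_isAlgebra.Build F A quat_scaleAr.

Definition reduced_norm (x : A) : F :=
  let: (x0, x1, x2, x3) := x in
  x0 ^+ 2 - a * x1 ^+ 2 - b * x2 ^+ 2 + a * b * x3 ^+ 2.

End Quaternions.

(** The base change of (a,b/F) along phi : F -> K is (phi a, phi b/K), the
    canonical map being phi on the coordinates. *)
Definition base_change (F K : fieldType) (phi : {rmorphism F -> K}) (a b : F)
    (x : quat a b) : quat (phi a) (phi b) :=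
  let: (x0, x1, x2, x3) := x in (phi x0, phi x1, phi x2, phi x3).

Section Arithmetic.
Variables (R : realType) (k : fieldExtType rat).
Local Notation C := R[i].

Definition unique_complex_place (iota : {rmorphism k -> C}) :=
  (exists x, complex.Im (iota x) != 0) /\
  forall sigma : {rmorphism k -> C},
    [\/ forall x, complex.Im (sigma x) = 0,
        sigma =1 iota | sigma =1 (fun x => (iota x)^*)].

Definition ramified_at_real_places (a b : k) :=
  forall phi : {rmorphism k -> R},
  exists f : {lrmorphism quat (phi a) (phi b) -> quat (-1 : R) (-1)},
    bijective f.

Definition algebraic_integer (x : k) := integralOver (intr : int -> k) x.

Definition is_order (a b : k) (O : set (quat a b)) :=
  [/\ O 1,
      forall x y, O x -> O y -> O (x * y),
      exists (n : nat) (e : 'I_n -> quat a b),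
        O = [set x | exists2 c : 'I_n -> k,
               forall i, algebraic_integer (c i) & x = \sum_i c i *: e i] &
      forall x, exists (n : nat) (c : 'I_n -> k) (e : 'I_n -> quat a b),
        (forall i, O (e i)) /\ x = \sum_i c i *: e i].

(** [theta] identifies the complexified algebra with the algebra of matrices. *)
Definition norm_one_group (iota : {rmorphism k -> C}) (a b : k)
    (theta : quat (iota a) (iota b) -> 'M[C]_2) (O : set (quat a b)) :=
  [set g : PSL2 R | exists x M, [/\ O x, reduced_norm x = 1,
     sl2_mx M = theta (base_change iota x) & g = psl2_proj M]].

End Arithmetic.

Definition arithmetic_group (R : realType) (G : set (PSL2 R)) :=
  exists (k : fieldExtType rat) (iota : {rmorphism k -> R[i]}) (a b : k)
    (theta : {lrmorphism quat (iota a) (iota b) -> 'M[R[i]]_2})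
    (O : set (quat a b)),
  [/\ unique_complex_place iota, a != 0 /\ b != 0,
      ramified_at_real_places R a b, bijective theta &
      is_order O /\ commensurable G (norm_one_group theta O)].

(* Main.v *)
(** Lift the half-turns to A, B, D in SL(2,C) with trace 0 and
    tr(AB) = tr(AD) = tr(BD) = -x. If x = 2 the group is virtually abelian.
    Otherwise the finite Fourier transform of (A, B, D) shows that the group is
    determined up to conjugation by s, where x = -1 - 3 s^2, so it is enough that
    x takes finitely many values on arithmetic groups.

    If the group is commensurable with O^1, then A, B, D are multiples of
    elements of the quaternion algebra, which gives x in k; since the algebra
    ramifies at the real places, Gram determinants there put the real conjugates
    of x in [-1, 2]. Eigenvalues of elements of O are integral, hence so is x.
    Moreover |1 + x| <= 4: otherwise the group acts by ping-pong on three disjoint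
    discs, and no nontrivial element fixes a point outside them; but the algebra
    is dense in M(2,C) and lies in the commensurator of the group, so some power
    of AB has a conjugate in the group that fixes a point outside the discs.

    Thus x is an algebraic integer of bounded modulus whose other conjugates,
    except the complex conjugate, lie in [-1, 2], an interval of length less than
    4, and there are only finitely many such numbers. *)

Require Import Defs.
From HB Require Import structures.
From mathcomp Require Import all_boot all_order all_algebra all_field.
From mathcomp Require Import generic_quotient ring lra zify complex.
From mathcomp Require Import all_classical all_reals all_analysis.
Set Implicit Arguments.
Unset Strict Implicit.
Unset Printing Implicit Defensive.
Import Order.TTheory GRing.Theory Num.Theory.
Import ComplexField.
Local Open Scope classical_set_scope.
Local Open Scope complex_scope.
Local Open Scope ring_scope.

(** * Integers with restricted conjugates *)

(** The orientations of the axes remove the sign ambiguity of the lifts: the eigenvalue at the head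
    is ['i], and then a single [x], twice the hyperbolic cosine of the common distance, serves all
    three pairs. The lifts belong to the algebra only up to scalars, and only the squares of these
    scalars are known to lie in [k]. In the ping-pong the discs have radius 1 and centres at mutual
    distance [sqrt 3 |s|], which exceeds 2 exactly if [|3 s^2| > 4]; hence the bound on [|1 + x|].
    Conjugation by an element [q] of the algebra need not preserve [O], but it sends elements
    congruent to 1 modulo a suitable denominator into [O], and every element of norm 1 in [O] has a
    power of this kind. The length of the interval matters through its capacity, a quarter of it: as
    3/4 is less than 1, some integer polynomial is less than 1 in absolute value on all of [-1, 2],
    which limits the number of conjugates there. *)

Lemma det_horner_mx (F : closedFieldType) n (M : 'M[F]_n.+1) (rs : seq F)
    (q : {poly F}) :
  char_poly M = \prod_(y <- rs) ('X - y%:P) ->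
  \det (horner_mx M q) = \prod_(y <- rs) q.[y].
Proof.
move=> charM.
have srs : size rs = n.+1.
  by have := size_char_poly M; rewrite charM size_prod_XsubC => -[].
have [zs ->] := closed_field_poly_normal q; move: (lead_coef q) => c.
have detB z : \det (M - z%:M) = \prod_(y <- rs) (y - z).
  have := congr1 (horner_eval z) charM.
  rewrite /char_poly -det_map_mx /horner_eval horner_prod => detz.
  rewrite -opprB -scaleN1r detZ.
  under [RHS]eq_bigr do rewrite -opprB -mulN1r.
  rewrite big_split /= big_const_seq iter_mulr_1 count_predT.
  rewrite srs; congr (_ * _); under eq_bigr do rewrite -hornerXsubC.
  rewrite -detz; congr (\det _); apply/matrixP => i j.
  by rewrite !mxE /= /horner_eval hornerD hornerMn hornerX hornerN hornerC.
under [RHS]eq_bigr do rewrite hornerZ horner_prod.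
rewrite linearZ /= detZ big_split /= big_const_seq iter_mulr_1 count_predT srs.
congr (_ * _); rewrite exchange_big /= rmorph_prod /=.
elim/big_rec2: _ => [|z u v _ IH]; first by rewrite det1.
rewrite -[in LHS]/(_ *m _) det_mulmx IH; congr (_ * _).
rewrite rmorphB /= horner_mx_X horner_mx_C detB.
by apply: eq_bigr => y _; rewrite !hornerE.
Qed.

(** The product is the determinant of [q] evaluated at the companion matrix of [p], an integer
    matrix whose eigenvalues are the roots of [p]. *)
Lemma prod_horner_roots_int (C : closedFieldType) (p q : {poly int})
    (rs : seq C) :
  p \is monic ->
  map_poly intr p = \prod_(y <- rs) ('X - y%:P) ->
  exists N : int, \prod_(y <- rs) (map_poly intr q).[y] = N%:~R.
Proof.
(* A monic [p] of size at most 1 is 1; its companion matrix would be empty, while [det_horner_mx]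
   asks for positive dimension. *)
move=> mon_p pE; have [sp|sp] := leqP (size p) 1.
  have p1 : p = 1.
    have := monicP mon_p; rewrite lead_coefE (size1_polyC sp) size_polyC.
    by rewrite coefC; case: (_ != 0) => /= ->.
  exists 1; move: pE; rewrite p1 rmorph1 => /(congr1 (size \o val)) /=.
  by rewrite size_prod_XsubC size_poly1; case: rs => // _; rewrite big_nil.
have := companionmxK mon_p; have := congr1 predn (erefl (size p)).
have : (0 < (size p).-1)%N by case: (size p) sp => [|[]].
move: (size p).-1 (companionmx p) => [//|n] M _ _ charM.
exists (\det (horner_mx M q)); rewrite -(@det_horner_mx _ n (map_mx intr M)).
  by rewrite -map_horner_mx det_map_mx.
by rewrite -map_char_poly charM.
Qed.

(** Each linear factor multiplies the bound on the coefficients by at most [1 + B]. *)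
Lemma coef_prod_XsubC_le (C : numDomainType) (B : C) (rs : seq C) (i : nat) :
  0 <= B -> (forall y, y \in rs -> `|y| <= B) ->
  `|(\prod_(y <- rs) ('X - y%:P))`_i| <= (1 + B) ^+ size rs.
Proof.
move=> B0; have B1 : 1 <= 1 + B by rewrite lerDl.
elim: rs i => [|y rs IH] i ys; first by rewrite big_nil coef1; case: eqP; rewrite ?normr1 ?normr0.
have {}IH j : `|(\prod_(y <- rs) ('X - y%:P))`_j| <= (1 + B) ^+ size rs.
  by apply: IH => z zs; apply: ys; rewrite inE zs orbT.
rewrite big_cons mulrBl coefB coefXM coefCM (le_trans (ler_normB _ _))//.
rewrite exprS mulrDl mul1r lerD//; last first.
  by rewrite normrM ler_pM// ys// mem_head.
by case: ifP => // _; rewrite normr0 exprn_ge0// (le_trans ler01).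
Qed.

Lemma finite_bounded_int_poly (n K : nat) :
  finite_set [set p : {poly int} | (size p <= n)%N /\ forall i, `|p`_i| <= K%:Z].
Proof.
pose F (f : {ffun 'I_n -> 'I_(2 * K).+1}) : {poly int} :=
  \poly_(i < n) (if insub i is Some j then (f j)%:Z - K%:Z else 0).
apply: (@sub_finite_set _ _ (F @` setT)); last first.
  exact: finite_image.
move=> p [sp pK] /=.
exists [ffun i : 'I_n => inord (absz (p`_i + K%:Z))] => //.
apply/polyP => i; rewrite coef_poly; case: ltnP => ni; last by rewrite nth_default// (leq_trans sp).
rewrite insubT ffunE /=; have := pK i; move: p`_i => c.
rewrite ler_norml => /andP[Kc cK].
by rewrite inordK; lia.
Qed.

(** In characteristic 0 the derivative is nonzero and of smaller degree, so it is coprime to an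
    irreducible polynomial. *)
Lemma irreducible_int_roots_uniq (C : numClosedFieldType) (p : {poly int})
    (rs : seq C) :
  p \is monic -> irreducible_poly (map_poly intr p : {poly rat}) ->
  map_poly intr p = \prod_(y <- rs) ('X - y%:P) -> uniq rs.
Proof.
move=> mon_p irr_p pE; rewrite -(separable_prod_XsubC rs) -pE.
have -> : map_poly intr p = map_poly ratr (map_poly intr p : {poly rat}) :> {poly C}.
  by rewrite -map_poly_comp; apply: eq_map_poly => z /=; rewrite ratr_int.
rewrite separable_map unlock irreducible_poly_coprime//.
move: irr_p; set q := map_poly _ _ => -[q1 _].
have q0 : q^`() != 0.
  by rewrite -size_poly_gt0 polyorder.size_deriv -subn1 subn_gt0.
apply: contraL (lt_size_deriv (_ : q != 0)) => [dvd|]; last first.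
  by rewrite -size_poly_gt0 ltnW.
by rewrite -leqNgt dvdp_leq.
Qed.

(** Bernoulli's inequality for 4/3, the inverse of the bound 3/4 of [fekete_small]. *)
Lemma power_lt_bound (F : numFieldType) (g m : nat) :
  1 <= m%:R * (3 / 4 : F) ^+ g -> (g <= 3 * m)%N.
Proof.
have pos : 0 < (3 / 4 : F) by rewrite divr_gt0 ?ltr0n.
have bern : 1 + g%:R / 3 <= (4 / 3 : F) ^+ g.
  elim: g => [|g IH]; first by rewrite mul0r addr0 expr0.
  rewrite exprS (le_trans _ (ler_wpM2l _ IH)) ?divr_ge0 ?ler0n//.
  rewrite -subr_ge0 (_ : _ - _ = g%:R / 9); first by rewrite divr_ge0 ?ler0n.
  by rewrite -natr1; field.
move=> h; have : 1 + g%:R / 3 <= m%:R :> F.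
  apply: (le_trans bern); rewrite -(ler_pM2r (exprn_gt0 g pos)) -exprMn.
  by rewrite (_ : 4 / 3 * (3 / 4) = 1 :> F) ?expr1n//; field.
rewrite -(lerD2l (- 1)) addKr => /le_trans-/(_ m%:R).
by rewrite gerDr lerN10 ler_pdivrMr ?ltr0n// -natrM ler_nat mulnC; apply.
Qed.

(* At most 3/4 in absolute value on [-1, 2], while its values at the conjugates
   of an algebraic integer that is not one of its roots have a nonzero integer as
   product: this bounds the number of conjugates in [-1, 2]. *)
Definition fekete_poly : {poly int} :=
  'X * ('X - 1) * ('X ^+ 2 - 'X - 1) * ('X ^+ 2 - 'X - 2%:P).

Lemma horner_fekete (F : comNzRingType) (y : F) :
  (map_poly intr fekete_poly).[y] =
    y * (y - 1) * (y ^+ 2 - y - 1) * (y ^+ 2 - y - 2).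
Proof.
rewrite /fekete_poly !(rmorphM, rmorphB, rmorphXn, rmorph1) /= map_polyX map_polyC /=.
by rewrite !hornerE.
Qed.

(** Put [u = r^2 - r], which maps [-1, 2] onto [-1/4, 2]. The polynomial becomes
    [u (u - 1) (u - 2)], whose largest absolute value on that range is 45/64, taken at
    [u = -1/4]. *)
Lemma fekete_small (R : realFieldType) (r : R) :
  -1 <= r <= 2 -> `|r * (r - 1) * (r ^+ 2 - r - 1) * (r ^+ 2 - r - 2)| <= 3 / 4.
Proof.
move=> /andP[r1 r2].
have -> : r * (r - 1) * (r ^+ 2 - r - 1) * (r ^+ 2 - r - 2) =
   (r ^+ 2 - r) * (r ^+ 2 - r - 1) * (r ^+ 2 - r - 2) by ring.
have u1 : - (1 / 4) <= r ^+ 2 - r.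
  by have := sqr_ge0 (r - 1 / 2); rewrite sqrrB; lra.
have u2 : r ^+ 2 - r <= 2.
  have : 0 <= (r + 1) * (2 - r) by rewrite mulr_ge0; lra.
  by rewrite mulrDl !mulrDr -expr2; lra.
move: (r ^+ 2 - r) u1 u2 => u u1 u2; rewrite ler_norml; apply/andP; split.
  (* The constant 3/64 is the gap between 3/4 and 45/64. *)
  rewrite -subr_ge0 (_ : _ - _ = (u + 1 / 4) * ((u - 13 / 8) ^+ 2 + 11 / 64) + 3 / 64).
    have := sqr_ge0 (u - 13 / 8); move: (_ ^+ 2) => v v0.
    by rewrite addr_ge0 ?mulr_ge0//; lra.
  by field.
have [|u0] := leP u 1.
  have : 0 <= (u - 1 / 2) ^+ 2 by rewrite sqr_ge0.
  nra.
have : 0 <= u * (u - 1) * (2 - u) by rewrite !mulr_ge0//; lra.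
lra.
Qed.

(** At most two conjugates escape the interval, and each contributes at most [M] to a product of
    absolute value at least 1 in which all other factors are at most 3/4. This bounds the degree;
    with the roots bounded as well, only finitely many integer polynomials remain. *)
Lemma finite_restricted_integers (R : realType) (B : nat) :
  finite_set [set x : R[i] | `|x| <= B%:R /\ exists p : {poly int},
    [/\ p \is monic, irreducible_poly (map_poly intr p : {poly rat}),
        root (map_poly intr p) x &
        forall y, root (map_poly intr p) y ->
          [\/ exists2 r : R, -1 <= r <= 2 & y = r%:C, y = x | y = x^*]]].
Proof.
pose C := R[i]; pose Pc : {poly C} := map_poly intr fekete_poly.
(* [M] bounds [fekete_poly] on the disc of radius [B], the successor making it at least 1; [n]
   allows for [3 M^2] conjugates in the interval and two others; the base of [K] uses the radius
   [B + 2], so that [-1, 2] is covered even for [B = 0]. *)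
pose M := (B * B.+1 * (B ^ 2 + B + 1) * (B ^ 2 + B + 2)).+1.
pose n := (3 * M ^ 2 + 2).+1; pose K := ((1 + B.+2) ^ n)%N.
have rootsE (p : {poly C}) : p != 0 -> finite_set [set x | root p x].
  move=> p0; have [rs pE] := closed_field_poly_normal p.
  apply: (sub_finite_set _ (finite_seq rs)) => x /=.
  by rewrite pE rootZ ?lead_coef_eq0// root_prod_XsubC.
have intr_neq0 (p : {poly int}) : p != 0 -> map_poly intr p != 0 :> {poly C}.
  by move=> p0; rewrite map_poly_eq0_id0// intr_eq0 lead_coef_eq0.
apply: (@sub_finite_set _ _ ([set x | root Pc x] `|`
    \bigcup_(p in [set p : {poly int} |
                    (size p <= n.+1)%N /\ forall i, `|p`_i| <= K%:Z])
      [set x | p != 0 /\ root (map_poly intr p) x])); last first.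
  rewrite finite_setU; split.
    apply/rootsE/intr_neq0/eqP => /(congr1 (fun p => p.[3])).
    by rewrite /fekete_poly !hornerE.
  apply: bigcup_finite; first exact: finite_bounded_int_poly.
  move=> p _; have [->|p0] := eqVneq p 0.
    by apply: (sub_finite_set _ (@finite_set0 C)) => x [].
  by apply: (sub_finite_set _ (rootsE _ (intr_neq0 _ p0))) => x [].
move=> x [xB [p [mon_p irr_p px conj]]] /=.
have [Px|Px] := boolP (root Pc x); [by left|right].
exists p; last by split; rewrite ?monic_neq0.
have [rs] := closed_field_poly_normal (map_poly intr p : {poly C}).
rewrite lead_coef_map_id0 ?(monicP mon_p)// scale1r => pE.
have urs := irreducible_int_roots_uniq mon_p irr_p pE.
have rsB y : y \in rs -> `|y| <= B.+2%:R.
  rewrite -root_prod_XsubC -pE => /conj[[r /andP[r1 r2] ->]|->|->].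
  - rewrite normc_def /= expr0n addr0 sqrtr_sqr.
    rewrite -(rmorph_nat (real_complex R)) lecR ler_norml.
    by have := ler0n R B; rewrite -(addn2 B) natrD => B0; apply/andP; split; lra.
  - by rewrite (le_trans xB)// ler_nat -addn2 leq_addr.
  - by rewrite norm_conjC (le_trans xB)// ler_nat -addn2 leq_addr.
have srs : size p = (size rs).+1.
  rewrite -(size_prod_XsubC rs id) -pE size_map_poly_id0//.
  by rewrite (monicP mon_p).
suff sn : (size rs <= n)%N.
  split; first by rewrite srs.
  move=> i; have := coef_prod_XsubC_le i (ler0n _ B.+2) rsB.
  rewrite -pE coef_map /= -(ler_int C) intr_norm => /le_trans; apply.
  rewrite addrC natr1 -natrX -pmulrn ler_nat leq_pexp2l//.
pose bad := pred2 x x^*.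
have Pgood y : y \in rs -> ~~ bad y -> `|Pc.[y]| <= 3 / 4.
  rewrite -root_prod_XsubC -pE => /conj[[r r12 ->]|->|->]; last 2 first.
  - by rewrite /bad /= eqxx.
  - by rewrite /bad /= eqxx orbT.
  move=> _; rewrite horner_fekete.
  have -> : r%:C * (r%:C - 1) * (r%:C ^+ 2 - r%:C - 1) * (r%:C ^+ 2 - r%:C - 2) =
     (r * (r - 1) * (r ^+ 2 - r - 1) * (r ^+ 2 - r - 2))%:C :> C.
    by rewrite !(rmorphM, rmorphB, rmorphXn, rmorph1, rmorph_nat).
  rewrite normc_def /= expr0n addr0 sqrtr_sqr.
  have -> : 3 / 4 = (3 / 4 : R)%:C :> C by rewrite fmorph_div !rmorph_nat.
  by rewrite lecR fekete_small.
have Pbad y : bad y -> `|Pc.[y]| <= M%:R.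
  move=> bady; have yB : `|y| <= B%:R.
    by move: bady => /orP[]/eqP->; rewrite ?norm_conjC.
  rewrite horner_fekete !normrM.
  rewrite (@le_trans _ _ (B%:R * B.+1%:R * (B ^ 2 + B + 1)%:R * (B ^ 2 + B + 2)%:R))//.
    have y2B : `|y ^+ 2 - y| <= (B ^ 2 + B)%:R.
      by rewrite (le_trans (ler_normB _ _))// normrX natrD natrX lerD// lerXn2r// nnegrE ler0n.
    rewrite !ler_pM ?mulr_ge0//.
    - by rewrite (le_trans (ler_normB _ _))// normr1 -natr1 lerD2r.
    - by rewrite (le_trans (ler_normB _ _))// normr1 natrD lerD2r.
    - by rewrite (le_trans (ler_normB _ _))// normr_nat natrD lerD2r.
  by rewrite -!natrM ler_nat.
have [N NE] := prod_horner_roots_int fekete_poly mon_p pE.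
(* By irreducibility [p] divides [fekete_poly] or is coprime to it. The first is excluded because
   [x] is not a root, so no conjugate is a root and the integer [N] is nonzero. *)
have P1 : 1 <= \prod_(y <- rs) `|Pc.[y]|.
  rewrite -normr_prod NE -intr_norm (ler_int C 1) -gtz0_ge1 normr_gt0.
  rewrite -(intr_eq0 C) -NE prodf_seq_neq0; apply/allP => y yrs /=.
  have ratE (q : {poly int}) :
      map_poly intr q = map_poly ratr (map_poly intr q : {poly rat}) :> {poly C}.
    by rewrite -map_poly_comp; apply: eq_map_poly => z /=; rewrite ratr_int.
  rewrite ratE; apply: (@coprimep_root _ (map_poly intr p)); last by rewrite pE root_prod_XsubC.
  rewrite ratE coprimep_map irreducible_poly_coprime//.
  apply: contraNN Px; rewrite -(dvdp_map (ratr : {rmorphism rat -> C})) -!ratE.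
  by move=> /root_dvdp; apply.
have bad2 : (count bad rs <= 2)%N.
  rewrite /bad -[count _ _](eq_count (a1 := predU (pred1 x) (pred1 x^*)))//.
  rewrite (leq_trans (leq_addr (count (predI (pred1 x) (pred1 x^*)) rs) _))//.
  by rewrite count_predUI !count_uniq_mem// (leq_add (leq_b1 _) (leq_b1 _)).
have : 1 <= (M ^ 2)%:R * (3 / 4) ^+ count (predC bad) rs :> C.
  rewrite (le_trans P1)// (bigID bad) /= natrX ler_pM ?prodr_ge0//.
    rewrite (@le_trans _ _ (M%:R ^+ count bad rs))//; last first.
      by rewrite ler_weXn2l// (ler_nat C 1).
    rewrite -big_filter -size_filter.
    have : all bad (seq.filter bad rs) by exact: filter_all.
    elim: (seq.filter bad rs) => [|y s IH] /=; first by rewrite big_nil.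
    by move=> /andP[/Pbad yM /IH sM]; rewrite big_cons exprS ler_pM ?prodr_ge0.
  rewrite -big_filter -size_filter.
  have : all (fun y => (y \in rs) && ~~ bad y) (seq.filter (predC bad) rs).
    by apply/allP => y; rewrite mem_filter /= andbC.
  elim: (seq.filter _ rs) => [|y s IH] /=; first by rewrite big_nil.
  by move=> /andP[/andP[/Pgood/[apply] yM] /IH sM]; rewrite big_cons exprS ler_pM ?prodr_ge0.
move=> /power_lt_bound; rewrite -(count_predC bad rs) /n => h.
by rewrite addnC ltnW// ltnS leq_add.
Qed.

(** * Embeddings of number fields *)

Lemma rat_min_poly (k : fieldExtType rat) (x : k) :
  exists p : {poly rat}, [/\ p \is monic, irreducible_poly p,
    root (map_poly (in_alg k) p) x &
    forall q, root (map_poly (in_alg k) q) x -> p %| q].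
Proof.
have [p pE] := elimT polyOver1P (minPolyOver 1 x).
have dvd q : root (map_poly (in_alg k) q) x -> p %| q.
  move=> qx; rewrite -(dvdp_map (in_alg k)) -pE minPoly_dvdp//.
  by apply/polyOver1P; exists q.
have px : root (map_poly (in_alg k) p) x by rewrite -pE root_minPoly.
have mon_p : p \is monic by rewrite -(map_monic (in_alg k)) -pE monic_minPoly.
exists p; split=> //; apply/(subfx_irreducibleP px); rewrite ?monic_neq0//.
by move=> q /dvd pq q0; rewrite dvdp_leq.
Qed.

Lemma num_field_generator (k : fieldExtType rat) :
  exists a : k, forall x, exists q : {poly rat}, x = (map_poly (in_alg k) q).[a].
Proof.
have sepk : separable (1%AS : {subfield k}) {:k}%AS.
  apply/separableP => y _; apply: pcharf0_separable => p.
  by rewrite pchar_lalg pchar_num.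
exists (separable_generator 1%AS {:k}%AS) => x; apply/Fadjoin1_polyP.
by rewrite -(eq_adjoin_separable_generator sepk (sub1v _)) memvf.
Qed.

(** The polynomial that represents an element is unique only modulo multiples of [p], and these
    vanish at [b]; so evaluation at [b] is well defined. *)
Lemma num_field_morphism (k : fieldExtType rat) (C : numFieldType) (a : k)
    (p : {poly rat}) (b : C) :
  (forall x, exists q : {poly rat}, x = (map_poly (in_alg k) q).[a]) ->
  (forall q, root (map_poly (in_alg k) q) a -> p %| q) ->
  root (map_poly ratr p) b ->
  exists tau : {rmorphism k -> C},
    forall q : {poly rat}, tau (map_poly (in_alg k) q).[a] = (map_poly ratr q).[b].
Proof.
move=> gen mina pb; pose poly_of x := sval (cid (gen x)).
have poly_ofP x : x = (map_poly (in_alg k) (poly_of x)).[a] := svalP (cid (gen x)).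
pose tau x : C := (map_poly ratr (poly_of x)).[b].
have tauE q : tau (map_poly (in_alg k) q).[a] = (map_poly ratr q).[b].
  rewrite /tau; set r := poly_of _; apply/eqP; rewrite -subr_eq0 -hornerN -hornerD.
  rewrite -rmorphB /=; apply: (@root_dvdp _ (map_poly ratr p)) => //.
  rewrite dvdp_map mina// rootE rmorphB /= hornerD hornerN.
  by rewrite -poly_ofP subrr.
have tauB : zmod_morphism tau.
  move=> x y; rewrite {1}(poly_ofP x) {1}(poly_ofP y) -hornerN -hornerD -rmorphB /=.
  by rewrite tauE rmorphB hornerD hornerN.
have tauM : monoid_morphism tau.
  split=> [|x y]; first by have := tauE 1; rewrite !rmorph1 !hornerC.
  rewrite {1}(poly_ofP x) {1}(poly_ofP y) -hornerM -rmorphM /=.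
  by rewrite tauE rmorphM hornerM.
pose m1 := GRing.isZmodMorphism.Build _ _ tau tauB.
pose m2 := GRing.isMonoidMorphism.Build _ _ tau tauM.
pose T : {rmorphism k -> C} := HB.pack tau m1 m2.
by exists T.
Qed.

(** Elimination: write [x = q(a)] with a primitive element [a]. The resultant [N] of the minimal
    polynomial of [a] and of [q - y], a polynomial in [y], vanishes at [x] and hence at all roots of
    [p]. For such a root [y] the two polynomials share a root [b], and [a] can be sent to [b]. *)
Lemma num_field_conjugate (k : fieldExtType rat) (C : numClosedFieldType) (x : k)
    (p : {poly rat}) (y : C) :
  (forall q, root (map_poly (in_alg k) q) x -> p %| q) ->
  root (map_poly ratr p) y ->
  exists tau : {rmorphism k -> C}, tau x = y.
Proof.
move=> minx py; have [a gen] := num_field_generator k.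
have [pa [mon_pa irr_pa ra mina]] := rat_min_poly a.
(* The added multiple of [pa] vanishes at [a], and makes [q] nonconstant. The leading coefficient of
   [q - y] is then free of [y], so that the resultant commutes with the specialisation of [y]. *)
have [q0 q0E] := gen x; pose m := pa * 'X ^+ (size q0).+1; pose q := m + q0.
have qE : x = (map_poly (in_alg k) q).[a].
  rewrite /q /m rmorphD rmorphM /= hornerD hornerM (rootP ra) mul0r add0r; exact: q0E.
have sq0 : (size q0 < size m)%N.
  by rewrite size_Mmonic ?monic_neq0 ?monicXn// size_polyXn addnS ltn_addl.
have sq : (1 < size q)%N.
  rewrite size_polyDl// size_Mmonic ?monic_neq0 ?monicXn// size_polyXn addnS /=.
  have : (0 < size pa)%N by rewrite size_poly_gt0 monic_neq0.
  by move=> /leq_add; apply.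
pose Q : {poly {poly rat}} := map_poly polyC q - 'X%:P.
pose N := resultant (map_poly polyC pa) Q.
have lQ : lead_coef Q = (lead_coef q)%:P.
  rewrite lead_coefDl ?lead_coef_map_eq ?polyC_eq0 ?lead_coef_eq0 -?size_poly_gt0 ?(ltnW sq)//.
  rewrite size_polyN size_polyC polyX_eq0.
  rewrite size_map_poly_id0 ?polyC_eq0 ?lead_coef_eq0 -?size_poly_gt0 ?(ltnW sq)//.
have NE (K : fieldType) (g : {rmorphism rat -> K}) z :
    root (map_poly g N) z = (1 < size (gcdp (map_poly g pa) (map_poly g q - z%:P)))%N.
  rewrite rootE -[LHS]/((horner_eval z \o map_poly g) N == 0) map_resultant.
  - rewrite resultant_eq0 -!map_poly_comp; congr (_ < size (gcdp _ _))%N.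
      by apply: eq_map_poly => c /=; rewrite map_polyC /horner_eval hornerC.
    rewrite rmorphB /= -map_poly_comp map_polyC /= map_polyX /horner_eval hornerX.
    by congr (_ - _); apply: eq_map_poly => c /=; rewrite map_polyC hornerC.
  - rewrite lead_coef_map_eq ?polyC_eq0 ?lead_coef_eq0 ?monic_neq0//=.
    by rewrite map_polyC /horner_eval hornerC fmorph_eq0 lead_coef_eq0 monic_neq0.
  - rewrite lQ /= map_polyC /horner_eval hornerC fmorph_eq0 lead_coef_eq0.
    by rewrite -size_poly_gt0 ltnW.
have : root (map_poly ratr N) y.
  apply: (@root_dvdp _ (map_poly ratr p)) => //; rewrite dvdp_map minx// NE.
  apply: (@root_size_gt1 _ a).
    by rewrite gcdp_eq0 map_poly_eq0 (negPf (monic_neq0 mon_pa)).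
  by rewrite root_gcd ra rootE /= hornerD hornerN hornerC -qE subrr eqxx.
rewrite NE => /gtn_eqF/negbT/closed_rootP[b].
rewrite root_gcd => /andP[pab]; rewrite rootE hornerD hornerN hornerC subr_eq0 => /eqP qb.
have [tau tauE] := num_field_morphism gen mina pab.
by exists tau; rewrite qE tauE.
Qed.

(** Gauss's lemma: the minimal polynomial over the rationals divides a monic integer polynomial,
    hence has integer coefficients. *)
Lemma int_min_poly (k : fieldExtType rat) (x : k) :
  integralOver (intr : int -> k) x ->
  exists p : {poly int}, [/\ p \is monic,
    irreducible_poly (map_poly intr p : {poly rat}),
    root (map_poly intr p) x &
    forall (C : numClosedFieldType) (y : C), root (map_poly intr p) y ->
      exists tau : {rmorphism k -> C}, tau x = y].
Proof.
move=> [f mon_f fx]; have [p [mon_p irr_p px minx]] := rat_min_poly x.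
have ratE (K : numFieldType) (q : {poly int}) :
    map_poly intr q = map_poly ratr (map_poly intr q : {poly rat}) :> {poly K}.
  by rewrite -map_poly_comp; apply: eq_map_poly => z /=; rewrite ratr_int.
have algE (q : {poly int}) :
    map_poly intr q = map_poly (in_alg k) (map_poly intr q : {poly rat}).
  by rewrite -map_poly_comp; apply: eq_map_poly => z /=; rewrite alg_num_field ratr_int.
have /dvdpP_rat_int[p1 [c c0 pE] [r fE]] : p %| map_poly intr f.
  by apply: minx; rewrite -algE.
have : lead_coef p1 * lead_coef r = 1 by rewrite -lead_coefM -fE (monicP mon_f).
have p10 : (lead_coef p1)%:~R != 0 :> rat.
  rewrite intr_eq0 lead_coef_eq0; apply: contraTneq (monic_neq0 mon_p) => p10.
  by rewrite pE p10 rmorph0 scaler0 eqxx.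
have lp : c * (lead_coef p1)%:~R = 1.
  by have := monicP mon_p; rewrite pE lead_coefZ lead_coef_map_eq.
move=> /(ex_intro (fun y => _ * y = 1) _)/unitrPr/orP lp1.
exists (lead_coef p1 *: p1); have pE' : p = map_poly intr (lead_coef p1 *: p1).
  by case: lp1 lp pE => /eqP-> lp ->; rewrite map_polyZ; congr (_ *: _);
    move: lp; rewrite /= ?intrN !rmorph1 ?mulrN ?mulr1 // => <-; rewrite opprK.
split; rewrite -?pE'//.
- by rewrite monicE lead_coefZ; case: lp1 => /eqP->.
- by rewrite algE -pE'.
- by move=> C y; rewrite ratE -pE'; apply: num_field_conjugate.
Qed.

(** * Subgroups of finite index *)

Lemma nat_pigeonhole (T : Type) (f : nat -> T) : finite_set (range f) ->
  exists i j, (i < j)%N /\ f i = f j.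
Proof.
move=> fin; have [injf|] := pselect (injective f).
  by have := infinite_nat; rewrite -(eq_finite_set (inj_card_eq (in2W injf))).
move=> /existsNP[i /existsNP[j /not_implyP[fij /eqP ij]]].
by have := ij; rewrite neq_ltn => /orP[] lt; [exists i, j|exists j, i].
Qed.

Section FiniteIndex.
Variable gT : groupType.
Implicit Types G H K S : set gT.
Local Open Scope group_scope.

Lemma subgroupM G x y : is_subgroup G -> G x -> G y -> G (x * y).
Proof.
move=> [G1 GV] Gx Gy; rewrite -[y]invgK; apply: (GV) => //.
by rewrite -(mul1g y^-1); apply: GV.
Qed.

Lemma subgroupV G x : is_subgroup G -> G x -> G x^-1.
Proof. by move=> [G1 GV] Gx; rewrite -(mul1g x^-1); apply: GV. Qed.

Lemma subgroupX G x n : is_subgroup G -> G x -> G (x ^+ n).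
Proof.
move=> sG Gx; elim: n => [|n IH]; first by rewrite expg0; case: sG.
by rewrite expgS; apply: subgroupM.
Qed.

Lemma generated_subgroup S : is_subgroup (generated S).
Proof.
split=> [H [[H1 _] _]//|x y Gx Gy H HS].
by case: (HS) => -[_ HV] _; apply: HV; [apply: Gx|apply: Gy].
Qed.

Lemma generated_sub S : S `<=` generated S.
Proof. by move=> x Sx H [_]; apply. Qed.

Lemma generated_min S H : is_subgroup H -> S `<=` H -> generated S `<=` H.
Proof. by move=> sH SH x; apply. Qed.

Lemma generated_ind S (P : gT -> Prop) :
  (forall x, S x -> S x^-1) -> P 1 ->
  (forall s x, S s -> P x -> P (s * x)) ->
  forall x, generated S x -> P x.
Proof.
move=> SV P1 PM x Gx.
(* Elements whose translation, in both directions, preserves [P]: unlike [P] itself, this is visibly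
   a subgroup. *)
pose H := [set y | forall z, P z -> P (y * z) /\ P (y^-1 * z)].
suff [sH SH] : is_subgroup H /\ S `<=` H.
  by have [] := generated_min sH SH Gx _ P1; rewrite mulg1.
split; last by move=> s Ss z Pz; split; apply: PM => //; apply: SV.
split=> [z Pz|y z Hy Hz w Pw]; first by rewrite invg1 mul1g.
rewrite invgM invgK -!mulgA; split.
  by apply: (Hy _ _).1; apply: (Hz _ Pw).2.
by apply: (Hz _ _).1; apply: (Hy _ Pw).2.
Qed.

Lemma coset_eqP H x y : is_subgroup H ->
  [set x * h | h in H] = [set y * h | h in H] -> H (x^-1 * y).
Proof.
move=> sH /(congr1 (fun A => A y)) e.
have : [set x * h | h in H] y by rewrite e; exists 1; rewrite ?mulg1; case: sH.
by move=> [h Hh <-]; rewrite mulKg.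
Qed.

Lemma eq_coset H x y : is_subgroup H -> H (x^-1 * y) ->
  [set x * h | h in H] = [set y * h | h in H].
Proof.
move=> sH Hxy; apply/seteqP; split=> z [h Hh <-].
  exists (y^-1 * x * h); last by rewrite -!mulgA mulVKg.
  by apply: subgroupM => //; rewrite -[y^-1 * x]invgK invgM invgK; apply: subgroupV.
by exists (x^-1 * y * h); [apply: subgroupM|rewrite -!mulgA mulVKg].
Qed.

Lemma finite_index_power H G x : finite_index_subgroup H G ->
  (forall n, G (x ^+ n)) -> exists2 n, (0 < n)%N & H (x ^+ n).
Proof.
move=> [sH HG fin] Gx; pose F n := [set (x ^+ n) * h | h in H].
have finF : finite_set (range F).
  by apply: sub_finite_set fin => _ [n _ <-]; exists (x ^+ n).
have [i [j [ltij Fij]]] := nat_pigeonhole finF.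
exists (j - i)%N; first by rewrite subn_gt0.
by have := coset_eqP sH Fij; rewrite -{1}(subnKC (ltnW ltij)) expgnDr mulKg.
Qed.

(** A coset of the intersection is the intersection of two cosets, of which there are finitely many
    pairs. *)
Lemma finite_indexI H K G : finite_index_subgroup H G ->
  finite_index_subgroup K G -> finite_index_subgroup (H `&` K) G.
Proof.
move=> [sH HG finH] [sK KG finK].
have sHK : is_subgroup (H `&` K).
  split; first by split; [case: sH|case: sK].
  by move=> x y [Hx Kx] [Hy Ky]; split; [apply: sH.2|apply: sK.2].
split=> // [x [/HG]//|].
apply: (sub_finite_set _ (finite_image2 (fun X Y => X `&` Y) finH finK)).
move=> _ [x Gx <-]; exists [set x * h | h in H]; first by exists x.
exists [set x * h | h in K]; first by exists x.
apply/seteqP; split=> z.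
  by move=> [[h Hh hz] [h' Kh' h'z]]; exists h => //; split=> //; rewrite -(mulgI _ _ _ (etrans h'z (esym hz))).
by move=> [h [Hh Kh] <-]; split; exists h.
Qed.

Lemma finite_index_conj H G g : is_subgroup G -> G g ->
  finite_index_subgroup H G ->
  finite_index_subgroup [set x | H (x ^ g)] G.
Proof.
move=> sG Gg [sH HG finH].
have sHg : is_subgroup [set x | H (x ^ g)].
  split=> /= [|x y Hx Hy]; first by rewrite conj1g; case: sH.
  by rewrite conjMg conjVg; apply: sH.2.
split=> // [x /HG|].
  move=> Gxg; rewrite -(conjgK g x) conjgE invgK.
  by apply: subgroupM => //; apply: subgroupM => //; apply: subgroupV.
apply: (sub_finite_set _ (finite_image (fun X : set gT => [set z * g^-1 | z in X]) finH)).
move=> _ [x Gx <-]; exists [set (x * g) * h | h in H].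
  by exists (x * g) => //; apply: subgroupM.
apply/seteqP; split=> z.
  move=> [_ [h Hh <-] <-]; exists (g * h * g^-1) => /=.
    by rewrite conjgE !mulgA mulVg mul1g mulgVK.
  by rewrite !mulgA.
move=> [h Hh <-]; exists (x * g * (h ^ g)); first by exists (h ^ g).
by rewrite conjgE !mulgA mulgK mulgK.
Qed.

End FiniteIndex.

(** * Half-turns and traces *)

Section Matrices2.
Variable F : comNzRingType.
Implicit Types A B : 'M[F]_2.

Definition mx2 (a b c d : F) : 'M[F]_2 :=
  \matrix_(i < 2, j < 2) if i == 0 then (if j == 0 then a else b)
                         else (if j == 0 then c else d).

Definition cv2 (a b : F) : 'cV[F]_2 := \col_(i < 2) if i == 0 then a else b.

Lemma ord2P (i : 'I_2) : i = 0 \/ i = 1.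
Proof. by case: i => -[|[|//]] lt; [left|right]; apply: val_inj. Qed.

Lemma eq_mx2 A B : A 0 0 = B 0 0 -> A 0 1 = B 0 1 -> A 1 0 = B 1 0 ->
  A 1 1 = B 1 1 -> A = B.
Proof.
move=> e00 e01 e10 e11; apply/matrixP => i j.
by case: (ord2P i) (ord2P j) => -> [] ->.
Qed.

Lemma eq_cv2 (u v : 'cV[F]_2) : u 0 0 = v 0 0 -> u 1 0 = v 1 0 -> u = v.
Proof. by move=> e0 e1; apply/colP => i; case: (ord2P i) => ->. Qed.

Lemma sum_ord2 (V : nmodType) (f : 'I_2 -> V) : \sum_i f i = f 0 + f 1.
Proof.
rewrite !big_ord_recl big_ord0 addr0; congr (f _ + f _).
exact: val_inj.
Qed.

Lemma mx2E A : A = mx2 (A 0 0) (A 0 1) (A 1 0) (A 1 1).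
Proof. by apply: eq_mx2; rewrite !mxE. Qed.

Lemma cv2E (u : 'cV[F]_2) : u = cv2 (u 0 0) (u 1 0).
Proof. by apply: eq_cv2; rewrite !mxE. Qed.

Lemma mulmx2E n p (A : 'M[F]_(n, 2)) (B : 'M[F]_(2, p)) i j :
  (A *m B) i j = A i 0 * B 0 j + A i 1 * B 1 j.
Proof. by rewrite mxE sum_ord2. Qed.

Lemma mxtrace2 A : \tr A = A 0 0 + A 1 1.
Proof. exact: sum_ord2. Qed.

Lemma det2 A : \det A = A 0 0 * A 1 1 - A 0 1 * A 1 0.
Proof.
rewrite (expand_det_row _ 0) sum_ord2 /cofactor !det_mx11 !mxE /=.
rewrite expr0 mul1r expr1 mulN1r mulrN.
have -> : lift 0 0 = 1 :> 'I_2 by apply: val_inj.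
have -> // : lift 1 0 = 0 :> 'I_2 by apply: val_inj.
Qed.

(** Cayley-Hamilton applied to [v]. The equation keeps [v], since over a mere ring a nonzero vector
    cannot be cancelled. *)
Lemma eigen2 A (v : 'cV[F]_2) e : A *m v = e *: v ->
  (e ^+ 2 - \tr A * e + \det A) *: v = 0.
Proof.
move=> Av; have := congr1 (fun u : 'cV_2 => u 0 0) Av.
have := congr1 (fun u : 'cV_2 => u 1 0) Av; rewrite /= !mulmx2E !mxE => e1 e0.
apply: eq_cv2; rewrite mxtrace2 det2 !mxE.
  have -> : (e ^+ 2 - (A 0 0 + A 1 1) * e + (A 0 0 * A 1 1 - A 0 1 * A 1 0)) * v 0 0 =
    (A 0 0 * v 0 0 + A 0 1 * v 1 0 - e * v 0 0) * (A 1 1 - e)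
    - A 0 1 * (A 1 0 * v 0 0 + A 1 1 * v 1 0 - e * v 1 0) by ring.
  by rewrite e1 e0 !subrr mul0r mulr0 subr0.
have -> : (e ^+ 2 - (A 0 0 + A 1 1) * e + (A 0 0 * A 1 1 - A 0 1 * A 1 0)) * v 1 0 =
    (A 1 0 * v 0 0 + A 1 1 * v 1 0 - e * v 1 0) * (A 0 0 - e)
    - A 1 0 * (A 0 0 * v 0 0 + A 0 1 * v 1 0 - e * v 0 0) by ring.
by rewrite e1 e0 !subrr mul0r mulr0 subr0.
Qed.

Lemma addmxE m n (A B : 'M[F]_(m, n)) i j : (A + B) i j = A i j + B i j.
Proof. by rewrite mxE. Qed.

Lemma oppmxE m n (A : 'M[F]_(m, n)) i j : (- A) i j = - A i j.
Proof. by rewrite mxE. Qed.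

Lemma scalemxE m n (a : F) (A : 'M[F]_(m, n)) i j : (a *: A) i j = a * A i j.
Proof. by rewrite mxE. Qed.

Lemma zeromxE m n i j : (0 : 'M[F]_(m, n)) i j = 0.
Proof. by rewrite mxE. Qed.

Lemma scalar_mx2E (a : F) : (((a%:M : 'M[F]_2) 0 0 = a) * ((a%:M : 'M[F]_2) 0 1 = 0)) *
  (((a%:M : 'M[F]_2) 1 0 = 0) * ((a%:M : 'M[F]_2) 1 1 = a)).
Proof. by rewrite !mxE. Qed.

Lemma mx2_entries (a b c d : F) : ((mx2 a b c d 0 0 = a) * (mx2 a b c d 0 1 = b)) *
  ((mx2 a b c d 1 0 = c) * (mx2 a b c d 1 1 = d)).
Proof. by rewrite !mxE. Qed.

Lemma cv2_entries (a b : F) : (cv2 a b 0 0 = a) * (cv2 a b 1 0 = b).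
Proof. by rewrite !mxE. Qed.

Definition entriesE := (mx2_entries, cv2_entries, scalar_mx2E, addmxE, oppmxE,
  scalemxE, zeromxE, mulmx2E).

End Matrices2.

Ltac mx2 := rewrite ?entriesE.

Section Axes.
Variable R : realType.
Local Notation C := R[i].
Implicit Types (M N : SL2 R) (p q : sphere R) (l : oriented_line R).

Lemma sl2_mulE M N : sl2_mx (M * N)%g = sl2_mx M *m sl2_mx N.
Proof. by []. Qed.

Lemma sl2_oneE : sl2_mx (1%g : SL2 R) = 1%:M.
Proof. by []. Qed.

Lemma sl2_invE M : sl2_mx M^-1%g = invmx (sl2_mx M).
Proof. by []. Qed.

Lemma sl2_inj M N : sl2_mx M = sl2_mx N -> M = N.
Proof. exact: val_inj. Qed.

Lemma psl2_projM M N : psl2_proj (M * N)%g = (psl2_proj M * psl2_proj N)%g.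
Proof. exact/esym/psl2_mulE. Qed.

Lemma psl2_projV M : psl2_proj M^-1%g = (psl2_proj M)^-1%g.
Proof. exact/esym/psl2_invE. Qed.

(** Homogeneous coordinates: [mobius], with its cases at infinity, becomes multiplication of
    matrices up to a nonzero scalar. *)
Definition sphere_vec p : 'cV[C]_2 := if p is Some z then cv2 z 1 else cv2 1 0.

Lemma sphere_vec_neq0 p : sphere_vec p != 0.
Proof.
apply/eqP => /colP; case: p => [z|] e.
  by have /eqP := e 1; rewrite !mxE /= oner_eq0.
by have /eqP := e 0; rewrite !mxE /= oner_eq0.
Qed.

Lemma mobius_vec M p : exists2 z : C, z != 0 &
  sl2_mx M *m sphere_vec p = z *: sphere_vec (mobius M p).
Proof.
have nz (v : 'cV[C]_2) : v != 0 -> sl2_mx M *m v != 0.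
  apply: contraNneq => Mv0; rewrite -[v](mulKmx (unitmx_sl2 M)) Mv0 mulmx0//.
have := nz _ (sphere_vec_neq0 p); rewrite [_ *m _]cv2E => nz0.
have scale0 (a : C) : cv2 a 0 = a *: cv2 1 0.
  by apply: eq_cv2; mx2; rewrite ?mulr1 ?mulr0.
have scale1 (a b : C) : b != 0 -> cv2 a b = b *: cv2 (a / b) 1.
  by move=> b0; apply: eq_cv2; mx2; rewrite ?mulr1// mulrC divfK.
move: nz0; rewrite /mobius; case: p => [z|] /=; rewrite !mulmx2E !mxE /= ?mulr1 ?mulr0 ?addr0.
  have [->|d0] := eqVneq (sl2_mx M 1 0 * z + sl2_mx M 1 1) 0; last first.
    by move=> _; exists (sl2_mx M 1 0 * z + sl2_mx M 1 1); [exact: d0|exact: scale1 d0].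
  rewrite scale0 => nz0; exists (sl2_mx M 0 0 * z + sl2_mx M 0 1) => //.
  by apply: contraNneq nz0 => ->; rewrite scale0r.
have [->|d0] := eqVneq (sl2_mx M 1 0) 0; last first.
  by move=> _; exists (sl2_mx M 1 0); [exact: d0|exact: scale1 d0].
rewrite scale0 => nz0; exists (sl2_mx M 0 0) => //.
by apply: contraNneq nz0 => ->; rewrite scale0r.
Qed.

Lemma mx_eq_on_vec (u v : 'cV[C]_2) (A B : 'M[C]_2) :
  u 0 0 * v 1 0 != v 0 0 * u 1 0 -> A *m u = B *m u -> A *m v = B *m v -> A = B.
Proof.
move=> uv Au Av; pose P := mx2 (u 0 0) (v 0 0) (u 1 0) (v 1 0).
have uP : P \in unitmx by rewrite unitmxE det2 unitfE !mxE /= subr_eq0.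
rewrite -[A](mulmxK uP) -[B](mulmxK uP); congr (_ *m _).
have := congr1 (fun w : 'cV_2 => w 0 0) Au; have := congr1 (fun w : 'cV_2 => w 1 0) Au.
have := congr1 (fun w : 'cV_2 => w 0 0) Av; have := congr1 (fun w : 'cV_2 => w 1 0) Av.
by rewrite /= !mulmx2E => *; apply: eq_mx2; rewrite !mulmx2E !mxE.
Qed.

(** Selects one of the two lifts of a half-turn: reversing the line exchanges the eigenvalues and so
    changes the sign of the matrix. *)
Definition axis_mx l M :=
  sl2_mx M *m sphere_vec (line_head l) = 'i *: sphere_vec (line_head l) /\
  sl2_mx M *m sphere_vec (line_tail l) = - 'i *: sphere_vec (line_tail l).

Lemma eigen_sphere_vec M p z : sl2_mx M *m sphere_vec p = z *: sphere_vec p ->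
  z ^+ 2 - \tr (sl2_mx M) * z + 1 = 0.
Proof.
move=> /eigen2/eqP; rewrite scaler_eq0 (negPf (sphere_vec_neq0 p)) orbF det_sl2.
by move/eqP.
Qed.

Lemma conj_eigen_sphere_vec (g M : SL2 R) p z :
  sl2_mx M *m sphere_vec p = z *: sphere_vec p ->
  sl2_mx (g * M * g^-1)%g *m sphere_vec (mobius g p) = z *: sphere_vec (mobius g p).
Proof.
move=> Mp; have [c c0 gp] := mobius_vec g p.
have gp' : sphere_vec (mobius g p) = c^-1 *: (sl2_mx g *m sphere_vec p).
  by rewrite gp scalerA mulVf// scale1r.
rewrite gp' -scalemxAr !sl2_mulE sl2_invE -!mulmxA mulKmx ?unitmx_sl2//.
by rewrite Mp -scalemxAr !scalerA mulrC.
Qed.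

Lemma expC_imag (y : R) : expC (0 +i* y) = cos y +i* sin y.
Proof. by rewrite /expC /= expR0 mul1r. Qed.

Lemma half_imag (y : R) : y *i / 2 = 0 +i* (y / 2).
Proof.
have imE (z : R) : z *i = z%:C * 'i%C.
  by apply/eqP; rewrite eq_complex /= !(mul0r, mulr0, mulr1, addr0, subr0) !eqxx.
by rewrite imE (imE (y / 2)) mulrAC rmorphM fmorphV rmorph_nat.
Qed.

Lemma expC_half_pi : expC (pi *i / 2) = 'i :> C.
Proof. by rewrite half_imag expC_imag cos_pihalf sin_pihalf complexiE. Qed.

Lemma expC0 : expC (0 / 2) = 1 :> C.
Proof. by rewrite mul0r expC_imag cos0 sin0. Qed.

Lemma half_turn_axis l h : half_turn l h ->
  exists2 M, axis_mx l M & h = psl2_proj M.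
Proof.
move=> [g [g0 goo hE]].
pose S := MkSL2 (screw_mx_det (pi *i : C)).
exists (repr g * S * (repr g)^-1)%g; last first.
  by rewrite hE !psl2_projM psl2_projV psl2_reprK.
rewrite /axis_mx -g0 -goo; split; apply: conj_eigen_sphere_vec;
  rewrite /S /screw_mx /= mul_diag_mx expC_half_pi; apply: eq_cv2; rewrite !mxE /=.
- by [].
- by rewrite !mulr0.
- by rewrite !mulr0.
- by rewrite mulr1 mulr1 invCi.
Qed.

(** Twice the hyperbolic cosine of [mu], written with the entries of [screw_mx mu]. *)
Definition pair_trace (mu : C) : C := expC (mu / 2) ^+ 2 + (expC (mu / 2))^-1 ^+ 2.

Lemma axis_trace0 l M : axis_mx l M -> \tr (sl2_mx M) = 0.
Proof.
move=> [/eigen_sphere_vec e _]; apply: (mulIf (neq0Ci _)); rewrite mul0r.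
by move/eqP: e; rewrite sqrCi addrAC addNr sub0r oppr_eq0 => /eqP.
Qed.

Lemma axis_mx_conj l M g : axis_mx l M ->
  sl2_mx (g * M * g^-1)%g *m sphere_vec (mobius g (line_head l)) =
    'i *: sphere_vec (mobius g (line_head l)) /\
  sl2_mx (g * M * g^-1)%g *m sphere_vec (mobius g (line_tail l)) =
    - 'i *: sphere_vec (mobius g (line_tail l)).
Proof. by move=> [h t]; split; apply: conj_eigen_sphere_vec. Qed.

Lemma mobius_screw (mu z : C) : mobius (MkSL2 (screw_mx_det mu)) (Some z) =
  Some (expC (mu / 2) ^+ 2 * z).
Proof.
rewrite /mobius /= !mxE /= !mulr0n !mulr1n mul0r add0r addr0.
by rewrite invr_eq0 (negPf (expC_neq0 _)) invrK mulrAC -expr2.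
Qed.

Lemma complex_distance_trace l1 l2 mu M1 M2 :
  complex_distance l1 l2 mu -> axis_mx l1 M1 -> axis_mx l2 M2 ->
  \tr (sl2_mx (M1 * M2)%g) = - pair_trace mu.
Proof.
move=> [_ _ [[g [t1 h1 t2 h2]]|as_d]] a1 a2; last first.
  (* A common endpoint gives a common eigenvector, on which the product of the lifts has eigenvalue
     -1 or 1 according to the orientations; as its determinant is 1, its trace is -2 or 2. *)
  have e12 p z1 z2 : sl2_mx M1 *m sphere_vec p = z1 *: sphere_vec p ->
      sl2_mx M2 *m sphere_vec p = z2 *: sphere_vec p ->
      (z1 * z2) ^+ 2 - \tr (sl2_mx (M1 * M2)%g) * (z1 * z2) + 1 = 0.
    move=> e1 e2; apply: (@eigen_sphere_vec _ p).
    by rewrite sl2_mulE -mulmxA e2 -scalemxAr e1 scalerA mulrC.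
  have ii : 'i * 'i = -1 :> C by rewrite -expr2 sqrCi.
  move: a1 a2 => [a1h a1t] [a2h a2t]; rewrite /pair_trace.
  case: as_d => -[par ->].
    have -> : \tr (sl2_mx (M1 * M2)%g) = -2.
      move: par; case: eqP => [tt _|_ /= /eqP hh].
        rewrite -tt in a2t; have := e12 _ _ _ a1t a2t; rewrite mulrNN ii => e.
        by apply/eqP; rewrite -subr_eq0 -e; apply/eqP; ring.
      rewrite -hh in a2h; have := e12 _ _ _ a1h a2h; rewrite ii => e.
      by apply/eqP; rewrite -subr_eq0 -e; apply/eqP; ring.
    by rewrite expC0 invr1 !expr1n.
  have -> : \tr (sl2_mx (M1 * M2)%g) = 2.
    move: par; case: eqP => [th _|_ /= /eqP ht].
      rewrite -th in a2h; have := e12 _ _ _ a1t a2h; rewrite mulNr ii opprK => e.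
      by apply/eqP; rewrite -subr_eq0 -oppr_eq0 -e; apply/eqP; ring.
    rewrite -ht in a2t; have := e12 _ _ _ a1h a2t; rewrite mulrN ii opprK => e.
    by apply/eqP; rewrite -subr_eq0 -oppr_eq0 -e; apply/eqP; ring.
  by rewrite expC_half_pi exprVn sqrCi invrN invr1 opprD !opprK.
(* After conjugation by [g] the lines run from -1 to 1 and from [- exp mu] to [exp mu]; the
   eigenvectors then determine both matrices explicitly. *)
have {a1}[a1h a1t] := axis_mx_conj (repr g) a1.
have {a2}[a2h a2t] := axis_mx_conj (repr g) a2.
move: a1h a1t a2h a2t; rewrite -!/(psl2_act g _) h1 t1 h2 t2 !psl2_act_proj.
rewrite !mobius_screw mulr1 mulrN1 /pair_trace.
have := expC_neq0 (mu / 2); move: (expC (mu / 2)) => w w0.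
set N1 := sl2_mx _; set N2 := sl2_mx (_ * M2 * _)%g => a1h a1t a2h a2t.
have two0 : 2 != 0 :> C by rewrite pnatr_eq0.
have N1E : N1 = mx2 0 'i 'i 0.
  apply: (mx_eq_on_vec _ (etrans a1h _) (etrans a1t _)).
  - by rewrite !mxE /= mulr1 mulN1r -subr_eq0 opprK.
  - by apply: eq_cv2; mx2; ring.
  - by apply: eq_cv2; mx2; ring.
have N2E : N2 = mx2 0 ('i * w ^+ 2) ('i * w^-1 ^+ 2) 0.
  apply: (mx_eq_on_vec _ (etrans a2h _) (etrans a2t _)).
  - by rewrite !mxE /= !mulr1 -subr_eq0 opprK -mulr2n -mulr_natr mulf_neq0// expf_neq0.
  - by apply: eq_cv2; mx2; field.
  - by apply: eq_cv2; mx2; field.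
have -> : \tr (sl2_mx (M1 * M2)%g) = \tr (N1 *m N2).
  rewrite /N1 /N2 -sl2_mulE -!mulgA mulKg !mulgA [in RHS]sl2_mulE.
  rewrite [RHS]mxtrace_mulC -sl2_mulE.
  by rewrite !mulgA mulVg mul1g.
rewrite N1E N2E mxtrace2; mx2.
have -> : 0 * 0 + 'i * ('i * w^-1 ^+ 2) + ('i * ('i * w ^+ 2) + 0 * 0) =
   'i ^+ 2 * (w ^+ 2 + w^-1 ^+ 2) by ring.
by rewrite sqrCi mulN1r.
Qed.

Lemma regular_triangle_lift G : regular_triangle_group G ->
  exists (A B D : SL2 R) (x : C),
    [/\ \tr (sl2_mx A) = 0, \tr (sl2_mx B) = 0 & \tr (sl2_mx D) = 0] /\
    [/\ \tr (sl2_mx (A * B)%g) = - x, \tr (sl2_mx (A * D)%g) = - x,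
        \tr (sl2_mx (B * D)%g) = - x &
        G = generated [set psl2_proj A; psl2_proj B; psl2_proj D]].
Proof.
move=> [a [b [c [la [lb [lc [ta tb tc [mu [ab ac cb]] ->]]]]]]].
have [A axA ->] := half_turn_axis ta; have [B axB ->] := half_turn_axis tb.
have [D axD ->] := half_turn_axis tc.
exists A, B, D, (pair_trace mu); split.
  by rewrite (axis_trace0 axA) (axis_trace0 axB) (axis_trace0 axD).
split=> //.
- exact: complex_distance_trace ab axA axB.
- exact: complex_distance_trace ac axA axD.
- by rewrite sl2_mulE mxtrace_mulC; apply: complex_distance_trace cb axD axB.
Qed.

End Axes.

(** * Ping-pong *)

Section StandardTriangle.
Variable C : numClosedFieldType.
Implicit Types (s u w : C) (v : 'cV[C]_2) (M : 'M[C]_2).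

(** In the coordinate [t = u z - s] this is [t |-> -1/t]. The rotations of order 3 about the line
    from 0 to infinity permute the three matrices with [u^3 = 1]; the product of two different ones
    has trace [1 + 3 s^2]. *)
Definition std_mx s u : 'M[C]_2 := mx2 s (u ^+ 2 * (-1 - s ^+ 2)) u (- s).

Lemma std_mx_sqr s u : u ^+ 3 = 1 -> std_mx s u *m std_mx s u = - 1%:M.
Proof.
move=> u3; have e : s * s + u ^+ 2 * (-1 - s ^+ 2) * u = -1.
  have -> : s * s + u ^+ 2 * (-1 - s ^+ 2) * u = -1 - (u ^+ 3 - 1) * (1 + s ^+ 2) by ring.
  by rewrite u3 subrr mul0r subr0.
apply: eq_mx2; mx2; rewrite ?mulr1n ?mulr0n ?oppr0 ?e//; try ring.
by rewrite -[RHS]e; ring.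
Qed.

Lemma norm_cube_root u : u ^+ 3 = 1 -> `|u| = 1.
Proof.
move=> u3; apply/eqP; rewrite -(@pexpr_eq1 _ _ 3)//.
by rewrite -normrX u3 normr1.
Qed.

(** The squares of the cube roots of unity are the vertices of an equilateral triangle in the unit
    circle, with side [sqrt 3]. *)
Lemma cube_root_dist u u' : u ^+ 3 = 1 -> u' ^+ 3 = 1 -> u != u' ->
  `|u ^+ 2 - u' ^+ 2| ^+ 2 = 3.
Proof.
move=> u3 u'3 uu'.
have e : u ^+ 2 + u * u' + u' ^+ 2 = 0.
  have : (u - u') * (u ^+ 2 + u * u' + u' ^+ 2) = 0.
    have -> : (u - u') * (u ^+ 2 + u * u' + u' ^+ 2) = u ^+ 3 - u' ^+ 3 by ring.
    by rewrite u3 u'3 subrr.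
  by move/eqP; rewrite mulf_eq0 subr_eq0 (negPf uu') => /eqP.
rewrite -normrX.
have -> : (u ^+ 2 - u' ^+ 2) ^+ 2 = -3 * u ^+ 2 * u' ^+ 2 +
   (u ^+ 2 + u * u' + u' ^+ 2) * (u ^+ 2 - u * u' + u' ^+ 2) by ring.
rewrite e mul0r addr0 2!normrM normrN 2!normrX (norm_cube_root u3) (norm_cube_root u'3).
by rewrite !expr1n !mulr1 normr_nat.
Qed.

(** Normal forms of the free product of three groups of order 2. The option records the leftmost
    letter, against which the next letter is compared. *)
Inductive reduced_word s : option C -> 'M[C]_2 -> Prop :=
| reduced_nil : reduced_word s None 1%:M
| reduced_cons u o M : u ^+ 3 = 1 -> o <> Some u -> reduced_word s o M ->
    reduced_word s (Some u) (std_mx s u *m M).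

(* The half-turn [std_mx s u] exchanges the interior and the exterior of the disc
   with centre [s u^2] and radius 1; [v] represents the point [v 0 0 / v 1 0]. *)
Definition inside s u v := `|u * v 0 0 - s * v 1 0| < `|v 1 0|.
Definition outside s u v := `|v 1 0| < `|u * v 0 0 - s * v 1 0|.

(** Two equal adjacent letters cancel to -1 rather than 1, so the words are closed under
    multiplication only up to sign. *)
Lemma reduced_word_mul s u o M : u ^+ 3 = 1 -> reduced_word s o M ->
  exists o' M', reduced_word s o' M' /\
    (std_mx s u *m M = M' \/ std_mx s u *m M = - M').
Proof.
move=> u3; case=> [|u' o' M' u'3 o'u' rM'].
  by exists (Some u), (std_mx s u *m 1%:M); split; [exact: reduced_cons u3 _ (reduced_nil s)|left].
have [<-|uu'] := eqVneq u u'.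
  by exists o', M'; split=> //; right; rewrite mulmxA std_mx_sqr// mulNmx mul1mx.
exists (Some u), (std_mx s u *m (std_mx s u' *m M')); split; last by left.
apply: reduced_cons u3 _ (reduced_cons u'3 o'u' rM') => -[/esym/eqP].
by apply/negP.
Qed.

Lemma std_mx_inside s u v : u ^+ 3 = 1 -> outside s u v -> inside s u (std_mx s u *m v).
Proof.
rewrite /outside /inside => u3; mx2.
have -> : u * (s * v 0 0 + u ^+ 2 * (-1 - s ^+ 2) * v 1 0) -
   s * (u * v 0 0 + - s * v 1 0) = - v 1 0 - (u ^+ 3 - 1) * (1 + s ^+ 2) * v 1 0 by ring.
by rewrite u3 subrr !mul0r subr0 normrN mulNr.
Qed.

(** The centres [s u^2] and [s u'^2] are at distance [sqrt 3 |s|], which is more than 2, so the two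
    discs of radius 1 are disjoint. *)
Lemma inside_outside s u u' v : 4 < `|3 * s ^+ 2| ->
  u ^+ 3 = 1 -> u' ^+ 3 = 1 -> u != u' -> inside s u' v -> outside s u v.
Proof.
move=> s4 u3 u'3 uu'; rewrite /inside /outside.
have scale z : z ^+ 3 = 1 -> `|z * v 0 0 - s * v 1 0| = `|v 0 0 - s * z ^+ 2 * v 1 0|.
  move=> z3; rewrite -[RHS]mul1r -(norm_cube_root z3) -normrM; congr `|_|.
  have -> : z * (v 0 0 - s * z ^+ 2 * v 1 0) = z * v 0 0 - z ^+ 3 * s * v 1 0 by ring.
  by rewrite z3 mul1r.
rewrite !scale// => ins.
have d2 : 2 < `|s| * `|u ^+ 2 - u' ^+ 2|.
  rewrite -(@ltr_pXn2r _ 2)// ?nnegrE ?mulr_ge0//.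
  rewrite exprMn cube_root_dist// -[3]normr_nat -normrX -normrM mulrC.
  by rewrite -natrX.
have : `|s * (u ^+ 2 - u' ^+ 2) * v 1 0| <=
    `|v 0 0 - s * u ^+ 2 * v 1 0| + `|v 0 0 - s * u' ^+ 2 * v 1 0|.
  rewrite -(normrN (v 0 0 - s * u ^+ 2 * v 1 0)); apply: le_trans (ler_normD _ _).
  by rewrite le_eqVlt; apply/orP; left; apply/eqP; congr `|_|; ring.
rewrite !normrM => le1; have v1 : 0 < `|v 1 0| by apply: le_lt_trans ins.
have := lt_le_trans (_ : 2 * `|v 1 0| < _) le1.
rewrite ltr_pM2r// => /(_ d2) lt1.
have := lt_trans lt1 (_ : _ < `|v 0 0 - s * u ^+ 2 * v 1 0| + `|v 1 0|).
by rewrite ltrD2l mulrDl mul1r ltrD2r; apply.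
Qed.

(** Ping-pong: every letter takes the disc of the preceding letter, which lies outside its own disc,
    into its own disc. *)
Lemma reduced_word_inside s u M v : 4 < `|3 * s ^+ 2| ->
  (forall u, u ^+ 3 = 1 -> outside s u v) ->
  reduced_word s (Some u) M -> inside s u (M *m v).
Proof.
move=> s4 outv; move: {-2}(Some u) (erefl (Some u)) => o oE rM.
elim: rM u oE => [//|u o' M' u3 o'u rM' IH] _ [<-]; rewrite -mulmxA.
apply: std_mx_inside => //; case: rM' o'u IH => [|u' o'' M'' u'3 _ _] o'u IH.
  by rewrite mul1mx; apply: outv.
apply: (inside_outside (u' := u')) (IH _ erefl) => //.
by apply: contra_not_neq o'u => ->.
Qed.

Lemma reduced_word_eigen s o M v e : 4 < `|3 * s ^+ 2| ->
  (forall u, u ^+ 3 = 1 -> outside s u v) ->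
  reduced_word s o M -> M *m v = e *: v -> M = 1%:M.
Proof.
move=> s4 outv rM Mv; case: o rM => [u rM|]; last first.
  by move: {-2}None (erefl (@None C)) => o oE rM; case: rM oE.
have u3 : u ^+ 3 = 1.
  by move: {-2}(Some u) (erefl (Some u)) rM => o oE rM; case: rM oE => // u' o' M' u3 _ _ [<-].
have := reduced_word_inside s4 outv rM; rewrite Mv /inside !mxE.
have -> : u * (e * v 0 0) - s * (e * v 1 0) = e * (u * v 0 0 - s * v 1 0) by ring.
rewrite !normrM; have [->|e0] := eqVneq e 0; first by rewrite normr0 !mul0r ltxx.
rewrite ltr_pM2l ?normr_gt0// => ins.
by have := lt_trans ins (outv _ u3); rewrite ltxx.
Qed.

End StandardTriangle.

(** * Normal form *)

Section NormalForm.
Variable C : numClosedFieldType.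
Implicit Types (s u w : C) (v : 'cV[C]_2) (A B D M N : 'M[C]_2).

Lemma exists_cube_root : exists w : C, w ^+ 2 + w + 1 = 0.
Proof.
exists ((-1 + 'i * sqrtC 3) / 2).
have -> : ((-1 + 'i * sqrtC 3) / 2) ^+ 2 + (-1 + 'i * sqrtC 3) / 2 + 1 =
   ('i ^+ 2 * sqrtC 3 ^+ 2 + 3) / 4 :> C by field.
by rewrite sqrCi sqrtCK mulN1r addNr mul0r.
Qed.

Lemma cube_root_unity w : w ^+ 2 + w + 1 = 0 -> w ^+ 3 = 1.
Proof.
move=> w0; apply/eqP; rewrite -subr_eq0.
have -> : w ^+ 3 - 1 = (w - 1) * (w ^+ 2 + w + 1) by ring.
by rewrite w0 mulr0.
Qed.

(** A singular [M] has rank at most 1, a column [p] times a row [q]; the scalar [q N p] in the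
    middle of the product is the trace of [M N]. *)
Lemma mx2_sandwich M N : \det M = 0 -> M *m N *m M = \tr (M *m N) *: M.
Proof.
rewrite mxtrace2 det2 => d0; apply/eqP; rewrite -subr_eq0; apply/eqP.
have adj : M *m N *m M - (\tr (M *m N)) *: M =
   - (M 0 0 * M 1 1 - M 0 1 * M 1 0) *: mx2 (N 1 1) (- N 0 1) (- N 1 0) (N 0 0).
  by rewrite mxtrace2; apply: eq_mx2; mx2; ring.
by rewrite -mxtrace2 adj d0 oppr0 scale0r.
Qed.

Lemma mx2_trace_sqr M : \tr (M *m M) = \tr M ^+ 2 - 2 * \det M.
Proof. by rewrite !mxtrace2 det2; mx2; ring. Qed.

Lemma mx2_sqr0 M : \tr M = 0 -> \det M = 0 -> M *m M = 0.
Proof.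
move=> t0 d0; have : M *m M = \tr M *: M - (\det M)%:M.
  by rewrite mxtrace2 det2; apply: eq_mx2; mx2; rewrite ?mulr1n ?mulr0n; ring.
by rewrite t0 d0 scale0r sub0r raddf0 oppr0.
Qed.

Lemma mulmx_cols (X : 'M[C]_2) (p q : 'cV[C]_2) a b c d :
  X *m p = a *: p + c *: q -> X *m q = b *: p + d *: q ->
  X *m mx2 (p 0 0) (q 0 0) (p 1 0) (q 1 0) =
    mx2 (p 0 0) (q 0 0) (p 1 0) (q 1 0) *m mx2 a b c d.
Proof.
move=> Xp Xq; have := congr1 (fun w : 'cV_2 => w 0 0) Xp.
have := congr1 (fun w : 'cV_2 => w 1 0) Xp.
have := congr1 (fun w : 'cV_2 => w 0 0) Xq.
have := congr1 (fun w : 'cV_2 => w 1 0) Xq.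
rewrite /= !entriesE => e1 e2 e3 e4.
by apply: eq_mx2; mx2; rewrite ?e1 ?e2 ?e3 ?e4; ring.
Qed.

(** The columns of [P] are [M v] and [N M v] for any [v] not killed by [M]; [mx2_sandwich] computes
    [M N M v]. *)
Lemma nilpotent_pair_basis M N (t : C) :
  M *m M = 0 -> N *m N = 0 -> \det M = 0 -> \tr (M *m N) = t -> t != 0 ->
  exists2 P : 'M[C]_2, P \in unitmx &
    M *m P = P *m mx2 0 t 0 0 /\ N *m P = P *m mx2 0 0 1 0.
Proof.
move=> MM NN dM tMN t0; have [v vN0] : exists v : 'cV_2, M *m v != 0.
  apply: contrapT => nex; suff M0 : M = 0.
    by move: t0; rewrite -tMN M0 mul0mx mxtrace0 eqxx.
  apply/matrixP => i j; rewrite mxE; apply: contrapT => /eqP Mij; apply: nex.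
  exists (delta_mx j 0); apply: contraNneq Mij => /colP/(_ i).
  by rewrite -colE !mxE => ->.
pose p := M *m v; pose q := N *m p.
have Mp : M *m p = 0 by rewrite /p mulmxA MM mul0mx.
have Nq : N *m q = 0 by rewrite /q mulmxA NN mul0mx.
have Mq : M *m q = t *: p.
  by rewrite /q /p !mulmxA mx2_sandwich// tMN scalemxAl.
pose P := mx2 (p 0 0) (q 0 0) (p 1 0) (q 1 0).
exists P; last first.
  split; apply: mulmx_cols; rewrite ?Mp ?Mq ?Nq ?scale0r ?scale1r ?addr0 ?add0r//.
rewrite unitmxE det2 unitfE; apply: contraNneq vN0; rewrite -/p.
move: p q Mp Nq Mq @P => p q Mp Nq Mq P; rewrite /P; mx2 => d0.
have pq k : q k 0 *: p = p k 0 *: q.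
  move: d0; case: (ord2P k) => -> /eqP; rewrite subr_eq0 => /eqP d0.
    by apply: eq_cv2; mx2; [ring|rewrite d0].
  by apply: eq_cv2; mx2; [rewrite mulrC d0 mulrC|ring].
have p0 k : p k 0 = 0.
  have := congr1 (mulmx M) (pq k); rewrite -!scalemxAr Mp Mq scaler0 scalerA.
  move/esym/eqP; rewrite scaler_eq0 mulf_eq0 (negPf t0) orbF => /orP[/eqP//|/eqP->].
  by rewrite mxE.
by apply/eqP; apply: eq_cv2; rewrite p0 mxE.
Qed.

Lemma fourier3_inversion w w2 : w * w2 = 1 -> w2 * w2 = w -> w ^+ 2 = w2 ->
  1 + w + w2 = 0 -> forall a b d : C,
  3^-1 * (a + b + d) + w2 * (3^-1 * (a + w * b + w2 * d)) +
    w * (3^-1 * (a + w2 * b + w * d)) = b.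
Proof.
move=> ww2 w22 w2E w12 a b d.
have -> : 3^-1 * (a + b + d) + w2 * (3^-1 * (a + w * b + w2 * d)) +
    w * (3^-1 * (a + w2 * b + w * d)) = b + 2 / 3 * b * (w * w2 - 1) +
    d / 3 * ((w2 * w2 - w) + (w ^+ 2 - w2)) + (a + d) / 3 * (1 + w + w2) by field.
by rewrite ww2 w22 w2E w12 !subrr addr0 !mulr0 !addr0.
Qed.

(** For the trace form, the Gram matrix of the three matrices is invariant under cyclic permutation,
    so the Fourier transform diagonalises it: [N] and [M] are isotropic and [S] is orthogonal to
    both. Since [tr (N M) = (x - 2) / 3] is nonzero, a change of basis turns [N] and [M] into
    multiples of elementary matrices and [S] into a diagonal matrix. *)
Lemma triangle_normal_form A B D x :
  [/\ \tr A = 0, \tr B = 0 & \tr D = 0] ->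
  [/\ \det A = 1, \det B = 1 & \det D = 1] ->
  [/\ \tr (A *m B) = - x, \tr (A *m D) = - x & \tr (B *m D) = - x] ->
  x != 2 ->
  exists s w (P : 'M[C]_2), [/\ w ^+ 2 + w + 1 = 0, x = -1 - 3 * s ^+ 2, \det P = 1 &
    [/\ A *m P = P *m std_mx s 1, B *m P = P *m std_mx s w &
        D *m P = P *m std_mx s (w ^+ 2)]].
Proof.
move=> [tA tB tD] [dA dB dD] [tAB tAD tBD] x2.
have [w w1] := exists_cube_root; pose w2 := -1 - w.
have w2E : w ^+ 2 = w2 by apply/eqP; rewrite -subr_eq0 -w1; apply/eqP; rewrite /w2; ring.
have ww2 : w * w2 = 1 by rewrite /w2 mulrBr mulrN1 -expr2 w2E /w2; ring.
have w22 : w2 * w2 = w by rewrite -{1}w2E expr2 -mulrA ww2 mulr1.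
pose N := 3^-1 *: (A + w *: B + w2 *: D).
pose M := 3^-1 *: (A + w2 *: B + w *: D).
pose S := 3^-1 *: (A + B + D).
have three : 3 != 0 :> C by rewrite pnatr_eq0.
have trC (X Y : 'M[C]_2) (a : C) : \tr (X *m Y) = a -> \tr (Y *m X) = a by rewrite mxtrace_mulC.
have sqr (X : 'M[C]_2) : \tr X = 0 -> \det X = 1 -> \tr (X *m X) = -2.
  by move=> tX dX; rewrite mx2_trace_sqr tX dX expr0n sub0r mulr1.
have tr3 (a1 b1 d1 a2 b2 d2 : C) :
    \tr ((3^-1 *: (a1 *: A + b1 *: B + d1 *: D)) *m (3^-1 *: (a2 *: A + b2 *: B + d2 *: D))) =
    9^-1 * (-2 * (a1 * a2 + b1 * b2 + d1 * d2)
      - x * (a1 * b2 + b1 * a2 + a1 * d2 + d1 * a2 + b1 * d2 + d1 * b2)).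
  rewrite -scalemxAl -scalemxAr !mxtraceZ !mulmxDl !mulmxDr.
  rewrite -!scalemxAl -!scalemxAr !mxtraceD !mxtraceZ.
  rewrite tAB tAD tBD (trC _ _ _ tAB) (trC _ _ _ tAD) (trC _ _ _ tBD) !sqr//.
  by field.
have tr1 (a b d : C) : \tr (3^-1 *: (a *: A + b *: B + d *: D)) = 0.
  by rewrite !(mxtraceZ, mxtraceD) tA tB tD !mulr0 !addr0 mulr0.
have NE : N = 3^-1 *: (1 *: A + w *: B + w2 *: D) by rewrite scale1r.
have ME : M = 3^-1 *: (1 *: A + w2 *: B + w *: D) by rewrite scale1r.
have SE : S = 3^-1 *: (1 *: A + 1 *: B + 1 *: D) by rewrite !scale1r.
have NN : \tr (N *m N) = 0.
  by rewrite NE tr3 -[w * w]expr2 w2E w22 [w2 * w]mulrC ww2 /w2; ring.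
have MM : \tr (M *m M) = 0.
  by rewrite ME tr3 -[w * w]expr2 w2E w22 [w2 * w]mulrC ww2 /w2; ring.
have NM : \tr (N *m M) = (x - 2) / 3.
  by rewrite NE ME tr3 -[w * w]expr2 w2E w22 [w2 * w]mulrC ww2 /w2; field.
have SN : \tr (S *m N) = 0 by rewrite SE NE tr3 /w2; ring.
have SM : \tr (S *m M) = 0 by rewrite SE ME tr3 /w2; ring.
have det0 (X : 'M[C]_2) : \tr X = 0 -> \tr (X *m X) = 0 -> \det X = 0.
  move=> tX; rewrite mx2_trace_sqr tX expr0n sub0r => /eqP.
  by rewrite oppr_eq0 mulf_eq0 pnatr_eq0 => /eqP.
have tN : \tr N = 0 by rewrite NE tr1.
have tM : \tr M = 0 by rewrite ME tr1.
have tS : \tr S = 0 by rewrite SE tr1.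
have [t [NMt t0 xE]] : exists t, [/\ \tr (N *m M) = t, t != 0 & x = 3 * t + 2].
  exists ((x - 2) / 3); split=> //; last by field.
  by rewrite mulf_neq0 ?invr_eq0 ?subr_eq0.
have [P uP [NP MP]] := nilpotent_pair_basis (mx2_sqr0 tN (det0 _ tN NN))
  (mx2_sqr0 tM (det0 _ tM MM)) (det0 _ tN NN) NMt t0.
pose T := invmx P *m S *m P.
have SP : S *m P = P *m T by rewrite /T !mulmxA mulmxV// mul1mx.
have conjtr (X Y X' Y' : 'M[C]_2) : X *m P = P *m X' -> Y *m P = P *m Y' ->
    \tr (X *m Y) = \tr (X' *m Y').
  move=> XP YP; rewrite -[X *m Y](mulmxK uP) mxtrace_mulC -[X *m Y *m P]mulmxA YP.
  by rewrite mulmxA XP !mulmxA mulVmx// mul1mx.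
(* Orthogonality to [N] and to [M] kills the two entries of [T] off the diagonal. *)
have T10 : T 1 0 = 0.
  have := conjtr _ _ _ _ SP NP; rewrite SN mxtrace2; mx2.
  rewrite !mulr0 !add0r !addr0 => /esym/eqP; rewrite mulf_eq0 (negPf t0) orbF.
  by move/eqP.
have T01 : T 0 1 = 0.
  by have := conjtr _ _ _ _ SP MP; rewrite SM mxtrace2; mx2; rewrite !mulr0 !add0r !addr0 mulr1.
have T11 : T 1 1 = - T 0 0.
  apply/eqP; rewrite -addr_eq0 addrC -mxtrace2 /T mxtrace_mulC mulmxA mulmxV//.
  by rewrite mul1mx tS.
have [s TE] : exists s, T = mx2 s 0 0 (- s).
  by exists (T 0 0); rewrite [T in LHS]mx2E T10 T01 T11.
have w12 : 1 + w + w2 = 0 by rewrite /w2; ring.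
have dft := fourier3_inversion ww2 w22 w2E w12.
have AE : A = S + N + M.
  by apply: eq_mx2; rewrite /S /N /M /w2 !entriesE; field.
have BE : B = S + w2 *: N + w *: M.
  by apply: eq_mx2; rewrite /S /N /M !entriesE dft.
have DE : D = S + w *: N + w2 *: M.
  have dft' := fourier3_inversion (etrans (mulrC _ _) ww2)
    (w2E : w * w = w2) w22 (etrans (addrAC _ _ _) w12).
  apply/matrixP => i j; rewrite /S /N /M !entriesE.
  by rewrite -[LHS](dft' (A i j) _ (B i j)); ring.
clearbody S N M w2.
(* The remaining parameter [t] is determined by [s], because [A] has determinant 1. *)
have detc : \det A = \det (mx2 s t 1 (- s)).
  have AP : A *m P = P *m mx2 s t 1 (- s).
    rewrite AE !mulmxDl SP NP MP -!mulmxDr TE; congr (_ *m _).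
    by apply: eq_mx2; rewrite !entriesE; ring.
  have := congr1 determinant AP; rewrite !det_mulmx mulrC => /mulfI; apply.
  by rewrite -unitfE -unitmxE.
have tE : t = -1 - s ^+ 2.
  by move: detc; rewrite dA det2 !entriesE => ->; ring.
(* Dividing by a square root of the determinant brings the change of basis into SL(2,C). *)
exists s, w; pose c := sqrtC (\det P).
have c0 : c != 0 by rewrite sqrtC_eq0 -unitfE -unitmxE.
exists (c^-1 *: P); split=> //.
- by rewrite xE tE; ring.
- by rewrite detZ exprVn sqrtCK mulVf// -unitfE -unitmxE.
have scl (X Y : 'M[C]_2) : X *m P = P *m Y -> X *m (c^-1 *: P) = c^-1 *: P *m Y.
  by move=> XP; rewrite -scalemxAr XP scalemxAl.
split; apply: scl.
- rewrite AE !mulmxDl SP NP MP -!mulmxDr TE; congr (_ *m _).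
  by rewrite /std_mx -tE; apply: eq_mx2; rewrite !entriesE; ring.
- rewrite BE !mulmxDl -!scalemxAl SP NP MP !scalemxAr -!mulmxDr TE; congr (_ *m _).
  by rewrite /std_mx -tE w2E; apply: eq_mx2; rewrite !entriesE; ring.
- rewrite DE !mulmxDl -!scalemxAl SP NP MP !scalemxAr -!mulmxDr TE; congr (_ *m _).
  by rewrite /std_mx -tE !w2E (w22 : w2 ^+ 2 = w); apply: eq_mx2; rewrite !entriesE; ring.
Qed.

End NormalForm.

(** * Elementary triangle groups *)

Section Elementary.
Variable gT : groupType.
Implicit Types (G H K S : set gT) (a b d x : gT).
Local Open Scope group_scope.

Lemma generated_abelian S : (forall x y, S x -> S y -> commute x y) ->
  is_abelian (generated S).
Proof.
move=> cS; have sub x : is_subgroup [set y | commute x y].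
  split=> [|y z xy xz] /=; first exact: commute1.
  by apply: commuteM => //; apply: commuteV.
have S1 x y : S x -> generated S y -> commute x y.
  by move=> Sx; apply: (generated_min (sub x) (fun z => cS x z Sx)).
move=> x y Gx; apply: (generated_min (sub x)) => z Sz.
exact/commute_sym/S1.
Qed.

(** The words of even length form a subgroup of index at most 2, generated by [a b] and [a d]. *)
Lemma involutions_virtually_abelian a b d :
  a * a = 1 -> b * b = 1 -> d * d = 1 -> commute (a * b) (a * d) ->
  exists2 H, finite_index_subgroup H (generated [set a; b; d]) & is_abelian H.
Proof.
move=> aa bb dd cpq; set G := generated _.
pose H := generated [set a * b; a * d]; exists H; last first.
  apply: generated_abelian => x y [->|->] [->|->] //; exact/commute_sym.
have sG : is_subgroup G := generated_subgroup _.
have sH : is_subgroup H := generated_subgroup _.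
have Ga : G a by apply: generated_sub; left; left.
have Gb : G b by apply: generated_sub; left; right.
have Gd : G d by apply: generated_sub; right.
have Hp : H (a * b) by apply: generated_sub; left.
have Hq : H (a * d) by apply: generated_sub; right.
have inv (s : gT) : s * s = 1 -> s^-1 = s by move=> ss; rewrite -[RHS](mulKg s) ss mulg1.
have GH x : G x -> H x \/ H (a * x).
  apply: (@generated_ind _ [set a; b; d] (fun x => H x \/ H (a * x))).
  - by move=> s [[->|->]|->]; rewrite inv//; [left; left|left; right|right].
  - by left; case: sH.
  have step (s y : gT) : s * s = 1 -> H (a * s) -> H y \/ H (a * y) -> H (s * y) \/ H (a * (s * y)).
    move=> ss Has [Hy|Hay]; [right|left].
      by rewrite mulgA; exact: (subgroupM sH Has Hy).
    have -> : s * y = (a * s)^-1 * (a * y).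
      by rewrite invgM (inv _ ss) (inv _ aa) -!mulgA (mulgA a a) aa mul1g.
    exact: (subgroupM sH (subgroupV sH Has) Hay).
  move=> s y [[->|->]|->]; apply: step => //.
  by rewrite aa; case: sH.
split=> //; first by apply: (generated_min sG) => x [->|->]; exact: (subgroupM sG).
apply: (@sub_finite_set _ _ [set [set 1 * h | h in H]; [set a * h | h in H]]).
  move=> _ [x Gx <-]; have [Hx|Hax] := GH x Gx; [left|right]; apply: (eq_coset sH).
    by rewrite mulg1; exact: (subgroupV sH Hx).
  by rewrite -[_^-1 * _]invgK invgM invgK (inv _ aa); exact: (subgroupV sH Hax).
exact: finite_set2.
Qed.

End Elementary.

Section TriangleElementary.
Variable C : numClosedFieldType.
Implicit Types (A B D M N P : 'M[C]_2) (u v : 'cV[C]_2).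

Lemma traceless_sqr M : \tr M = 0 -> \det M = 1 -> M *m M = - 1%:M.
Proof.
rewrite mxtrace2 det2 => tM dM; have M11 : M 1 1 = - M 0 0.
  by apply/eqP; rewrite -addr_eq0 addrC tM.
apply: eq_mx2; rewrite !entriesE ?M11 ?oppr0; try ring.
  by rewrite -[in RHS]dM M11; ring.
by rewrite -[in RHS]dM M11; ring.
Qed.

(** The trace form on the three-dimensional space of traceless matrices is nondegenerate, so two
    orthogonal isotropic elements are proportional, and they are nilpotent. The proof shows instead
    that the square of each entry of the product vanishes. *)
Lemma isotropic_traceless_mul0 M N : \tr M = 0 -> \tr N = 0 ->
  \det M = 0 -> \det N = 0 -> \tr (M *m N) = 0 -> M *m N = 0.
Proof.
rewrite !mxtrace2 !det2 !entriesE => tM tN.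
have M11 : M 1 1 = - M 0 0 by apply/eqP; rewrite -addr_eq0 addrC tM.
have N11 : N 1 1 = - N 0 0 by apply/eqP; rewrite -addr_eq0 addrC tN.
rewrite M11 N11.
suff sq a b c d e f : a * - a - b * c = 0 -> d * - d - e * f = 0 ->
    a * d + b * f + (c * e + - a * - d) = 0 ->
    [/\ a * d + b * f = 0, a * e + b * - d = 0, c * d + - a * f = 0 &
        c * e + - a * - d = 0 :> C].
  move=> dM dN tMN; have [e1 e2 e3 e4] := sq _ _ _ _ _ _ dM dN tMN.
  by apply: eq_mx2; rewrite !entriesE ?M11 ?N11 ?e1 ?e2 ?e3 ?e4.
move=> h1 h2 h3.
have sq0 (z : C) : z ^+ 2 = 0 -> z = 0 by move/eqP; rewrite expf_eq0 => /eqP.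
have q1 : a ^+ 2 + b * c = 0 by rewrite -oppr0 -h1; ring.
have q2 : d ^+ 2 + e * f = 0 by rewrite -oppr0 -h2; ring.
have t : 2 * a * d + b * f + c * e = 0 by rewrite -h3; ring.
have e1 : a * d + b * f = 0.
  apply/sq0; have -> : (a * d + b * f) ^+ 2 =
    (b * f) * (2 * a * d + b * f + c * e) - (a ^+ 2 + b * c) * (d ^+ 2 + e * f)
    + (a ^+ 2 + b * c) * d ^+ 2 + a ^+ 2 * (d ^+ 2 + e * f) by ring.
  by rewrite q1 q2 t !(mulr0, mul0r, addr0, subr0).
split=> //.
- apply/sq0; have -> : (a * e + b * - d) ^+ 2 = e ^+ 2 * (a ^+ 2 + b * c) +
    b ^+ 2 * (d ^+ 2 + e * f) - b * e * (2 * a * d + b * f + c * e) by ring.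
  by rewrite q1 q2 t !mulr0 addr0 subr0.
- apply/sq0; have -> : (c * d + - a * f) ^+ 2 = f ^+ 2 * (a ^+ 2 + b * c) +
    c ^+ 2 * (d ^+ 2 + e * f) - c * f * (2 * a * d + b * f + c * e) by ring.
  by rewrite q1 q2 t !mulr0 addr0 subr0.
- have -> : c * e + - a * - d = 2 * a * d + b * f + c * e - (a * d + b * f) by ring.
  by rewrite t e1 subrr.
Qed.

(** The differences [A - B] and [A - D] are isotropic and orthogonal, so their products in both
    orders vanish. Comparing the two expansions and moving [A] to the left, by the scalar
    anticommutators of traceless matrices, gives the claim. *)
Lemma asymptotic_triangle_commute A B D :
  [/\ \tr A = 0, \tr B = 0 & \tr D = 0] ->
  [/\ \det A = 1, \det B = 1 & \det D = 1] ->
  [/\ \tr (A *m B) = - 2, \tr (A *m D) = - 2 & \tr (B *m D) = - 2] ->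
  (A *m B) *m (A *m D) = (A *m D) *m (A *m B).
Proof.
move=> [tA tB tD] [dA dB dD] [tAB tAD tBD].
have sqrN1 (X : 'M[C]_2) : \tr X = 0 -> \det X = 1 -> X *m X = - 1%:M := @traceless_sqr X.
have trC (X Y : 'M[C]_2) : \tr (X *m Y) = \tr (Y *m X) := mxtrace_mulC X Y.
have trB (X Y : 'M[C]_2) : \tr (X - Y) = \tr X - \tr Y by rewrite raddfB.
have trN (X : 'M[C]_2) : \tr (- X) = - \tr X by rewrite raddfN.
have tr1 : \tr (1%:M : 'M[C]_2) = 2 by rewrite mxtrace1.
have diff (X Y : 'M[C]_2) : \tr X = 0 -> \tr Y = 0 -> \det X = 1 -> \det Y = 1 ->
    \tr (X *m Y) = -2 -> \det (X - Y) = 0.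
  move=> tX tY dX dY tXY; have tXY0 : \tr (X - Y) = 0 by rewrite trB tX tY subrr.
  have : \tr ((X - Y) *m (X - Y)) = 0.
    rewrite mulmxBl !mulmxBr !sqrN1// !trB !trN (trC Y X) tXY tr1; ring.
  rewrite mx2_trace_sqr tXY0 expr0n sub0r => /eqP.
  by rewrite oppr_eq0 mulf_eq0 pnatr_eq0 => /eqP.
have n12 : (A - B) *m (A - D) = 0.
  apply: isotropic_traceless_mul0; rewrite ?diff// ?trB ?tA ?tB ?tD ?subrr//.
  by rewrite mulmxBl !mulmxBr !sqrN1// !trB !trN (trC B A) tAB tAD tBD tr1; ring.
have n21 : (A - D) *m (A - B) = 0.
  apply: isotropic_traceless_mul0; rewrite ?diff// ?trB ?tA ?tB ?tD ?subrr//.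
  by rewrite mulmxBl !mulmxBr !sqrN1// !trB !trN (trC D A) (trC D B) tAB tAD tBD tr1; ring.
have anti (X Y : 'M[C]_2) : \tr X = 0 -> \tr Y = 0 -> X *m Y + Y *m X = (\tr (X *m Y))%:M.
  rewrite !mxtrace2 => tX tY.
  have X11 : X 1 1 = - X 0 0 by apply/eqP; rewrite -addr_eq0 addrC tX.
  have Y11 : Y 1 1 = - Y 0 0 by apply/eqP; rewrite -addr_eq0 addrC tY.
  by apply: eq_mx2; rewrite !entriesE X11 Y11; ring.
have BA : B *m A = (-2)%:M - A *m B by rewrite -tAB -(anti A B)// (addrC (A *m B)) addrK.
have DA : D *m A = (-2)%:M - A *m D by rewrite -tAD -(anti A D)// (addrC (A *m D)) addrK.
have AA := sqrN1 _ tA dA.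
have red (X Y : 'M[C]_2) : X *m A = (-2)%:M - A *m X ->
   (A *m X) *m (A *m Y) = (-2) *: (A *m Y) + X *m Y.
  move=> XA; rewrite mulmxA -(mulmxA A X A) XA mulmxBr mulmxBl mul_mx_scalar -scalemxAl.
  by rewrite (mulmxA A A X) AA mulNmx mul1mx mulNmx opprK.
rewrite !red//; move/eqP: n12; move/eqP: n21.
rewrite !mulmxBl !mulmxBr AA => n21 n12.
have : - 1%:M - A *m D - (B *m A - B *m D) = - 1%:M - A *m B - (D *m A - D *m B).
  by rewrite (eqP n12) (eqP n21).
rewrite BA DA => e; apply/eqP; rewrite -subr_eq0; apply/eqP.
move/eqP: e; rewrite -subr_eq0 => /eqP <-.
by apply/matrixP => i j; rewrite !(addmxE, oppmxE, scalemxE); ring.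
Qed.

End TriangleElementary.

(** * Spanning subgroups of finite index *)

Section Spanning.
Variable R : realType.
Local Notation C := R[i].
Implicit Types (M N P : SL2 R) (X Y : 'M[C]_2) (u v : 'cV[C]_2) (G K : set (PSL2 R)).

Definition eigenvector X u := exists e : C, X *m u = e *: u.

(** The relation says that [(X - c) (Y - b)] is scalar. A nonzero scalar would force the factors to
    commute, so the product is 0, and [X - c] kills the image of [Y - b], which is a line. *)
Lemma eigenvector_of_span X Y (a b c : C) : X *m Y != Y *m X ->
  X *m Y = a%:M + b *: X + c *: Y ->
  exists2 u, u != 0 & eigenvector X u /\ eigenvector Y u.
Proof.
move=> nXY XYE.
have [X' XE] : exists X', X = X' + c%:M by exists (X - c%:M); rewrite subrK.
have [Y' YE] : exists Y', Y = Y' + b%:M by exists (Y - b%:M); rewrite subrK.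
have comm : X' *m Y' != Y' *m X'.
  apply: contraNneq nXY => e; rewrite XE YE !mulmxDl !mulmxDr e.
  rewrite !mul_scalar_mx !mul_mx_scalar !scale_scalar_mx [c * b]mulrC.
  by apply/eqP/matrixP => i j; rewrite !(addmxE, scalemxE); ring.
have XY0 : X' *m Y' = (a + b * c)%:M.
  move: XYE; rewrite XE YE !mulmxDl !mulmxDr !mul_mx_scalar !mul_scalar_mx => /eqP.
  rewrite -subr_eq0 => /eqP XYE; apply/eqP; rewrite -subr_eq0 -XYE; apply/eqP.
  by apply/matrixP => i j; rewrite !(addmxE, oppmxE, scalemxE) !mxE; case: (i == j); rewrite ?mulr1n ?mulr0n; ring.
have k0 : a + b * c = 0.
  apply: contraNeq comm => k0; have uY : Y' \in unitmx.
    have := congr1 determinant XY0; rewrite det_mulmx det_scalar => d.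
    have : \det X' * \det Y' != 0 by rewrite d expf_neq0.
    by rewrite mulf_eq0 negb_or unitmxE unitfE => /andP[].
  have -> : X' = (a + b * c) *: invmx Y'.
    by rewrite -[LHS](mulmxK uY) XY0 mul_scalar_mx.
  by rewrite -scalemxAl -scalemxAr mulVmx// mulmxV.
rewrite k0 raddf0 in XY0.
have dY : \det Y' = 0.
  apply: contraNeq comm => dY; have uY : Y' \in unitmx by rewrite unitmxE unitfE.
  have -> : X' = 0 by rewrite -[LHS](mulmxK uY) XY0 mul0mx.
  by rewrite mul0mx mulmx0.
have [z Yz] : exists z : 'cV_2, Y' *m z != 0.
  apply: contrapT => nex; move/negP: comm; apply; suff -> : Y' = 0 by rewrite mul0mx mulmx0.
  apply/matrixP => i j; rewrite mxE; apply: contrapT => /eqP Yij; apply: nex.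
  exists (delta_mx j 0); apply: contraNneq Yij => /colP/(_ i).
  by rewrite -colE !mxE => ->.
exists (Y' *m z) => //; split.
  by exists c; rewrite XE mulmxDl mulmxA XY0 mul0mx add0r mul_scalar_mx.
exists (\tr Y' + b); rewrite [in LHS]YE mulmxDl mul_scalar_mx scalerDl; congr (_ + _).
by have := mx2_sandwich 1%:M dY; rewrite !mulmx1 mulmxA => ->; rewrite scalemxAl.
Qed.

Lemma common_eigenvector_unique X Y u v : X *m Y != Y *m X ->
  eigenvector X u -> eigenvector Y u -> eigenvector X v -> eigenvector Y v ->
  u 0 0 * v 1 0 = v 0 0 * u 1 0.
Proof.
move=> nXY [a Xu] [b Yu] [c Xv] [d Yv]; apply: contraNeq nXY => uv.
apply/eqP/(mx_eq_on_vec uv); rewrite -!mulmxA ?Yu ?Xu ?Xv ?Yv -!scalemxAr ?Yu ?Xu ?Xv ?Yv.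
  by rewrite !scalerA mulrC.
by rewrite !scalerA mulrC.
Qed.

Lemma parallel_scale u v : u != 0 -> u 0 0 * v 1 0 = v 0 0 * u 1 0 ->
  exists e : C, v = e *: u.
Proof.
move=> u0 uv; have [u00|u00] := eqVneq (u 0 0) 0.
  have u10 : u 1 0 != 0.
    by apply: contraNneq u0 => u10; apply/eqP/eq_cv2; rewrite mxE.
  exists (v 1 0 / u 1 0); apply: eq_cv2; rewrite scalemxE ?divfK//.
  by rewrite u00 mulr0; apply: (mulIf u10); rewrite -uv u00 !mul0r.
exists (v 0 0 / u 0 0); apply: eq_cv2; rewrite scalemxE ?divfK//.
by apply: (mulfI u00); rewrite uv; field.
Qed.

Lemma eigenvector_sub X Y u (a b c : C) : eigenvector X u -> eigenvector Y u ->
  eigenvector (a%:M + b *: X + c *: Y) u.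
Proof.
move=> [e Xu] [f Yu]; exists (a + b * e + c * f).
by rewrite !mulmxDl mul_scalar_mx -!scalemxAl Xu Yu !scalerA -!scalerDl.
Qed.

Lemma psl2_mx_comm M N : sl2_mx M *m sl2_mx N = sl2_mx N *m sl2_mx M ->
  commute (psl2_proj M) (psl2_proj N).
Proof.
by move=> MN; rewrite /commute -!psl2_projM; congr psl2_proj; apply: sl2_inj.
Qed.

Lemma finite_index_noncommuting G K : ~ elementary G -> finite_index_subgroup K G ->
  exists M N, [/\ K (psl2_proj M), K (psl2_proj N) &
    sl2_mx M *m sl2_mx N != sl2_mx N *m sl2_mx M].
Proof.
move=> nel fK; apply: contrapT => nex; apply: nel; exists K => // x y Kx Ky.
rewrite -(psl2_reprK x) -(psl2_reprK y); apply: psl2_mx_comm.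
apply: contrapT => /eqP xy; apply: nex; exists (repr x), (repr y).
by rewrite !psl2_reprK.
Qed.

Lemma solve_linear_relation X Y (Z : 'M[C]_2) (a b c d : C) : d != 0 ->
  a%:M + b *: X + c *: Y + d *: Z = 0 ->
  Z = (- a / d)%:M + (- b / d) *: X + (- c / d) *: Y.
Proof.
move=> d0 e; apply/matrixP => i j; have := congr1 (fun W : 'M[C]_2 => W i j) e.
rewrite /= !(addmxE, scalemxE) [_%:M _ _]mxE [(- a / d)%:M _ _]mxE mxE.
case: (i == j); rewrite ?mulr1n ?mulr0n => /eqP; rewrite addr_eq0 => /eqP h.
  by apply: (mulfI d0); rewrite -[LHS]opprK -h; field.
by apply: (mulfI d0); rewrite -[LHS]opprK -h; field.
Qed.

(** If [K] lay in the span of 1, [M] and [N], it would have a common eigenvector by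
    [eigenvector_of_span]; its line is unique enough to be preserved by all of [G], against the
    hypothesis. *)
Lemma finite_index_spanning G K : is_subgroup G -> ~ elementary G ->
  (forall u, u != 0 -> exists2 M, G (psl2_proj M) & ~ eigenvector (sl2_mx M) u) ->
  finite_index_subgroup K G ->
  exists M N P, [/\ K (psl2_proj M), K (psl2_proj N), K (psl2_proj P) &
    forall a b c d : C,
      a%:M + b *: sl2_mx M + c *: sl2_mx N + d *: sl2_mx P = 0 ->
      [/\ a = 0, b = 0, c = 0 & d = 0]].
Proof.
move=> sG nel noeig fK; have sK : is_subgroup K by case: fK.
have [M [N [KM KN nMN]]] := finite_index_noncommuting nel fK.
have [[P [KP Pout]]|allin] := pselect (exists P, K (psl2_proj P) /\
    forall a b c : C, sl2_mx P <> a%:M + b *: sl2_mx M + c *: sl2_mx N).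
  exists M, N, P; split=> // a b c d e.
  have d0 : d = 0.
    apply: contrapT => /eqP d0; apply: (Pout (- a / d) (- b / d) (- c / d)).
    exact: solve_linear_relation.
  rewrite d0 scale0r addr0 in e *.
  have c0 : c = 0.
    apply: contraNeq nMN => c0.
    have := @solve_linear_relation (sl2_mx M) 0 (sl2_mx N) a b 0 c c0.
    rewrite !scaler0 !addr0 => /(_ e) ->.
    by rewrite mulmxDl mulmxDr mul_scalar_mx mul_mx_scalar -scalemxAl -scalemxAr.
  rewrite c0 scale0r addr0 in e *.
  have b0 : b = 0.
    apply: contraNeq nMN => b0.
    have := @solve_linear_relation 0 0 (sl2_mx M) a 0 0 b b0.
    rewrite !scaler0 !addr0 => /(_ e) ->.
    by rewrite mul_scalar_mx mul_mx_scalar.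
  rewrite b0 scale0r addr0 in e *.
  by have := congr1 (fun X : 'M[C]_2 => X 0 0) e; rewrite !entriesE => ->.
have spanP P : K (psl2_proj P) -> exists a b c : C,
    sl2_mx P = a%:M + b *: sl2_mx M + c *: sl2_mx N.
  move=> KP; apply: contrapT => nex; apply: allin; exists P; split=> // a b c e.
  by apply: nex; exists a, b, c.
have [a [b [c MNE]]] : exists a b c : C, sl2_mx (M * N)%g = a%:M + b *: sl2_mx M + c *: sl2_mx N.
  by apply: spanP; rewrite psl2_projM; apply: subgroupM.
have [u u0 [Mu Nu]] := eigenvector_of_span nMN MNE.
have Ku P : K (psl2_proj P) -> eigenvector (sl2_mx P) u.
  by move=> /spanP[a' [b' [c' ->]]]; apply: eigenvector_sub.
have [g Gg] := noeig u u0; case.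
(* The intersection of [K] with its conjugate by [g] still contains two noncommuting elements. Both
   [u] and [g u] are common eigenvectors of them, hence proportional. *)
have [M' [N' [[KM' KgM'] [KN' KgN'] nMN']]] := finite_index_noncommuting nel
  (finite_indexI fK (finite_index_conj sG Gg fK)).
have conj_eig Q : K (psl2_proj Q ^ psl2_proj g)%g -> eigenvector (sl2_mx Q) (sl2_mx g *m u).
  have -> : (psl2_proj Q ^ psl2_proj g)%g = psl2_proj (g^-1 * (Q * g))%g.
    by rewrite conjgE !psl2_projM psl2_projV.
  move=> /Ku[e].
  rewrite !sl2_mulE sl2_invE -!mulmxA => Qe; exists e.
  have := congr1 (mulmx (sl2_mx g)) Qe.
  by rewrite mulKVmx ?unitmx_sl2// -scalemxAr.
have [e ge] : exists e : C, sl2_mx g *m u = e *: u.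
  apply: parallel_scale => //; apply: (common_eigenvector_unique nMN'); auto.
by exists e.
Qed.

End Spanning.

(** * Quaternion algebras *)

Section QuaternionAlgebra.
Variables (F : fieldType) (a b : F).
Implicit Types x y : quat a b.

Definition quat_re x : F := let: (x0, _, _, _) := x in x0.

Lemma quat_char_poly x :
  x * x - (2 * quat_re x) *: x + (reduced_norm x) *: 1 = 0.
Proof.
by case: x => [[[x0 x1] x2] x3]; congr (_, _, _, _) => /=; ring.
Qed.

Definition quat_i : quat a b := (0, 1, 0, 0).
Definition quat_j : quat a b := (0, 0, 1, 0).
Definition quat_k : quat a b := (0, 0, 0, 1).

(* The Casimir identity: the four terms are the products of [y] with the
   elements of a basis and of its dual for the trace form. *)
Lemma quat_casimir y : a != 0 -> b != 0 ->
  y + a^-1 *: (quat_i * y * quat_i) + b^-1 *: (quat_j * y * quat_j)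
    - (a * b)^-1 *: (quat_k * y * quat_k) = (4 * quat_re y) *: 1.
Proof.
move=> a0 b0; case: y => [[[y0 y1] y2] y3].
by congr (_, _, _, _) => /=; field; rewrite a0 b0.
Qed.

Lemma reduced_normM x y : reduced_norm (x * y) = reduced_norm x * reduced_norm y.
Proof.
by case: x y => [[[x0 x1] x2] x3] [[[y0 y1] y2] y3] /=; ring.
Qed.

Definition quat_conj x : quat a b :=
  let: (x0, x1, x2, x3) := x in (x0, - x1, - x2, - x3).

Lemma mul_quat_conj x : x * quat_conj x = (reduced_norm x) *: 1.
Proof.
by case: x => [[[x0 x1] x2] x3]; congr (_, _, _, _) => /=; ring.
Qed.

End QuaternionAlgebra.

Section HamiltonRamified.
Variable R : realType.

Lemma hamilton_norm_eq0 (x : quat (-1 : R) (-1)) : reduced_norm x = 0 -> x = 0.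
Proof.
case: x => [[[x0 x1] x2] x3] /= e.
have : x0 ^+ 2 + x1 ^+ 2 + x2 ^+ 2 + x3 ^+ 2 = 0 by rewrite -[RHS]e; ring.
move/eqP; rewrite !paddr_eq0 ?addr_ge0 ?sqr_ge0// !sqrf_eq0.
by move=> /andP[/andP[/andP[/eqP-> /eqP->] /eqP->] /eqP->].
Qed.

(** A positive [a] would give zero divisors [i - sqrt a] and [i + sqrt a], and likewise for [b]; the
    Hamilton quaternions have none. *)
Lemma hamilton_form_neg (a b : R) (f : {lrmorphism quat a b -> quat (-1 : R) (-1)}) :
  a != 0 -> b != 0 -> bijective f -> a < 0 /\ b < 0.
Proof.
move=> a0 b0 /bij_inj injf.
have zero (x y : quat a b) : x * y = 0 -> x = 0 \/ y = 0.
  move=> xy; have : reduced_norm (f x) * reduced_norm (f y) = 0.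
    by rewrite -reduced_normM -rmorphM xy rmorph0 /= ; ring.
  have f0 z : reduced_norm (f z) = 0 -> z = 0.
    by move=> /hamilton_norm_eq0 fz; apply: injf; rewrite fz rmorph0.
  by move/eqP; rewrite mulf_eq0 => /orP[] /eqP /f0; [left|right].
split; rewrite lt_neqAle ?a0 ?b0 leNgt /=; apply/negP => pos.
  have [] := zero (- Num.sqrt a, 1, 0, 0) (Num.sqrt a, 1, 0, 0).
  - have := sqr_sqrtr (ltW pos); move: (Num.sqrt a) => s sE.
    by congr (_, _, _, _) => /=; rewrite -?sE; ring.
  - by case=> _ /eqP; rewrite oner_eq0.
  - by case=> _ /eqP; rewrite oner_eq0.
have [] := zero (- Num.sqrt b, 0, 1, 0) (Num.sqrt b, 0, 1, 0).
- have := sqr_sqrtr (ltW pos); move: (Num.sqrt b) => s sE.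
  by congr (_, _, _, _) => /=; rewrite -?sE; ring.
- by case=> _ /eqP; rewrite oner_eq0.
- by case=> _ /eqP; rewrite oner_eq0.
Qed.

(** Up to signs the three vectors have pairwise cosines [T / 2]. The Gram determinant of the unit
    vectors is [(T + 1) (T - 2)^2 / 4], which gives the lower bound; Cauchy-Schwarz gives the upper
    one. *)
Lemma equal_gram_interval (p q T : R) (x y z : R * R * R)
    (n := fun u : R * R * R => p * u.1.1 ^+ 2 + q * u.1.2 ^+ 2 + p * q * u.2 ^+ 2)
    (g := fun u v : R * R * R =>
      p * (u.1.1 * v.1.1) + q * (u.1.2 * v.1.2) + p * q * (u.2 * v.2)) :
  0 < p -> 0 < q -> n x != 0 -> n y != 0 -> n z != 0 ->
  g x y ^+ 2 = n x * n y * (T ^+ 2 / 4) ->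
  g x z ^+ 2 = n x * n z * (T ^+ 2 / 4) ->
  g y z ^+ 2 = n y * n z * (T ^+ 2 / 4) ->
  g x y * g x z * g y z = n x * n y * n z * (T ^+ 3 / 8) ->
  -1 <= T <= 2.
Proof.
move=> p0 q0; have p0' := ltW p0; have q0' := ltW q0; have npos u : n u != 0 -> 0 < n u.
  move=> nu; rewrite lt_neqAle eq_sym nu /n.
  by do ?apply: addr_ge0; apply: mulr_ge0; rewrite ?sqr_ge0 ?mulr_ge0.
move=> /npos nx /npos ny /npos nz gxy gxz gyz gg.
have cs : 0 <= n x * n y - g x y ^+ 2.
  have -> : n x * n y - g x y ^+ 2 = p * q * (x.1.1 * y.1.2 - x.1.2 * y.1.1) ^+ 2 +
    p * (p * q) * (x.1.1 * y.2 - x.2 * y.1.1) ^+ 2 +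
    q * (p * q) * (x.1.2 * y.2 - x.2 * y.1.2) ^+ 2 by rewrite /n /g; ring.
  by do ?apply: addr_ge0; apply: mulr_ge0; rewrite ?sqr_ge0 ?mulr_ge0.
have det : 0 <= n x * n y * n z + 2 * (g x y * g x z * g y z) - n x * g y z ^+ 2
    - n y * g x z ^+ 2 - n z * g x y ^+ 2.
  have -> : n x * n y * n z + 2 * (g x y * g x z * g y z) - n x * g y z ^+ 2
      - n y * g x z ^+ 2 - n z * g x y ^+ 2 = p * q * (p * q) *
      (x.1.1 * (y.1.2 * z.2 - y.2 * z.1.2) - x.1.2 * (y.1.1 * z.2 - y.2 * z.1.1)
       + x.2 * (y.1.1 * z.1.2 - y.1.2 * z.1.1)) ^+ 2 by rewrite /n /g; ring.
  by apply: mulr_ge0; rewrite ?sqr_ge0 ?mulr_ge0.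
move: det cs; rewrite gg gxy gxz gyz; clear gg gxy gxz gyz; clear g.
move: (n x) (n y) (n z) nx ny nz => n1 n2 n3 h1 h2 h3.
have -> : n1 * n2 * n3 + 2 * (n1 * n2 * n3 * (T ^+ 3 / 8)) - n1 * (n2 * n3 * (T ^+ 2 / 4))
   - n2 * (n1 * n3 * (T ^+ 2 / 4)) - n3 * (n1 * n2 * (T ^+ 2 / 4)) =
   n1 * n2 * n3 * ((T + 1) * (T - 2) ^+ 2 / 4) by field.
rewrite pmulr_rge0 ?mulr_gt0// => det.
have -> : n1 * n2 - n1 * n2 * (T ^+ 2 / 4) = n1 * n2 * ((2 - T) * (2 + T) / 4) by field.
rewrite pmulr_rge0 ?mulr_gt0// => cs; apply/andP; split; last by nra.
rewrite leNgt; apply/negP => T1.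
have : (T + 1) * (T - 2) ^+ 2 < 0 by rewrite nmulr_rlt0 ?exprn_even_gt0//=; lra.
lra.
Qed.

End HamiltonRamified.

(** * The quaternion algebra inside M(2,C) and its normalizer *)

Section MatrixModel.
Variables (R : realType) (k : fieldExtType rat) (iota : {rmorphism k -> R[i]}).
Local Notation C := R[i].
Variables (a b : k) (theta : {lrmorphism quat (iota a) (iota b) -> 'M[C]_2}).
Hypotheses (a0 : a != 0) (b0 : b != 0) (bij_theta : bijective theta).
Implicit Types (x y z : quat a b) (g M : SL2 R).

Definition quat_mx x : 'M[C]_2 := theta (base_change iota x).

Lemma base_changeD x y : base_change iota (x + y) = base_change iota x + base_change iota y.
Proof.
by case: x y => [[[x0 x1] x2] x3] [[[y0 y1] y2] y3]; rewrite /= !rmorphD.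
Qed.

Lemma base_changeM x y : base_change iota (x * y) = base_change iota x * base_change iota y.
Proof.
case: x y => [[[x0 x1] x2] x3] [[[y0 y1] y2] y3].
by congr (_, _, _, _) => /=; rewrite !(rmorphD, rmorphN, rmorphM).
Qed.

Lemma base_changeZ c x : base_change iota (c *: x) = iota c *: base_change iota x.
Proof. by case: x => [[[x0 x1] x2] x3]; congr (_, _, _, _); rewrite /= rmorphM. Qed.

Lemma base_change1 : base_change iota (1 : quat a b) = 1.
Proof. by congr (_, _, _, _); rewrite ?rmorph1 ?rmorph0. Qed.

Lemma quat_mxD x y : quat_mx (x + y) = quat_mx x + quat_mx y.
Proof. by rewrite /quat_mx base_changeD raddfD. Qed.

Lemma quat_mxM x y : quat_mx (x * y) = quat_mx x *m quat_mx y.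
Proof. by rewrite /quat_mx base_changeM rmorphM. Qed.

Lemma quat_mxZ c x : quat_mx (c *: x) = iota c *: quat_mx x.
Proof. by rewrite /quat_mx base_changeZ linearZ. Qed.

Lemma quat_mx1 : quat_mx 1 = 1%:M.
Proof. by rewrite /quat_mx base_change1 rmorph1. Qed.

Lemma quat_mxN x : quat_mx (- x) = - quat_mx x.
Proof. by rewrite -scaleN1r quat_mxZ rmorphN1 scaleN1r. Qed.

Lemma quat_mx0 : quat_mx 0 = 0.
Proof. by rewrite -(scale0r 1) quat_mxZ rmorph0 scale0r. Qed.

(** For a nonscalar matrix the monic quadratic equation is unique, so [quat_char_poly] and
    Cayley-Hamilton have the same coefficients; scalars are checked directly. *)
Lemma theta_tr_det (y : quat (iota a) (iota b)) :
  \tr (theta y) = 2 * quat_re y /\ \det (theta y) = reduced_norm y.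
Proof.
have inj := bij_inj bij_theta.
have [[c yE]|nsc] := pselect (exists c : C, theta y = c%:M).
  have -> : y = c *: 1.
    by apply: inj; rewrite linearZ rmorph1 /= -scalemx1 in yE *.
  rewrite linearZ rmorph1 /= mxtraceZ mxtrace1 detZ det1; split; first by rewrite mulrC /quat_re /= mulr1.
  by rewrite /= !mulr0 !expr0n /= !mulr0 !subr0 addr0 !mulr1.
have : theta (y * y - (2 * quat_re y) *: y + reduced_norm y *: 1) = 0.
  by rewrite quat_char_poly rmorph0.
rewrite raddfD raddfB /= rmorphM !linearZ /= rmorph1.
have CH (X : 'M[C]_2) : X *m X = \tr X *: X - (\det X)%:M.
  by rewrite mxtrace2 det2; apply: eq_mx2; rewrite !entriesE; ring.
have A1 (c : C) : c%:A = c%:M :> 'M[C]_2 by rewrite -scalemx1.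
rewrite -[_ * _]/(theta y *m theta y) CH A1 => e.
have e' : (\tr (theta y) - 2 * quat_re y) *: theta y =
    (\det (theta y) - reduced_norm y)%:M.
  apply/eqP; rewrite -subr_eq0 -[X in _ == X]e; apply/eqP/matrixP => i j.
  by rewrite !(addmxE, oppmxE, scalemxE) !mxE; case: (i == j); rewrite ?mulr1n ?mulr0n; ring.
have t0 : \tr (theta y) - 2 * quat_re y = 0.
  apply: contrapT => /eqP t0; apply: nsc.
  exists ((\tr (theta y) - 2 * quat_re y)^-1 * (\det (theta y) - reduced_norm y)).
  by rewrite -scale_scalar_mx -e' scalerA mulVf// scale1r.
split; first by apply/eqP; rewrite -subr_eq0 t0.
have := congr1 (fun X : 'M[C]_2 => X 0 0) e'; rewrite t0 scale0r !entriesE.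
by move/esym/eqP; rewrite subr_eq0 => /eqP.
Qed.

Lemma tr_quat_mx x : \tr (quat_mx x) = 2 * iota (quat_re x).
Proof.
by rewrite /quat_mx (theta_tr_det _).1; case: x => [[[x0 x1] x2] x3].
Qed.

Lemma det_quat_mx x : \det (quat_mx x) = iota (reduced_norm x).
Proof.
rewrite /quat_mx (theta_tr_det _).2; case: x => [[[x0 x1] x2] x3] /=.
by rewrite !(rmorphD, rmorphN, rmorphM, rmorphXn).
Qed.

Lemma theta_surj (X : 'M[C]_2) : exists y : quat (iota a) (iota b), theta y = X.
Proof. by case: bij_theta => h _ hK; exists (h X). Qed.

Lemma quat_mx_span (X : 'M[C]_2) : exists c0 c1 c2 c3 : C,
  X = c0%:M + c1 *: quat_mx (quat_i a b) + c2 *: quat_mx (quat_j a b) +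
      c3 *: quat_mx (quat_k a b).
Proof.
have [[[[c0 c1] c2] c3] <-] := theta_surj X; exists c0, c1, c2, c3.
rewrite /quat_mx -scalemx1 -[1%:M]/1 -(rmorph1 theta) -!linearZ -!raddfD /=; congr (theta _).
rewrite !rmorph0 !rmorph1.
by congr (_, _, _, _) => /=; rewrite !(mulr0, mulr1, add0r, addr0).
Qed.

(** Moving [g] to the right past the first factor replaces [I] by [I']. With [g Y] in the algebra,
    the left side is in the algebra too, while the right side is a multiple of [g]. *)
Lemma conj_casimir (g Y I J K I' J' K' : 'M[C]_2) (p q r t : C) :
  Y + p *: (I *m Y *m I) + q *: (J *m Y *m J) - r *: (K *m Y *m K) = t%:M ->
  g *m I = I' *m g -> g *m J = J' *m g -> g *m K = K' *m g ->
  g *m Y + p *: (I' *m (g *m Y) *m I) + q *: (J' *m (g *m Y) *m J)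
    - r *: (K' *m (g *m Y) *m K) = t *: g.
Proof.
move=> e gI gJ gK; rewrite !(mulmxA _ g) -gI -gJ -gK -!mulmxA !scalemxAr -mulmxN -!mulmxDr.
by rewrite -!scalemxAr !mulmxA e mul_mx_scalar.
Qed.

(* Skolem-Noether made explicit: [conj_casimir] shows that, for every [w] of the
   algebra, the element [g] times [2 tr (g^-1 w)] lies in the algebra. *)
Lemma quat_mx_normalizer g :
  (forall x, exists y, sl2_mx g *m quat_mx x = quat_mx y *m sl2_mx g) ->
  exists2 c : C, c != 0 & exists z, quat_mx z = c *: sl2_mx g.
Proof.
move=> norm_g; have ug := unitmx_sl2 g; pose h := invmx (sl2_mx g).
have cas w : exists z, quat_mx z = (2 * \tr (h *m quat_mx w)) *: sl2_mx g.
  have [y yE] := theta_surj (h *m quat_mx w).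
  have := quat_casimir y (_ : iota a != 0) (_ : iota b != 0); rewrite !fmorph_eq0.
  move=> /(_ a0 b0) /(congr1 theta).
  have thetaE (p q r : C) (u v w' z : quat (iota a) (iota b)) :
      theta (u + p *: v + q *: w' - r *: z) =
      theta u + p *: theta v + q *: theta w' - r *: theta z.
    by rewrite !raddfD raddfN /= !linearZ.
  have theta3 (u v : quat (iota a) (iota b)) : theta (u * v * u) = theta u * theta v * theta u.
    by rewrite !rmorphM.
  have thetaA (c : C) : theta c%:A = c%:M by rewrite linearZ rmorph1 /= -scalemx1.
  rewrite thetaE !theta3 thetaA yE.
  rewrite -[theta (quat_i _ _)]/(theta _).
  have ij (q : quat a b) : theta (base_change iota q) = quat_mx q by [].
  have -> : quat_i (iota a) (iota b) = base_change iota (quat_i a b).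
    by congr (_, _, _, _); rewrite ?rmorph1 ?rmorph0.
  have -> : quat_j (iota a) (iota b) = base_change iota (quat_j a b).
    by congr (_, _, _, _); rewrite ?rmorph1 ?rmorph0.
  have -> : quat_k (iota a) (iota b) = base_change iota (quat_k a b).
    by congr (_, _, _, _); rewrite ?rmorph1 ?rmorph0.
  rewrite !ij -![_ * _ * _]/(_ *m _ *m _) => e.
  have [i' iE] := norm_g (quat_i a b); have [j' jE] := norm_g (quat_j a b).
  have [k' kE] := norm_g (quat_k a b).
  exists (w + a^-1 *: (i' * w * quat_i a b) + b^-1 *: (j' * w * quat_j a b)
    - (a * b)^-1 *: (k' * w * quat_k a b)).
  rewrite !(quat_mxD, quat_mxN, quat_mxZ, quat_mxM) !fmorphV rmorphM.
  have wE : quat_mx w = sl2_mx g *m theta y by rewrite yE /h mulKVmx.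
  rewrite -yE (theta_tr_det y).1 mulrA -natrM wE.
  rewrite -yE ?scalerN in e.
  exact: conj_casimir e iE jE kE.
(* The algebra spans M(2,C) over C, so the functional cannot vanish on all of it: at [g] its value
   is the trace of the identity. *)
have [w trw] : exists w, \tr (h *m quat_mx w) != 0.
  apply: contrapT => nex.
  have tr0 w : \tr (h *m quat_mx w) = 0 by apply: contrapT => /eqP nz; apply: nex; exists w.
  have [c0 [c1 [c2 [c3 gE]]]] := quat_mx_span (sl2_mx g).
  have : \tr (h *m sl2_mx g) = 0.
    have trE c d e f (X Y Z T : 'M[C]_2) : \tr (h *m (c *: X + d *: Y + e *: Z + f *: T)) =
        c * \tr (h *m X) + d * \tr (h *m Y) + e * \tr (h *m Z) + f * \tr (h *m T).
      by rewrite !mulmxDr !mxtraceD -!scalemxAr !mxtraceZ.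
    by rewrite gE -(scalemx1 2 c0) -quat_mx1 trE !tr0 !mulr0 !addr0.
  by rewrite mulVmx// mxtrace1 => /eqP; rewrite pnatr_eq0.
have [z zE] := cas w; exists (2 * \tr (h *m quat_mx w)); last by exists z.
by rewrite mulf_neq0// pnatr_eq0.
Qed.

End MatrixModel.

Section QuaternionBasis.
Variables (F : fieldType) (a b : F).
Implicit Types x y : quat a b.

(** Independence over [K] of the images implies independence over [F], and the algebra has dimension
    4 over [F]. *)
Lemma quat_basis (K : fieldType) (iota : {rmorphism F -> K}) (V : lmodType K)
    (f : quat a b -> V) (p0 p1 p2 p3 : quat a b) :
  {morph f : x y / x + y} -> (forall c x, f (c *: x) = iota c *: f x) ->
  (forall c0 c1 c2 c3 : K,
     c0 *: f p0 + c1 *: f p1 + c2 *: f p2 + c3 *: f p3 = 0 ->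
     [/\ c0 = 0, c1 = 0, c2 = 0 & c3 = 0]) ->
  forall y, exists c0 c1 c2 c3 : F, y = c0 *: p0 + c1 *: p1 + c2 *: p2 + c3 *: p3.
Proof.
move=> fD fZ indep y.
pose vec x : 'rV[F]_4 := let: (x0, x1, x2, x3) := x in
  \row_(i < 4) nth 0 [:: x0; x1; x2; x3] i.
pose unvec (v : 'rV[F]_4) : quat a b := (v 0 0, v 0 1, v 0 2, v 0 3).
have vecK x : unvec (vec x) = x.
  by case: x => [[[x0 x1] x2] x3]; rewrite /unvec /vec !mxE.
pose p (i : 'I_4) := nth 0 [:: p0; p1; p2; p3] i.
pose Q := \matrix_(i < 4) vec (p i).
have combE (v : 'rV[F]_4) : unvec (v *m Q) =
    v 0 0 *: p0 + v 0 1 *: p1 + v 0 2 *: p2 + v 0 3 *: p3.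
  have e i : (v *m Q) 0 i = v 0 0 * vec p0 0 i + v 0 1 * vec p1 0 i +
      v 0 2 * vec p2 0 i + v 0 3 * vec p3 0 i.
    rewrite mxE !big_ord_recl big_ord0 addr0 !addrA /Q !mxE /p /=.
    have -> : lift ord0 ord0 = 1 :> 'I_4 by apply: val_inj.
    have -> : lift ord0 (lift ord0 ord0) = 2 :> 'I_4 by apply: val_inj.
    by have -> : lift ord0 (lift ord0 (lift ord0 ord0)) = 3 :> 'I_4 by apply: val_inj.
  rewrite /unvec !e -[in RHS](vecK p0) -[in RHS](vecK p1) -[in RHS](vecK p2).
  by rewrite -[in RHS](vecK p3).
have uQ : Q \in unitmx.
  rewrite -row_free_unit -kermx_eq0; apply: contrapT => /negP/rowV0Pn[v /sub_kermxP vQ v0].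
  move/negP: v0; apply; have := combE v; rewrite vQ => c0.
  have f0 : f 0 = 0 by rewrite -(scale0r 0) fZ rmorph0 scale0r.
  have := congr1 f c0; rewrite !fD !fZ (_ : unvec 0 = 0); last by rewrite /unvec !mxE.
  rewrite f0 => /esym/indep[/eqP + /eqP + /eqP + /eqP].
  rewrite !fmorph_eq0 => /eqP e0 /eqP e1 /eqP e2 /eqP e3.
  apply/eqP/rowP => i; rewrite mxE.
  case: i => -[|[|[|[|//]]]] lti.
  - by rewrite -[RHS]e0; congr (v _ _); apply: val_inj.
  - by rewrite -[RHS]e1; congr (v _ _); apply: val_inj.
  - by rewrite -[RHS]e2; congr (v _ _); apply: val_inj.
  - by rewrite -[RHS]e3; congr (v _ _); apply: val_inj.
pose v := vec y *m invmx Q; exists (v 0 0), (v 0 1), (v 0 2), (v 0 3).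
by rewrite -combE /v mulmxKV// vecK.
Qed.

End QuaternionBasis.

(** * Orders, and the traces of a group commensurable with their norm-one units *)

Section Orders.
Variables (k : fieldExtType rat) (a b : k) (O : set (quat a b)).
Hypothesis order_O : is_order O.
Implicit Types x y : quat a b.

Lemma algebraic_integer_int (m : int) : algebraic_integer (m%:~R : k).
Proof. exact: (@integral_id _ _ (intmul (1 : k))). Qed.

Lemma orderM x y : O x -> O y -> O (x * y).
Proof. by case: order_O => _ + _ _; apply. Qed.

Lemma order1 : O 1.
Proof. by case: order_O. Qed.

Lemma orderD x y : O x -> O y -> O (x + y).
Proof.
case: order_O => _ _ [n [e ->]] _ [c cO ->] [d dO ->].
exists (fun i => c i + d i) => [i|]; first exact: integral_add (cO i) (dO i).
by rewrite -big_split; apply: eq_bigr => i _; rewrite scalerDl.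
Qed.

Lemma orderZ (c : k) x : algebraic_integer c -> O x -> O (c *: x).
Proof.
move=> cO; case: order_O => _ _ [n [e ->]] _ [d dO ->].
exists (fun i => c * d i) => [i|]; first exact: integral_mul cO (dO i).
by rewrite scaler_sumr; apply: eq_bigr => i _; rewrite scalerA.
Qed.

Lemma orderN x : O x -> O (- x).
Proof.
move=> Ox; rewrite -scaleN1r; apply: orderZ => //.
by rewrite -[-1]/((-1)%:~R); apply: algebraic_integer_int.
Qed.

Lemma order0 : O 0.
Proof.
rewrite -(scale0r 1); apply: orderZ order1.
by rewrite -[0]/(0%:~R); apply: algebraic_integer_int.
Qed.

Lemma order_sum I (r : seq I) (P : pred I) (f : I -> quat a b) :
  (forall i, P i -> O (f i)) -> O (\sum_(i <- r | P i) f i).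
Proof. by move=> Of; apply: big_ind => //; [apply: order0|apply: orderD]. Qed.

Lemma orderX x n : O x -> O (x ^+ n).
Proof.
by move=> Ox; elim: n => [|n IH]; [apply: order1|rewrite exprS; apply: orderM].
Qed.

End Orders.

Section ArithmeticTriangle.
Variables (R : realType) (k : fieldExtType rat) (iota : {rmorphism k -> R[i]}).
Local Notation C := R[i].
Variables (a b : k) (theta : {lrmorphism quat (iota a) (iota b) -> 'M[C]_2}).
Variable O : set (quat a b).
Hypotheses (a0 : a != 0) (b0 : b != 0) (bij_theta : bijective theta).
Hypothesis order_O : is_order O.
Implicit Types (x y z : quat a b) (g M A B D : SL2 R) (G H : set (PSL2 R)).

Lemma norm_one_lift M : norm_one_group theta O (psl2_proj M) ->
  exists x, [/\ O x, reduced_norm x = 1 & sl2_mx M = quat_mx theta x].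
Proof.
move=> [x [M' [Ox nx M'E /psl2_projP[]]]] ->; first by exists x.
exists (- x); split; first exact: orderN.
  by rewrite -nx; case: x {Ox nx M'E} => [[[x0 x1] x2] x3] /=; ring.
by rewrite quat_mxN M'E.
Qed.

(** Finitely many elements of [H] whose conjugates by [g] are still in [H] span the algebra over
    [k]. So conjugation by [g] preserves the algebra, and [quat_mx_normalizer] applies. *)
Lemma commensurable_normalizer G H g : is_subgroup G -> ~ elementary G ->
  (forall u, u != 0 -> exists2 M, G (psl2_proj M) & ~ eigenvector (sl2_mx M) u) ->
  finite_index_subgroup H G -> H `<=` norm_one_group theta O ->
  G (psl2_proj g) ->
  exists2 c : C, c != 0 & exists z, quat_mx theta z = c *: sl2_mx g.
Proof.
move=> sG nel noeig fH HO Gg; apply: quat_mx_normalizer => // x.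
have GV : G (psl2_proj g^-1)%g by rewrite psl2_projV; apply: subgroupV.
have fK := finite_indexI fH (finite_index_conj sG GV fH).
have [M [N [P [[KM KgM] [KN KgN] [KP KgP] indep]]]] := finite_index_spanning sG nel noeig fK.
have conj_in Q : H (psl2_proj Q ^ psl2_proj g^-1)%g ->
    exists z, sl2_mx g *m sl2_mx Q = quat_mx theta z *m sl2_mx g.
  have -> : (psl2_proj Q ^ psl2_proj g^-1)%g = psl2_proj (g * (Q * g^-1))%g.
    by rewrite conjgE !psl2_projM psl2_projV invgK.
  move=> /HO/norm_one_lift[z [_ _ zE]]; exists z.
  by rewrite -zE !sl2_mulE sl2_invE -!mulmxA mulVmx ?unitmx_sl2// mulmx1.
have [p1 [_ _ p1E]] := norm_one_lift (HO _ KM).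
have [p2 [_ _ p2E]] := norm_one_lift (HO _ KN).
have [p3 [_ _ p3E]] := norm_one_lift (HO _ KP).
have [q1 q1E] := conj_in _ KgM; have [q2 q2E] := conj_in _ KgN.
have [q3 q3E] := conj_in _ KgP.
have indep' (c0 c1 c2 c3 : C) : c0 *: quat_mx theta 1 + c1 *: quat_mx theta p1 +
    c2 *: quat_mx theta p2 + c3 *: quat_mx theta p3 = 0 ->
    [/\ c0 = 0, c1 = 0, c2 = 0 & c3 = 0].
  by rewrite quat_mx1 scalemx1 -p1E -p2E -p3E; apply: indep.
have [c0 [c1 [c2 [c3 ->]]]] := quat_basis (quat_mxD theta) (quat_mxZ theta) indep' x.
exists (c0 *: 1 + c1 *: q1 + c2 *: q2 + c3 *: q3).
rewrite !quat_mxD !quat_mxZ -p1E -p2E -p3E !mulmxDr !mulmxDl -!scalemxAl -!scalemxAr.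
by rewrite q1E q2E q3E quat_mx1 mulmx1 mul1mx.
Qed.

Lemma psl2_lift_unit_scale (c : C) z g : quat_mx theta z = c *: sl2_mx g ->
  iota (reduced_norm z) = c ^+ 2 /\ 2 * iota (quat_re z) = c * \tr (sl2_mx g).
Proof.
move=> zE; rewrite -(det_quat_mx bij_theta) -(tr_quat_mx bij_theta) zE.
by rewrite detZ det_sl2 mulr1 mxtraceZ.
Qed.

Definition quat_form (p q : k) (u v : k * k * k) : k :=
  p * (u.1.1 * v.1.1) + q * (u.1.2 * v.1.2) + p * q * (u.2 * v.2).

(** Traceless lifts are pure quaternions up to scalars. Ramification makes the norm form on pure
    quaternions positive definite at every real place, where [equal_gram_interval] applies. *)
Lemma triangle_trace_in_field A B D (x : C) :
  ramified_at_real_places R a b ->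
  [/\ \tr (sl2_mx A) = 0, \tr (sl2_mx B) = 0 & \tr (sl2_mx D) = 0] ->
  [/\ \tr (sl2_mx (A * B)%g) = - x, \tr (sl2_mx (A * D)%g) = - x &
      \tr (sl2_mx (B * D)%g) = - x] ->
  (forall g, g = A \/ g = B \/ g = D ->
     exists2 c : C, c != 0 & exists z, quat_mx theta z = c *: sl2_mx g) ->
  exists xi : k, iota xi = x /\
    forall phi : {rmorphism k -> R}, -1 <= phi xi <= 2.
Proof.
move=> ram [tA tB tD] [tAB tAD tBD] norm.
have [cA cA0 [zA zAE]] := norm A (or_introl erefl).
have [cB cB0 [zB zBE]] := norm B (or_intror (or_introl erefl)).
have [cD cD0 [zD zDE]] := norm D (or_intror (or_intror erefl)).
have pure z g (c : C) : quat_mx theta z = c *: sl2_mx g -> \tr (sl2_mx g) = 0 ->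
    exists u : k * k * k, z = (0, u.1.1, u.1.2, u.2).
  move=> /psl2_lift_unit_scale[_] + tg; rewrite tg mulr0 => /eqP.
  rewrite mulf_eq0 pnatr_eq0 /= fmorph_eq0; case: z => [[[z0 z1] z2] z3] /= /eqP->.
  by exists (z1, z2, z3).
have [u uE] := pure _ _ _ zAE tA; have [v vE] := pure _ _ _ zBE tB.
have [w wE] := pure _ _ _ zDE tD.
pose n s := quat_form (- a) (- b) s s.
pose h s t := quat_form (- a) (- b) s t.
have nE z s g (c : C) : z = (0, s.1.1, s.1.2, s.2) :> quat a b ->
    quat_mx theta z = c *: sl2_mx g -> iota (n s) = c ^+ 2.
  move=> -> /psl2_lift_unit_scale[<- _]; congr (iota _).
  by rewrite /n /quat_form /=; ring.
have hE y z s t g g' (c c' : C) : y = (0, s.1.1, s.1.2, s.2) :> quat a b ->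
    z = (0, t.1.1, t.1.2, t.2) :> quat a b ->
    quat_mx theta y = c *: sl2_mx g -> quat_mx theta z = c' *: sl2_mx g' ->
    \tr (sl2_mx (g * g')%g) = - x -> 2 * iota (h s t) = c * c' * x.
  move=> yE' zE' yE zE tr; have := quat_mxM theta y z.
  rewrite yE zE -scalemxAl -scalemxAr scalerA -sl2_mulE => /psl2_lift_unit_scale[_].
  rewrite tr yE' zE' mulrN => /(congr1 -%R); rewrite opprK => <-.
  rewrite -mulrN -rmorphN; congr (_ * iota _).
  by rewrite /h /quat_form /=; ring.
have nA := nE _ _ _ _ uE zAE; have nB := nE _ _ _ _ vE zBE; have nD := nE _ _ _ _ wE zDE.
have hAB := hE _ _ _ _ _ _ _ _ uE vE zAE zBE tAB.
have hAD := hE _ _ _ _ _ _ _ _ uE wE zAE zDE tAD.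
have hBD := hE _ _ _ _ _ _ _ _ vE wE zBE zDE tBD.
have [xi xiE] : exists xi : k, iota xi = x.
  (* In this quotient the scalars [cA], [cB] and [cD] cancel. If [x = 0] the numerator vanishes, so
     the value is right whatever the denominator. *)
  exists (2 * h u w * h v w / (n w * h u v)); rewrite fmorph_div !rmorphM rmorph_nat nD.
  have two0 : 2 != 0 :> C by rewrite pnatr_eq0.
  have [x0|x0] := eqVneq x 0.
    by have -> : iota (h u w) = 0; [apply: (mulfI two0); rewrite hAD x0 !mulr0|rewrite !(mulr0, mul0r) x0].
  have e1 : iota (h u v) = cA * cB * x / 2 by rewrite -hAB mulrC mulKf.
  have e2 : iota (h u w) = cA * cD * x / 2 by rewrite -hAD mulrC mulKf.
  have e3 : iota (h v w) = cB * cD * x / 2 by rewrite -hBD mulrC mulKf.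
  by rewrite e1 e2 e3; field; rewrite cA0 cB0 cD0 x0.
exists xi; split=> // phi.
have [f bij_f] := ram phi.
have [pa pb] := @hamilton_form_neg _ _ _ f (etrans (congr1 negb (fmorph_eq0 phi a)) a0)
  (etrans (congr1 negb (fmorph_eq0 phi b)) b0) bij_f.
have two0 : 2 != 0 :> C by rewrite pnatr_eq0.
have half (e : k) (y : C) : 2 * iota e = y -> iota e = y / 2 by move=> <-; rewrite mulrC mulKf.
have sqr s t (c c' : C) : iota (n s) = c ^+ 2 -> iota (n t) = c' ^+ 2 ->
    2 * iota (h s t) = c * c' * x -> h s t ^+ 2 = n s * n t * (xi ^+ 2 / 4).
  move=> ns nt /half hst; apply: (fmorph_inj iota).
  rewrite rmorphXn 3!rmorphM fmorphV rmorphXn rmorph_nat xiE ns nt hst.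
  by field.
have prod : h u v * h u w * h v w = n u * n v * n w * (xi ^+ 3 / 8).
  apply: (fmorph_inj iota); rewrite 6!rmorphM fmorphV rmorphXn rmorph_nat xiE nA nB nD.
  by rewrite (half _ _ hAB) (half _ _ hAD) (half _ _ hBD); field.
pose im (s : k * k * k) : R * R * R := (phi s.1.1, phi s.1.2, phi s.2).
have imE s t : phi (h s t) = - phi a * ((im s).1.1 * (im t).1.1) +
    - phi b * ((im s).1.2 * (im t).1.2) + - phi a * - phi b * ((im s).2 * (im t).2).
  by rewrite /h /quat_form !(rmorphD, rmorphM, rmorphN).
have imnE s : phi (n s) = - phi a * (im s).1.1 ^+ 2 +
    - phi b * (im s).1.2 ^+ 2 + - phi a * - phi b * (im s).2 ^+ 2.
  by rewrite -[n s]/(h s s) imE !expr2.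
have n0 s (c : C) : c != 0 -> iota (n s) = c ^+ 2 -> phi (n s) != 0.
  by move=> c0 ns; rewrite fmorph_eq0 -(fmorph_eq0 iota) ns expf_neq0.
have phisqr s t : h s t ^+ 2 = n s * n t * (xi ^+ 2 / 4) ->
    phi (h s t) ^+ 2 = phi (n s) * phi (n t) * (phi xi ^+ 2 / 4).
  by move=> e; rewrite -rmorphXn e 3!rmorphM fmorphV rmorphXn rmorph_nat.
have pa' : 0 < - phi a by rewrite oppr_gt0.
have pb' : 0 < - phi b by rewrite oppr_gt0.
apply: (equal_gram_interval (x := im u) (y := im v) (z := im w) pa' pb');
  rewrite -?imnE -?imE.
- exact: n0 cA0 nA.
- exact: n0 cB0 nB.
- exact: n0 cD0 nD.
- exact/phisqr/sqr/hAB.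
- exact/phisqr/sqr/hAD.
- exact/phisqr/sqr/hBD.
- by rewrite -2!rmorphM prod 4!rmorphM fmorphV rmorphXn rmorph_nat.
Qed.

End ArithmeticTriangle.

(** * Integrality and the commensurator *)

Section IntegralEigenvalues.
Variable C : numFieldType.
Local Notation integral := (integralOver (intr : int -> C)).
Implicit Types (p q : {poly C}).

Definition integral_poly_coefs p := forall i, integral p`_i.

Lemma integral_coefsC (c : C) : integral c -> integral_poly_coefs c%:P.
Proof. by move=> ic i; rewrite coefC; case: eqP => // _; exact: (mxpoly.integral0 (intmul (1 : C))). Qed.

Lemma integral_coefsD p q : integral_poly_coefs p -> integral_poly_coefs q ->
  integral_poly_coefs (p + q).
Proof. by move=> ip iq i; rewrite coefD; apply: integral_add. Qed.

Lemma integral_coefsM p q : integral_poly_coefs p -> integral_poly_coefs q ->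
  integral_poly_coefs (p * q).
Proof.
move=> ip iq i; rewrite coefM; apply: big_ind => [||j _].
- exact: (mxpoly.integral0 (intmul (1 : C))).
- exact: integral_add.
- exact: integral_mul.
Qed.

Lemma integral_char_poly n (A : 'M[C]_n) : (forall i j, integral (A i j)) ->
  integral_poly_coefs (char_poly A).
Proof.
move=> iA; have i1 : integral 1 by exact: (mxpoly.integral1 (intmul (1 : C))).
have iN1 : integral_poly_coefs (-1).
  by rewrite -polyC1 -polyCN; apply: integral_coefsC; apply: integral_opp.
rewrite /char_poly /determinant; apply: big_ind => [||s _].
- by apply: integral_coefsC; exact: (mxpoly.integral0 (intmul (1 : C))).
- exact: integral_coefsD.
apply: integral_coefsM.
  by case: (perm.odd_perm s); rewrite ?expr0 ?expr1//; apply: integral_coefsC.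
apply: big_ind => [||i _]; first exact: integral_coefsC.
- exact: integral_coefsM.
rewrite !mxE; apply: integral_coefsD.
  move=> j; rewrite coefMn coefX; case: (j == 1); case: (i == _); rewrite ?mulr0n ?mulr1n//;
    exact: (mxpoly.integral0 (intmul (1 : C))).
by rewrite -mulN1r; apply: integral_coefsM => //; apply: integral_coefsC.
Qed.

Lemma integral_eigenvalue n (A : 'M[C]_n) (v : 'cV[C]_n) (e : C) :
  (forall i j, integral (A i j)) -> v != 0 -> A *m v = e *: v -> integral e.
Proof.
move=> iA v0 Av; apply: (integral_root_monic (char_poly_monic A)).
  have dE : (char_poly A).[e] = \det (e%:M - A).
    rewrite -horner_evalE /char_poly -det_map_mx; congr (\det _); apply/matrixP => i j.
    by rewrite !mxE /= /horner_eval hornerD hornerMn hornerX hornerN hornerC.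
  rewrite rootE dE; apply: contraNT v0 => d0.
  have uB : e%:M - A \in unitmx by rewrite unitmxE unitfE.
  rewrite -[v](mulKmx uB) mulmxBl mul_scalar_mx Av subrr mulmx0//.
by apply/integral_poly; apply: integral_char_poly.
Qed.

Lemma integral_of_power (x : C) n : (0 < n)%N -> integral (x ^+ n) -> integral x.
Proof.
move=> n0 ixn; apply: (@integral_root_monic _ _ _ _ ('X^n - (x ^+ n)%:P)).
- exact: monicXnsubC.
- by rewrite rootE !hornerE subrr.
apply/integral_poly; rewrite -polyCN; apply: integral_coefsD.
  by move=> i; rewrite coefXn; case: (i == n);
    [exact: (mxpoly.integral1 (intmul (1 : C)))|exact: (mxpoly.integral0 (intmul (1 : C)))].
by apply: integral_coefsC; apply: integral_opp.
Qed.

End IntegralEigenvalues.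

Lemma integral_iota (k : fieldExtType rat) (C : numFieldType) (f : {rmorphism k -> C}) (c : k) :
  integralOver (intr : int -> C) (f c) <-> algebraic_integer c.
Proof.
split=> -[p mp pc]; exists p => //; move: pc;
  rewrite -(fmorph_root f) -map_poly_comp;
  by congr (root _ _); apply: eq_map_poly => z /=; rewrite rmorph_int.
Qed.

Section OrderEigenvalues.
Variables (R : realType) (k : fieldExtType rat) (iota : {rmorphism k -> R[i]}).
Local Notation C := R[i].
Variables (a b : k) (theta : {lrmorphism quat (iota a) (iota b) -> 'M[C]_2}).
Variable O : set (quat a b).
Hypothesis order_O : is_order O.

Lemma quat_mx_sum I (r : seq I) (P : pred I) (f : I -> quat a b) :
  quat_mx theta (\sum_(i <- r | P i) f i) = \sum_(i <- r | P i) quat_mx theta (f i).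
Proof. by apply: (big_morph _ (quat_mxD theta) (quat_mx0 theta)). Qed.

(** Right multiplication by [h] maps the generators of [O] to integral combinations of themselves.
    Applied to [u], this makes [e] an eigenvalue of the matrix of these coefficients; the generators
    need not be independent. *)
Lemma order_eigenvalue_integral (h : quat a b) (u : 'cV[C]_2) (e : C) : O h ->
  u != 0 -> quat_mx theta h *m u = e *: u -> integralOver (intr : int -> C) e.
Proof.
move=> Oh u0 hu; case: (order_O) => _ _ [n [f OE]] _.
have Of i : O (f i).
  rewrite OE; exists (fun j => (j == i)%:R) => [j|].
    by rewrite /algebraic_integer; exact: (mxpoly.integral_nat (intmul (1 : k))).
  rewrite (bigD1 i)//= eqxx scale1r big1 ?addr0// => j ji.
  by rewrite (negPf ji) scale0r.
have /fin_all_exists[c cP] i : exists c : 'I_n -> k,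
    (forall j, algebraic_integer (c j)) /\ f i * h = \sum_j c j *: f j.
  have := orderM order_O (Of i) Oh; rewrite {1}OE => -[c c1 c2].
  by exists c.
have [d dE] : exists d : 'I_n -> k, 1 = \sum_i d i *: f i.
  by have := order1 order_O; rewrite OE => -[d _ dE]; exists d.
have [w wE] : exists w : 'I_n -> 'cV[C]_2, forall i, quat_mx theta (f i) *m u = w i.
  by exists (fun i => quat_mx theta (f i) *m u).
pose E : 'M[C]_(n, 2) := \matrix_(i, j) w i j 0.
(* As 1 is a combination of the generators, [u] is one of the vectors [w i]; these cannot all
   vanish. *)
have [j Ej] : exists j, col j E != 0.
  apply: contrapT => nex; move/eqP: u0; apply.
  have -> : u = quat_mx theta 1 *m u by rewrite quat_mx1 mul1mx.
  rewrite dE quat_mx_sum mulmx_suml big1// => i _; rewrite quat_mxZ -scalemxAl.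
  rewrite wE; suff -> : w i = 0 by rewrite scaler0.
  apply/colP => j; rewrite [RHS]mxE; apply: contrapT => /eqP nz; apply: nex.
  by exists j; apply: contraNneq nz => /colP/(_ i); rewrite !mxE => ->.
apply: (@integral_eigenvalue _ n (\matrix_(i, l) iota (c i l)) (col j E)) => //.
  by move=> i l; rewrite mxE; apply/integral_iota; apply: (cP i).1.
apply/colP => i; rewrite !mxE.
have := congr1 (fun v : 'cV[C]_2 => v j 0) (congr1 (mulmx (quat_mx theta (f i))) hu).
rewrite /= mulmxA -quat_mxM (cP i).2 quat_mx_sum mulmx_suml -scalemxAr wE summxE.
rewrite [X in _ = X]mxE => <-; apply: eq_bigr => l _.
by rewrite quat_mxZ -scalemxAl wE !mxE.
Qed.

End OrderEigenvalues.

Lemma sl2_eigenvector (C : closedFieldType) (M : 'M[C]_2) (e : C) :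
  e ^+ 2 - \tr M * e + \det M = 0 -> exists2 u : 'cV[C]_2, u != 0 & M *m u = e *: u.
Proof.
move=> char0; have : \det (M - e%:M)^T == 0.
  by rewrite det_tr -char0 mxtrace2 !det2 !entriesE; apply/eqP; ring.
move=> /det0P[v v0 vM]; exists v^T; first by rewrite trmx_eq0.
apply/eqP; rewrite -subr_eq0 -mul_scalar_mx -mulmxBl -[M - _]trmxK -trmx_mul vM.
by rewrite trmx0.
Qed.

Lemma nat_denominator (k : fieldExtType rat) (c : k) :
  exists2 d : nat, (0 < d)%N & algebraic_integer (d%:R * c).
Proof.
have [p [mon_p _ pc _]] := rat_min_poly c.
pose d := (\prod_(i < size p) `|denq p`_i|)%N.
have d0 : (0 < d)%N by rewrite prodn_gt0// => i; rewrite absz_gt0 denq_eq0.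
exists d => //; pose n := (size p).-1.
have sp : size p = n.+1 by rewrite prednK// size_poly_gt0 monic_neq0.
have lp : p`_n = 1 by have := monicP mon_p; rewrite lead_coefE.
have dp i : exists z : int, (d%:R * p`_i)%:A = z%:~R :> k.
  have [lti|] := ltnP i (size p); last by move/(nth_default 0) => ->; exists 0; rewrite mulr0 scale0r.
  exists ((d %/ `|denq p`_i|)%:Z * numq p`_i).
  have dvd : (`|denq p`_i| %| d)%N.
    by rewrite /d (bigD1 (Ordinal lti))//= dvdn_mulr.
  have e : d%:R * p`_i = ((d %/ `|denq p`_i|)%:Z * numq p`_i)%:~R :> rat.
    rewrite rmorphM /= numqE -{1}(divnK dvd) natrM -mulrA; congr (_ * _).
    by rewrite mulrC; congr (_ * _); rewrite pmulrn absz_denq.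
  by rewrite e alg_num_field ratr_int.
(* The monic polynomial of [d c]: the coefficient of degree [i] is scaled by [d^(n-i)], and for
   [i < n] one factor [d] already clears its denominator. *)
pose Q : {poly k} := \poly_(i < n.+1) ((p`_i)%:A * d%:R ^+ (n - i)).
have Qn : Q`_n = 1 by rewrite coef_poly ltnSn lp subnn expr0 mulr1 scale1r.
have monQ : Q \is monic.
  by rewrite monicE lead_coefE size_poly_eq /= ?Qn//= subnn expr0 mulr1 lp scale1r oner_eq0.
apply: (integral_root_monic monQ).
  rewrite rootE horner_poly; apply/eqP.
  transitivity (d%:R ^+ n * (map_poly (in_alg k) p).[c]); last by rewrite (rootP pc) mulr0.
  rewrite horner_coef size_map_poly sp mulr_sumr; apply: eq_bigr => i _.
  have -> : d%:R ^+ n = d%:R ^+ (n - i) * d%:R ^+ i :> k.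
    by rewrite -exprD subnK// -ltnS.
  by rewrite coef_map exprMn /=; move: (_%:A) => e; ring.
apply/integral_poly => i; rewrite coef_poly; case: ifP => [|_]; last first.
  exact: (mxpoly.integral0 (intmul (1 : k))).
rewrite ltnS leq_eqVlt => /predU1P[->|lti].
  by rewrite subnn expr0 mulr1 lp scale1r; exact: (mxpoly.integral1 (intmul (1 : k))).
have [z zE] := dp i; rewrite -(subnSK lti) exprS mulrA.
have -> : (p`_i)%:A * d%:R = z%:~R :> k.
  by rewrite -[RHS]zE -[RHS]/(in_alg k _) rmorphM rmorph_nat mulrC.
by rewrite -natrX -(rmorph_nat (intmul (1 : k))) -rmorphM; apply: mxpoly.integral_id.
Qed.

Section Commensurator.
Variables (R : realType) (k : fieldExtType rat) (iota : {rmorphism k -> R[i]}).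
Local Notation C := R[i].
Variables (a b : k) (theta : {lrmorphism quat (iota a) (iota b) -> 'M[C]_2}).
Variable O : set (quat a b).
Hypotheses (bij_theta : bijective theta) (order_O : is_order O).
Implicit Types x y z q h : quat a b.

Lemma algebraic_integer_nat n : algebraic_integer (n%:R : k).
Proof. exact: (mxpoly.integral_nat (intmul (1 : k))). Qed.

Lemma finite_common_multiple n (P : 'I_n -> nat -> Prop) :
  (forall i d e, P i d -> P i (e * d)%N) ->
  (forall i, exists2 d, (0 < d)%N & P i d) ->
  exists2 d, (0 < d)%N & forall i, P i d.
Proof.
move=> Pmul exP; have /fin_all_exists[d dP] i : exists d, (0 < d)%N /\ P i d.
  by have [d d0 Pd] := exP i; exists d.
exists (\prod_i d i)%N; first by rewrite prodn_gt0// => i; apply: (dP i).1.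
by move=> i; rewrite (bigD1 i)//= mulnC; apply: Pmul; apply: (dP i).2.
Qed.

Lemma order_denominator z : exists2 d, (0 < d)%N & O (d%:R *: z).
Proof.
case: (order_O) => _ _ _ /(_ z)[n [c [e [Oe ->]]]].
have [| |d d0 dP] := @finite_common_multiple n (fun i d => algebraic_integer (d%:R * c i)).
- by move=> i d f h; rewrite natrM -mulrA; apply: integral_mul h; apply: algebraic_integer_nat.
- by move=> i; apply: nat_denominator.
exists d => //; rewrite scaler_sumr; apply: (order_sum order_O) => i _.
by rewrite scalerA; exact: (orderZ order_O (dP i) (Oe i)).
Qed.

(** [O] is finitely generated over the algebraic integers, so it is enough to clear the denominators
    for the generators. *)
Lemma order_conj_denominator p q :
  exists2 d, (0 < d)%N & forall y, O y -> O (d%:R *: (p * y * q)).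
Proof.
case: (order_O) => _ _ [n [e OE]] _.
have [| |d d0 dP] := @finite_common_multiple n (fun i d => O (d%:R *: (p * e i * q))).
- move=> i d f h; rewrite natrM -scalerA; apply: (orderZ order_O) h.
  exact: algebraic_integer_nat.
- by move=> i; apply: order_denominator.
exists d => // y; rewrite {1}OE => -[c cP ->].
rewrite mulr_sumr mulr_suml scaler_sumr; apply: (order_sum order_O) => i _.
rewrite -scalerAr -scalerAl scalerA mulrC -scalerA.
exact: (orderZ order_O (cP i) (dP i)).
Qed.

Lemma order_trace_integral h : O h -> algebraic_integer (2 * quat_re h).
Proof.
move=> Oh; apply/(integral_iota iota).
rewrite rmorphM rmorph_nat -(tr_quat_mx bij_theta); set M := quat_mx theta h.
pose s := sqrtC (\tr M ^+ 2 - 4 * \det M).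
have eig e : e = (\tr M + s) / 2 \/ e = (\tr M - s) / 2 -> e ^+ 2 - \tr M * e + \det M = 0.
  have s2 : s ^+ 2 = \tr M ^+ 2 - 4 * \det M by rewrite sqrtCK.
  move=> eE; have -> : e ^+ 2 - \tr M * e + \det M = (s ^+ 2 - (\tr M ^+ 2 - 4 * \det M)) / 4.
    by case: eE => ->; field.
  by rewrite s2 subrr mul0r.
have -> : \tr M = (\tr M + s) / 2 + (\tr M - s) / 2 by field.
have int e : e = (\tr M + s) / 2 \/ e = (\tr M - s) / 2 -> integralOver (intr : int -> C) e.
  move=> /eig/sl2_eigenvector[u u0 Mu].
  exact: (order_eigenvalue_integral order_O Oh u0 Mu).
by apply: integral_add; apply: int; [left|right].
Qed.

End Commensurator.

(** The quotient of the integer polynomials by [g] and [d] is finite: every class has a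
    representative of bounded degree and bounded coefficients. *)
Lemma int_poly_mod (d m : nat) (g : {poly int}) : (0 < d)%N -> g \is monic ->
  size g = m.+1 -> forall p : {poly int}, exists r s q : {poly int},
    [/\ (size r <= m)%N, forall i, `|r`_i| <= d%:Z & p = q * g + r + d%:Z *: s].
Proof.
move=> d0 mon_g sg p; have d0' : d%:Z != 0 by case: d d0.
pose u := Pdiv.Ring.rmodp p g.
have su : (size u <= m)%N.
  by rewrite -ltnS -sg Pdiv.Ring.ltn_rmodpN0 ?monic_neq0.
exists (\poly_(i < m) (u`_i %% d)%Z), (\poly_(i < m) (u`_i %/ d)%Z), (Pdiv.Ring.rdivp p g).
split; first exact: size_poly.
  move=> i; rewrite coef_poly; case: ifP => // _.
  by rewrite ger0_norm ?modz_ge0// ltW// -[X in _ < X]gez0_abs// ltz_mod.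
rewrite {1}(Pdiv.RingMonic.rdivp_eq mon_g p) -/u -addrA; congr (_ + _).
apply/polyP => i; rewrite coefD coefZ !coef_poly; case: ltnP => mi.
  by rewrite {1}(divz_eq u`_i d) mulrC addrC.
by rewrite mulr0 addr0 nth_default// (leq_trans su).
Qed.

Section UnitPowers.
Variables (k : fieldExtType rat) (a b : k) (O : set (quat a b)).
Hypothesis order_O : is_order O.
Implicit Types (h y : quat a b) (tau : k).

Lemma algebraic_integer_horner (p : {poly int}) tau : algebraic_integer tau ->
  algebraic_integer (map_poly intr p).[tau].
Proof.
move=> itau; apply: (integral_horner (RtoK := intmul (1 : k))) => //.
by apply/integral_poly => i; rewrite coef_map; apply: mxpoly.integral_id.
Qed.

(** Chebyshev-like polynomials in the trace: multiplying [p h + q] by [h] and using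
    [h^2 = tau h - 1] gives [(p tau + q) h - p]. *)
Fixpoint power_coefs n : {poly int} * {poly int} :=
  if n is n'.+1 then
    let: (p, q) := power_coefs n' in (p * 'X + q, - p)
  else (0, 1).

Lemma power_coefsE h tau : h * h = tau *: h - 1 -> forall n,
  h ^+ n = (map_poly intr (power_coefs n).1).[tau] *: h +
           (map_poly intr (power_coefs n).2).[tau] *: 1.
Proof.
move=> hh; elim=> [|n IH].
  by rewrite /= rmorph0 rmorph1 horner0 hornerC scale0r add0r scale1r.
rewrite exprSr IH /=; case: (power_coefs n) => p q /=.
rewrite rmorphD rmorphM rmorphN /= map_polyX hornerD hornerM hornerX hornerN.
rewrite mulrDl -!scalerAl mul1r hh scalerBr scalerA scaleNr scalerDl.
by rewrite addrAC.
Qed.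

(** The pairs of coefficients of the powers of [h] take finitely many values modulo [d], so two
    powers are congruent; [h] is invertible in [O] and the smaller power can be cancelled. *)
Lemma unit_power_congruence h tau (d : nat) : (0 < d)%N -> O h ->
  h * h = tau *: h - 1 -> algebraic_integer tau ->
  exists N y, [/\ (0 < N)%N, O y & h ^+ N = 1 + d%:R *: y].
Proof.
move=> d0 Oh hh itau; have [g mon_g gt] := itau.
have [m sg] : exists m, size g = m.+1.
  by exists (size g).-1; rewrite prednK// size_poly_gt0 monic_neq0.
have modP := int_poly_mod d0 mon_g sg.
pose res p := sval (cid (modP p)).
have resP p : exists s q, [/\ (size (res p) <= m)%N, forall i, `|(res p)`_i| <= d%:Z &
    p = q * g + res p + d%:Z *: s] := svalP (cid (modP p)).
have resE p q : res p = res q -> exists s : {poly int},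
    (map_poly intr p).[tau] = (map_poly intr q).[tau] + d%:R * (map_poly intr s).[tau].
  move=> pq; have [s [u [_ _ pE]]] := resP p; have [s' [u' [_ _ qE]]] := resP q.
  exists (s - s'); rewrite pE qE pq !(rmorphD, rmorphM, rmorphN) /= !map_polyZ /=.
  rewrite !(hornerD, hornerM, hornerN, hornerZ) (rootP gt) !mulr0 !add0r -[d%:Z%:~R]/(d%:R).
  by ring.
pose f n := (res (power_coefs n).1, res (power_coefs n).2).
have finf : finite_set (range f).
  have finr := finite_bounded_int_poly m d.
  apply: (sub_finite_set _ (finite_setX finr finr)) => _ [n _ <-].
  by split=> /=; have [s [q [? ?]]] := resP (power_coefs n).1;
     have [s' [q' [? ?]]] := resP (power_coefs n).2.
have [i [j [ij [/resE[s sE] /resE[s' s'E]]]]] := nat_pigeonhole finf.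
pose y := (map_poly intr s).[tau] *: h + (map_poly intr s').[tau] *: 1.
have Oy : O y.
  apply: (orderD order_O); [apply: (orderZ order_O) Oh|apply: (orderZ order_O) (order1 order_O)];
    exact: algebraic_integer_horner.
have hij : h ^+ i = h ^+ j + d%:R *: y.
  rewrite !(power_coefsE hh) sE s'E /y !scalerDl !scalerDr !scalerA.
  by rewrite addrACA.
(* The inverse of [h], read off from [h^2 = tau h - 1]; it lies in [O] because [tau] is integral. *)
pose h' := tau *: 1 - h.
have h'h : h' * h = 1 by rewrite /h' mulrBl -scalerAl mul1r hh opprB addrC subrK.
have Oh' : O h'.
  by apply: (orderD order_O); [exact: (orderZ order_O itau (order1 order_O))|exact: orderN].
have h'X n : h' ^+ n * h ^+ n = 1.
  elim: n => [|n IH]; first by rewrite mulr1.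
  by rewrite exprSr exprS mulrA -(mulrA _ h') h'h mulr1.
exists (j - i)%N, (- (h' ^+ i * y)); split.
- by rewrite subn_gt0.
- by apply: (orderN order_O); apply: (orderM order_O) => //; exact: orderX.
have := congr1 (fun z => h' ^+ i * z) hij.
rewrite h'X -{1}(subnKC (ltnW ij)) exprD mulrDr mulrA h'X mul1r -scalerAr => ->.
by rewrite scalerN addrK.
Qed.

Lemma quat_inv (q : quat a b) : reduced_norm q != 0 ->
  exists2 q', q' * q = 1 & q * q' = 1.
Proof.
move=> nq; exists ((reduced_norm q)^-1 *: quat_conj q).
  rewrite -scalerAl; have -> : quat_conj q * q = reduced_norm q *: 1.
    by case: q {nq} => [[[x0 x1] x2] x3]; congr (_, _, _, _) => /=; ring.
  by rewrite scalerA mulVf// scale1r.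
by rewrite -scalerAr mul_quat_conj scalerA mulVf// scale1r.
Qed.

End UnitPowers.

Section CommensuratorPower.
Variables (R : realType) (k : fieldExtType rat) (iota : {rmorphism k -> R[i]}).
Local Notation C := R[i].
Variables (a b : k) (theta : {lrmorphism quat (iota a) (iota b) -> 'M[C]_2}).
Variable O : set (quat a b).
Hypotheses (bij_theta : bijective theta) (order_O : is_order O).

(* [h^N] is 1 modulo a common denominator of conjugation by [q]. *)
Lemma order_conj_power (h q q' : quat a b) : O h -> reduced_norm h = 1 ->
  q * q' = 1 -> exists2 N, (0 < N)%N & O (q * h ^+ N * q').
Proof.
move=> Oh nh qq'; have [d d0 dP] := order_conj_denominator order_O q q'.
have hh : h * h = (2 * quat_re h) *: h - 1.
  have /eqP := quat_char_poly h; rewrite nh scale1r -addrA addr_eq0 => /eqP ->.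
  by rewrite opprD opprK.
have [N [y [N0 Oy hN]]] := unit_power_congruence order_O d0 Oh hh
  (order_trace_integral bij_theta order_O Oh).
exists N => //; rewrite hN mulrDr mulr1 mulrDl qq' -scalerAr -scalerAl.
by apply: (orderD order_O); [exact: order1|exact: dP].
Qed.

End CommensuratorPower.

(** * The trace bound *)

Section Density.
Variables (R : realType) (k : fieldExtType rat) (iota : {rmorphism k -> R[i]}).
Local Notation C := R[i].
Hypothesis nonreal : exists x, complex.Im (iota x) != 0.

(** The rational combinations of 1 and of one nonreal element are already dense: the coefficient of
    [x] adjusts the imaginary part, the rational summand then the real part. *)
Lemma field_dense (z eps : C) : 0 < eps -> exists c : k, `|iota c - z| < eps.
Proof.
rewrite ltcE /= => /andP[/eqP im0 e0]; set e := complex.Re eps in e0.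
have epsE : eps = e%:C by apply/eqP; rewrite eq_complex /= eqxx im0 eqxx.
have ratc (r : rat) : iota (in_alg k r) = (ratr r)%:C.
  by rewrite /= alg_num_field !fmorph_rat.
have [x imx] := nonreal; set p := complex.Re (iota x); set q := complex.Im (iota x).
have q0 : 0 < `|q| by rewrite normr_gt0.
have e2 : 0 < e / 2 / `|q| by rewrite !divr_gt0.
have rat_near (y d : R) : 0 < d -> exists r : rat, `|ratr r - y| < d.
  move=> d0; have lt : y - d < y + d by lra.
  have [r] := rat_in_itvoo lt; rewrite in_itv /= => /andP[r1 r2]; exists r.
  by rewrite ltr_norml; apply/andP; split; lra.
have [s sP] := rat_near (complex.Im z / q) _ e2.
have [r rP] := rat_near (complex.Re z - ratr s * p) (e / 2) (divr_gt0 e0 (ltr0n _ 2)).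
exists (in_alg k r + in_alg k s * x).
rewrite rmorphD rmorphM !ratc epsE.
have -> : (ratr r)%:C + (ratr s)%:C * iota x - z =
  (ratr r + ratr s * p - complex.Re z) +i* (ratr s * q - complex.Im z).
  by rewrite /p /q; case: (iota x) => u v; case: z {sP rP} => u' v'; apply/eqP;
    rewrite eq_complex /= !mul0r !subr0 !addr0 !add0r !eqxx.
rewrite normc_def ltcR /=.
set u := _ - complex.Re z; set v := _ - complex.Im z.
have u1 : `|u| < e / 2 by move: rP; rewrite /u opprB addrA addrAC.
have v1 : `|v| < e / 2.
  have -> : v = (ratr s - complex.Im z / q) * q by rewrite /v; field.
  by rewrite normrM -ltr_pdivlMr.
apply: (@le_lt_trans _ _ (`|u| + `|v|)); last by lra.
rewrite -[leRHS]ger0_norm ?addr_ge0// -sqrtr_sqr ler_wsqrtr// (sqrrD `|u|).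
by rewrite !real_normK ?num_real// addrAC lerDl mulrn_wge0 ?mulr_ge0.
Qed.

Variables (a b : k) (theta : {lrmorphism quat (iota a) (iota b) -> 'M[C]_2}).
Hypothesis bij_theta : bijective theta.

(** The four complex coordinates of [X^-1 Y^-1] are approximated in [k]; [S] bounds how far these
    errors are magnified. *)
Lemma quat_mx_dense (X Y : 'M[C]_2) (eps : C) : X \in unitmx -> Y \in unitmx ->
  0 < eps -> exists q : quat a b, forall i j,
    `|(X *m quat_mx theta q *m Y - 1%:M) i j| < eps.
Proof.
move=> uX uY e0.
have [c0 [c1 [c2 [c3 TE]]]] := quat_mx_span bij_theta (invmx X *m invmx Y).
have [E EE] : exists E : quat a b -> 'M[C]_2, forall x, E x = X *m quat_mx theta x *m Y.
  by exists (fun x => X *m quat_mx theta x *m Y).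
pose S := \sum_(i < 2) \sum_(j < 2) (`|E 1 i j| + `|E (quat_i a b) i j| +
   `|E (quat_j a b) i j| + `|E (quat_k a b) i j|).
have S0 : 0 <= S by do 2!(apply: sumr_ge0 => ? _); rewrite !addr_ge0.
have S1 : 0 < 1 + S by rewrite ltr_wpDr.
have d0 : 0 < eps / (1 + S) by rewrite divr_gt0.
have [k0 k0P] := field_dense c0 d0; have [k1 k1P] := field_dense c1 d0.
have [k2 k2P] := field_dense c2 d0; have [k3 k3P] := field_dense c3 d0.
exists (k0 *: 1 + k1 *: quat_i a b + k2 *: quat_j a b + k3 *: quat_k a b) => i j.
have sandE (c d e f : C) (M N P Q : 'M[C]_2) :
    X *m (c *: M + d *: N + e *: P + f *: Q) *m Y =
    c *: (X *m M *m Y) + d *: (X *m N *m Y) + e *: (X *m P *m Y) + f *: (X *m Q *m Y).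
  by rewrite !mulmxDr !mulmxDl -!scalemxAr -!scalemxAl.
have oneE : 1%:M = c0 *: E 1 + c1 *: E (quat_i a b) + c2 *: E (quat_j a b) + c3 *: E (quat_k a b).
  have -> : 1%:M = X *m (invmx X *m invmx Y) *m Y.
    by rewrite mulmxA mulmxV// mul1mx mulVmx.
  by rewrite TE -(scalemx1 2 c0) -(quat_mx1 theta) sandE !EE.
have -> : X *m quat_mx theta (k0 *: 1 + k1 *: quat_i a b + k2 *: quat_j a b + k3 *: quat_k a b) *m Y
    - 1%:M = (iota k0 - c0) *: E 1 + (iota k1 - c1) *: E (quat_i a b) +
    (iota k2 - c2) *: E (quat_j a b) + (iota k3 - c3) *: E (quat_k a b).
  rewrite oneE !quat_mxD !quat_mxZ sandE -!EE.
  rewrite !scalerBl !opprD; move: (E _) (E _) (E _) (E _) => E0 E1 E2 E3.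
  by apply/matrixP => l m; rewrite !(addmxE, oppmxE, scalemxE); ring.
rewrite !(addmxE, scalemxE).
have Sij : `|E 1 i j| + `|E (quat_i a b) i j| + `|E (quat_j a b) i j| + `|E (quat_k a b) i j| <= S.
  have le_sum2 (w : 'I_2 -> 'I_2 -> C) : (forall i j, 0 <= w i j) ->
      w i j <= \sum_i \sum_j w i j.
    move=> w0; rewrite (bigD1 i)//= (bigD1 j)//= -addrA lerDl addr_ge0//.
      by apply: sumr_ge0.
    by do 2!(apply: sumr_ge0 => ? _).
  by apply: (le_sum2 (fun i j => _)) => l m; rewrite !addr_ge0.
have bound (c e : C) : `|c| < eps / (1 + S) -> `|c * e| <= eps / (1 + S) * `|e|.
  by move=> lt; rewrite normrM ler_wpM2r// ltW.
apply: (@le_lt_trans _ _ (eps / (1 + S) * S)); last first.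
  by rewrite -mulrA gtr_pMr// mulrC ltr_pdivrMr// mul1r ltrDr.
apply: (le_trans _ (ler_wpM2l (ltW d0) Sij)); rewrite !mulrDr.
by do 3!(apply: (le_trans (ler_normD _ _)); apply: lerD; last exact: bound); apply: bound.
Qed.

End Density.

Section OutsideVector.
Variable C : numClosedFieldType.

(** The vector [cv2 1 0] is the point at infinity, outside all discs. The margin [eta] leaves room
    for the determinant, since [4 eta < 1], and for the discs, since [(2 + |s|) eta <= 1]. *)
Lemma near_identity (s eta : C) (X : 'M[C]_2) :
  0 < eta -> eta * 8 * (1 + `|s|) = 1 ->
  (forall i j, `|(X - 1%:M) i j| < eta) ->
  \det X != 0 /\ forall u, u ^+ 3 = 1 -> outside s u (X *m cv2 1 0).
Proof.
have [F ->] : exists F : 'M[C]_2, X = 1%:M + F.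
  by exists (X - 1%:M); rewrite addrC subrK.
move=> e0 eE near.
have s1 : 1 <= 1 + `|s| by rewrite lerDl.
have e8 : eta * 8 <= 1.
  by rewrite -[leRHS]eE ler_peMr// mulr_ge0// ltW.
have e1 : eta <= 1.
  by apply: le_trans e8; rewrite ler_peMr ?(ltW e0) ?ler1n.
have nF i j : `|F i j| < eta by have := near i j; rewrite addrAC subrr add0r.
have nM (x y : C) : `|x| < eta -> `|y| < eta -> `|x * y| <= eta.
  move=> xe ye; rewrite normrM -[eta]mulr1 ler_pM// ?(ltW xe)// (le_trans (ltW ye))//.
split.
  rewrite det2 !entriesE; set d := _ - _.
  have dE : d = 1 - - (F 0 0 + F 1 1 + F 0 0 * F 1 1 - F 0 1 * F 1 0) by rewrite /d; ring.
  rewrite dE subr_eq0; apply/eqP => e.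
  have le4 : 1 <= eta + eta + eta + eta.
    rewrite -[leLHS]normr1 e normrN (le_trans (ler_normB _ _))// lerD ?nM//.
    rewrite (le_trans (ler_normD _ _))// lerD ?nM//.
    by rewrite (le_trans (ler_normD _ _))// lerD// ltW.
  have : 1 + 1 <= 1 :> C.
    apply: le_trans e8; have -> : eta * 8 = eta + eta + eta + eta + (eta + eta + eta + eta) by ring.
    exact: lerD.
  by rewrite gerDl ler10.
move=> u u3; rewrite /outside !entriesE !mulr1 !mulr0 !addr0 add0r.
have nu := norm_cube_root u3.
have lt1 : `|F 1 0| < eta := nF 1 0.
apply: (lt_le_trans lt1).
have -> : u * (1 + F 0 0) - s * F 1 0 = u - (s * F 1 0 - u * F 0 0) by ring.
apply: le_trans (lerB_dist _ _); rewrite nu lerBrDr.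
have : `|s * F 1 0 - u * F 0 0| <= `|s| * eta + eta.
  rewrite (le_trans (ler_normB _ _))// !normrM nu mul1r lerD ?ler_wpM2l// ltW//.
move=> h; apply: (le_trans (lerD (lexx eta) h)).
rewrite -[leRHS]eE.
have -> : eta * 8 * (1 + `|s|) =
    eta + (`|s| * eta + eta) + eta * (6 + 7 * `|s|) by ring.
by rewrite lerDl mulr_ge0// ?ltW// ltr_wpDr ?mulr_ge0.
Qed.

End OutsideVector.

Section TraceBound.
Variables (R : realType).
Local Notation C := R[i].
Implicit Types (A B D M g : SL2 R) (G H : set (PSL2 R)).

Lemma sl2_mxX M n : sl2_mx (M ^+ n)%g = sl2_mx M ^+ n.
Proof.
by elim: n => [|n IH]; [rewrite expg0|rewrite expgS sl2_mulE IH exprS].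
Qed.

Lemma psl2_projX M n : psl2_proj (M ^+ n)%g = (psl2_proj M ^+ n)%g.
Proof.
by elim: n => [|n IH]; [rewrite !expg0|rewrite !expgS psl2_projM IH].
Qed.

Lemma eigenvectorX (X : 'M[C]_2) (v : 'cV[C]_2) (e : C) n : X *m v = e *: v ->
  X ^+ n *m v = e ^+ n *: v.
Proof.
move=> Xv; elim: n => [|n IH]; first by rewrite !expr0 scale1r [1 *m v]mul1mx.
by rewrite !exprS -[(X * _) *m v]mulmxA IH -scalemxAr Xv scalerA mulrC.
Qed.

(** Half-turns are their own inverses in PSL(2,C), so the group consists of products of generators;
    in the basis [P] these are reduced words up to sign. *)
Lemma generated_reduced_word A B D (s w : C) (P : 'M[C]_2) : w ^+ 3 = 1 ->
  sl2_mx A *m P = P *m std_mx s 1 -> sl2_mx B *m P = P *m std_mx s w ->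
  sl2_mx D *m P = P *m std_mx s (w ^+ 2) ->
  [/\ \tr (sl2_mx A) = 0, \tr (sl2_mx B) = 0 & \tr (sl2_mx D) = 0] ->
  forall M, generated [set psl2_proj A; psl2_proj B; psl2_proj D] (psl2_proj M) ->
  exists o W, reduced_word s o W /\
    (sl2_mx M *m P = P *m W \/ sl2_mx M *m P = - (P *m W)).
Proof.
move=> w3 AP BP DP [tA tB tD] M GM.
have inv (X : SL2 R) : \tr (sl2_mx X) = 0 -> psl2_proj X^-1%g = psl2_proj X.
  move=> tX; apply/psl2_projP; right; rewrite sl2_invE.
  rewrite -[LHS]mulmx1 -[1%:M]opprK -(traceless_sqr tX (det_sl2 X)) mulmxN.
  by rewrite mulmxA mulVmx ?unitmx_sl2// mul1mx.
suff [M' [eMM [oo [W [rW MW]]]]] : exists M', psl2_proj M = psl2_proj M' /\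
    exists o W, reduced_word s o W /\
    (sl2_mx M' *m P = P *m W \/ sl2_mx M' *m P = - (P *m W)).
  exists oo, W; split=> //; move/psl2_projP: eMM => [->//|->]; rewrite mulNmx.
  by case: MW => ->; rewrite ?opprK; [right|left].
move: GM; apply: (@generated_ind _ _ (fun x => exists M', x = psl2_proj M' /\
    exists o W, reduced_word s o W /\
    (sl2_mx M' *m P = P *m W \/ sl2_mx M' *m P = - (P *m W)))).
- move=> x [[->|->]|->]; rewrite -psl2_projV inv//; [by left; left|by left; right|by right].
- exists 1%g; split=> //; exists None, 1%:M; split; first exact: reduced_nil.
  by left; rewrite sl2_oneE mul1mx mulmx1.
have step (X : SL2 R) u y : u ^+ 3 = 1 -> sl2_mx X *m P = P *m std_mx s u ->
   (exists M', y = psl2_proj M' /\ exists o W, reduced_word s o W /\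
    (sl2_mx M' *m P = P *m W \/ sl2_mx M' *m P = - (P *m W))) ->
   exists M', (psl2_proj X * y)%g = psl2_proj M' /\ exists o W, reduced_word s o W /\
    (sl2_mx M' *m P = P *m W \/ sl2_mx M' *m P = - (P *m W)).
  move=> u3 XP [M' [-> [oo [W [rW MW]]]]]; exists (X * M')%g; split; first by rewrite psl2_projM.
  have [oo' [W' [rW' WW']]] := reduced_word_mul u3 rW; exists oo', W'; split=> //.
  rewrite sl2_mulE -mulmxA; case: MW WW' => -> [] WW';
    rewrite ?mulmxN mulmxA XP -mulmxA WW' ?mulmxN ?opprK; (by left) || (by right).
move=> x y [[->|->]|->]; [apply: step AP|apply: step BP|apply: step DP] => //.
  by rewrite expr1n.
by rewrite -exprM mulnC exprM w3 expr1n.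
Qed.

End TraceBound.

Section StdPower.
Variable C : numClosedFieldType.

(** The word alternates the letters 1 and [w] and is therefore reduced; it moves infinity into a
    disc, whereas a scalar fixes it. *)
Lemma std_mx_power_nonscalar (s w c : C) n : 4 < `|3 * s ^+ 2| -> w ^+ 3 = 1 ->
  w != 1 -> (0 < n)%N -> (std_mx s 1 *m std_mx s w) ^+ n != c%:M.
Proof.
move=> s4 w3 w1 n0.
have rW m : reduced_word s (if m is 0%N then None else Some 1)
    ((std_mx s 1 *m std_mx s w) ^+ m).
  elim: m => [|m IH]; first exact: reduced_nil.
  rewrite exprS -[_ * _]mulmxA; apply: (@reduced_cons _ _ _ (Some w)).
  - by rewrite expr1n.
  - by case=> e; rewrite e eqxx in w1.
  apply: reduced_cons IH => //; case: m => [//|m] [e].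
  by rewrite -e eqxx in w1.
have out u : u ^+ 3 = 1 -> outside s u (cv2 1 0).
  by move=> u3; rewrite /outside !mxE /= mulr1 mulr0 subr0 normr0 norm_cube_root.
case: n n0 (rW n) => [//|n] _ {}rW.
apply/eqP => e; have := reduced_word_inside s4 out rW.
by rewrite e mul_scalar_mx /inside !mxE /= !mulr0 normr0 normr_lt0.
Qed.

End StdPower.

Section TriangleTraceBound.
Variables (R : realType) (k : fieldExtType rat) (iota : {rmorphism k -> R[i]}).
Variables (a b : k) (theta : {lrmorphism quat (iota a) (iota b) -> 'M[R[i]]_2}).
Local Notation C := R[i].
Hypothesis nonreal : exists x, complex.Im (iota x) != 0.
Hypothesis bij_theta : bijective theta.
Variable O0 : set (quat a b).
Hypothesis order_O : is_order O0.
Local Notation qm := (quat_mx theta).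

Lemma quat_mxX (x : quat a b) n : qm (x ^+ n) = qm x ^+ n.
Proof.
by elim: n => [|n IH]; [rewrite quat_mx1|rewrite !exprS quat_mxM IH].
Qed.

Lemma reduced_normX (x : quat a b) n : reduced_norm (x ^+ n) = reduced_norm x ^+ n.
Proof.
elim: n => [|n IH]; last by rewrite !exprS reduced_normM IH.
by rewrite /= !expr0n /= expr1n !mulr0 !subr0 addr0.
Qed.

Lemma sl2_eigenvalue (M : 'M[C]_2) : exists e, e ^+ 2 - \tr M * e + \det M = 0.
Proof.
exists ((\tr M + sqrtC (\tr M ^+ 2 - 4 * \det M)) / 2).
set r := sqrtC _; have rE : r ^+ 2 = \tr M ^+ 2 - 4 * \det M by rewrite sqrtCK.
have -> : ((\tr M + r) / 2) ^+ 2 - \tr M * ((\tr M + r) / 2) + \det M =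
   (r ^+ 2 - (\tr M ^+ 2 - 4 * \det M)) / 4 by field.
by rewrite rE subrr mul0r.
Qed.

Lemma basis_completion (v : 'cV[C]_2) : v != 0 ->
  exists2 V : 'M[C]_2, V \in unitmx & V *m cv2 1 0 = v.
Proof.
move=> v0; have [v00|v00] := eqVneq (v 0 0) 0; last first.
  exists (mx2 (v 0 0) 0 (v 1 0) 1).
    by rewrite unitmxE det2 unitfE !mxE /= mulr1 mul0r subr0.
  by apply: eq_cv2; mx2; rewrite !mulr1 !mulr0 addr0.
exists (mx2 (v 0 0) 1 (v 1 0) 0).
  rewrite unitmxE det2 unitfE !mxE /= mulr0 mul1r sub0r oppr_eq0.
  by apply: contra_neq v0 => v10; apply: eq_cv2; rewrite !mxE.
by apply: eq_cv2; mx2; rewrite !mulr1 ?mulr0 addr0.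
Qed.

Lemma triangle_trace_bound (A B D : SL2 R) (s w : C) (P : 'M[C]_2) (H : set (PSL2 R)) :
  w ^+ 2 + w + 1 = 0 -> \det P = 1 ->
  [/\ sl2_mx A *m P = P *m std_mx s 1, sl2_mx B *m P = P *m std_mx s w &
      sl2_mx D *m P = P *m std_mx s (w ^+ 2)] ->
  [/\ \tr (sl2_mx A) = 0, \tr (sl2_mx B) = 0 & \tr (sl2_mx D) = 0] ->
  finite_index_subgroup H (generated [set psl2_proj A; psl2_proj B; psl2_proj D]) ->
  finite_index_subgroup H (norm_one_group theta O0) ->
  ~~ (4 < `|3 * s ^+ 2|).
Proof.
move=> w0 detP [AP BP DP] trs; set G := generated _ => HG HN; apply/negP => s4.
have w3 := cube_root_unity w0.
have w1 : w != 1.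
  apply/eqP => w1; move: w0; rewrite w1 expr1n => /eqP.
  have -> : 1 + 1 + 1 = 3 :> C by ring.
  by rewrite pnatr_eq0.
have uP : P \in unitmx by rewrite unitmxE detP unitr1.
have [GA GB] : G (psl2_proj A) /\ G (psl2_proj B).
  by split; apply: generated_sub; [left; left|left; right].
have sG : is_subgroup G := generated_subgroup _.
have GAB n : G ((psl2_proj (A * B)%g) ^+ n)%g.
  by rewrite psl2_projM; exact: (subgroupX n sG (subgroupM sG GA GB)).
have [N0 N00] := finite_index_power HG GAB.
case: (HN) => _ HsubN _; case: (HG) => _ HsubG _.
rewrite -psl2_projX => /HsubN/(norm_one_lift order_O) [h [Oh h1 ABh]].
have [T TE] : exists T, T = sl2_mx A *m sl2_mx B by exists (sl2_mx A *m sl2_mx B).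
have hT : qm h = T ^+ N0 by rewrite -ABh sl2_mxX TE.
(* A fixed point of [A B] on the sphere, written as the image of infinity under [V]. *)
have [e eE] := sl2_eigenvalue T; have [v v0 Tv] := sl2_eigenvector eE.
have [V uV Vv] := basis_completion v0.
have [eta eta0 etaE] : exists2 eta : C, 0 < eta & eta * 8 * (1 + `|s|) = 1.
  have p : 0 < 8 * (1 + `|s|) by rewrite mulr_gt0// ltr_wpDr.
  by exists (8 * (1 + `|s|))^-1; [rewrite invr_gt0|rewrite -mulrA mulVf// gt_eqF].
have uPV : invmx P \in unitmx by rewrite unitmx_inv.
(* In the basis [P] the vector [q v] is close to infinity, so it lies outside the three discs. *)
have [q /(near_identity eta0 etaE) [detX out]] :=
  quat_mx_dense nonreal bij_theta uPV uV eta0.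
have nq : reduced_norm q != 0.
  apply: contra_neq detX => nq; rewrite !det_mulmx (det_quat_mx bij_theta) nq.
  by rewrite rmorph0 mulr0 mul0r.
have [q' q'q qq'] := quat_inv nq.
(* The element [q h^N1 q^-1] fixes the point [q v] and is again in [O]; by finite index a power of
   it is in the group. *)
have [N1 N10 Oy] := order_conj_power bij_theta order_O Oh h1 qq'.
set y := q * h ^+ N1 * q' in Oy.
have ny : reduced_norm y = 1.
  rewrite /y !reduced_normM reduced_normX h1 expr1n mulr1 -reduced_normM qq'.
  exact: (reduced_normX 1 0).
have [Y YE] : exists Y : SL2 R, sl2_mx Y = qm y.
  have dy : \det (qm y) == 1 by rewrite (det_quat_mx bij_theta) ny rmorph1.
  by exists (MkSL2 dy).
have NY n : norm_one_group theta O0 ((psl2_proj Y) ^+ n)%g.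
  exists (y ^+ n), (Y ^+ n)%g; split; rewrite ?psl2_projX//.
  - exact: orderX.
  - by rewrite reduced_normX ny expr1n.
  - by rewrite sl2_mxX YE -quat_mxX.
have [N2 N20 /HsubG] := finite_index_power HN NY.
rewrite -psl2_projX => /(generated_reduced_word w3 AP BP DP trs) [oo [W [rW YW]]].
have qK : qm q' *m qm q = 1%:M by rewrite -quat_mxM q'q quat_mx1.
have YqT : qm y *m qm q = qm q *m T ^+ (N0 * N1).
  by rewrite /y !quat_mxM quat_mxX hT -exprM -mulmxA qK mulmx1.
have Yn n : qm y ^+ n *m qm q = qm q *m T ^+ (N0 * N1 * n).
  elim: n => [|n IH]; first by rewrite muln0 !expr0 [1 *m _]mul1mx [_ *m 1]mulmx1.
  by rewrite exprS -[(_ * _) *m _]mulmxA IH mulmxA YqT -mulmxA mulnS exprD.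
have YN2 : sl2_mx (Y ^+ N2)%g = qm y ^+ N2 by rewrite sl2_mxX YE.
(* That power is a reduced word with a fixed point outside the discs, so it is the empty word. *)
have W1 : W = 1%:M.
  have [f Wf] : exists f, W *m (invmx P *m qm q *m V *m cv2 1 0) =
      f *: (invmx P *m qm q *m V *m cv2 1 0).
    have key : sl2_mx (Y ^+ N2)%g *m qm q *m v = e ^+ (N0 * N1 * N2) *: (qm q *m v).
      by rewrite YN2 Yn -mulmxA (eigenvectorX _ Tv) scalemxAr.
    have vE : invmx P *m qm q *m V *m cv2 1 0 = invmx P *m (qm q *m v).
      by rewrite -[_ *m V *m _]mulmxA Vv !mulmxA.
    have WE : W = invmx P *m (P *m W) by rewrite mulKmx.
    rewrite vE WE; case: YW => YW.
      exists (e ^+ (N0 * N1 * N2)); rewrite -YW -!mulmxA mulKVmx// [_ *m (_ *m v)]mulmxA key.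
      by rewrite -scalemxAr.
    exists (- e ^+ (N0 * N1 * N2)).
    rewrite -[P *m W]opprK -YW mulmxN mulNmx -!mulmxA mulKVmx// [_ *m (_ *m v)]mulmxA key.
    by rewrite -scalemxAr scaleNr.
  exact: (reduced_word_eigen s4 out rW Wf).
have [c Yc] : exists c, sl2_mx (Y ^+ N2)%g = c%:M.
  case: YW; rewrite W1 mulmx1 => YW.
    by exists 1; rewrite -[LHS](mulmxK uP) YW mulmxV.
  by exists (-1); rewrite -[LHS](mulmxK uP) YW mulNmx mulmxV// raddfN.
(* Conjugating back by [q] makes a positive power of [A B] scalar, against
   [std_mx_power_nonscalar]. *)
have TN : T ^+ (N0 * N1 * N2) = c%:M.
  have := Yn N2; rewrite -YN2 Yc => e1.
  rewrite -[LHS]mul1mx -qK -mulmxA -e1 mulmxA scalar_mxC.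
  by rewrite -mulmxA qK mulmx1.
have TP1 : T *m P = P *m (std_mx s 1 *m std_mx s w).
  by rewrite TE -mulmxA BP mulmxA AP mulmxA.
have TP n : T ^+ n *m P = P *m (std_mx s 1 *m std_mx s w) ^+ n.
  elim: n => [|n IH]; first by rewrite !expr0 [1 *m _]mul1mx [_ *m 1]mulmx1.
  by rewrite !exprS -[LHS]mulmxA IH mulmxA TP1 -mulmxA.
have := @std_mx_power_nonscalar _ s w c (N0 * N1 * N2) s4 w3 w1.
rewrite !muln_gt0 N00 N10 N20 => /(_ isT)/eqP; apply.
by rewrite -[LHS](mulKmx uP) -TP TN -scalar_mxC mulKmx.
Qed.

End TriangleTraceBound.

(** * The conditions on the trace of an arithmetic triangle group *)

Section RegularTriangle.
Variable R : realType.
Local Notation C := R[i].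
Variables (A B D : SL2 R) (x : C).
Hypothesis tr0 :
  [/\ \tr (sl2_mx A) = 0, \tr (sl2_mx B) = 0 & \tr (sl2_mx D) = 0].
Hypothesis trx : [/\ \tr (sl2_mx (A * B)%g) = - x,
  \tr (sl2_mx (A * D)%g) = - x & \tr (sl2_mx (B * D)%g) = - x].
Local Notation G := (generated [set psl2_proj A; psl2_proj B; psl2_proj D]).

Lemma psl2_proj_involution (M : SL2 R) : \tr (sl2_mx M) = 0 ->
  (psl2_proj M * psl2_proj M)%g = 1%g.
Proof.
move=> tM; rewrite -psl2_projM; apply/psl2_projP; right.
exact: traceless_sqr tM (det_sl2 M).
Qed.

Lemma asymptotic_triangle_elementary : x = 2 -> elementary G.
Proof.
case: tr0 trx => tA tB tD [tAB tAD tBD] x2.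
apply: involutions_virtually_abelian; rewrite ?psl2_proj_involution//.
rewrite -!psl2_projM; apply: psl2_mx_comm.
by apply: asymptotic_triangle_commute; rewrite ?det_sl2// -x2.
Qed.

(** On a common eigenvector the eigenvalues [al], [be], [de] have square -1, and each pair has
    product [-2 / x]. Evaluating [x^2 al^2 be de] in two ways gives [x = 2]. *)
Lemma triangle_no_common_eigenvector u : x != 2 -> u != 0 ->
  exists2 M, G (psl2_proj M) & ~ eigenvector (sl2_mx M) u.
Proof.
move=> x2 u0; have [[al Au]|nA] := pselect (eigenvector (sl2_mx A) u); last first.
  by exists A => //; apply: generated_sub; left; left.
have [[be Bu]|nB] := pselect (eigenvector (sl2_mx B) u); last first.
  by exists B => //; apply: generated_sub; left; right.
have [[de Du]|nD] := pselect (eigenvector (sl2_mx D) u); last first.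
  by exists D => //; apply: generated_sub; right.
case: tr0 trx => tA tB tD [tAB tAD tBD]; case/eqP: x2.
have sqr (M : SL2 R) e : \tr (sl2_mx M) = 0 -> sl2_mx M *m u = e *: u -> e ^+ 2 = -1.
  move=> tM /eigen2/eqP; rewrite scaler_eq0 (negPf u0) orbF tM mul0r subr0 det_sl2.
  by rewrite addr_eq0 => /eqP.
have pair (M N : SL2 R) e f : \tr (sl2_mx (M * N)%g) = - x -> sl2_mx M *m u = e *: u ->
    sl2_mx N *m u = f *: u -> e ^+ 2 = -1 -> f ^+ 2 = -1 -> x * (e * f) = -2.
  move=> tMN Mu Nu e2 f2.
  have : sl2_mx (M * N)%g *m u = (e * f) *: u.
    by rewrite sl2_mulE -mulmxA Nu -scalemxAr Mu scalerA mulrC.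
  move/eigen2/eqP; rewrite scaler_eq0 (negPf u0) orbF tMN det_sl2 exprMn e2 f2.
  have -> : -1 * -1 - - x * (e * f) + 1 = x * (e * f) + 2 by ring.
  by rewrite addr_eq0 => /eqP.
have a2 := sqr _ _ tA Au; have b2 := sqr _ _ tB Bu; have d2 := sqr _ _ tD Du.
have ab := pair _ _ _ _ tAB Au Bu a2 b2.
have ad := pair _ _ _ _ tAD Au Du a2 d2.
have bd := pair _ _ _ _ tBD Bu Du b2 d2.
have e : x * (x * (be * de)) * al ^+ 2 = (x * (al * be)) * (x * (al * de)) by ring.
move: e; rewrite ab ad bd a2 => e.
have : 2 * (x - 2) = 0.
  have -> : 2 * (x - 2) = x * -2 * -1 - -2 * -2 by ring.
  by rewrite e subrr.
by move/eqP; rewrite mulf_eq0 pnatr_eq0 /= subr_eq0 => /eqP.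
Qed.

End RegularTriangle.

Section ArithmeticTrace.
Variables (R : realType) (k : fieldExtType rat) (iota : {rmorphism k -> R[i]}).
Local Notation C := R[i].

Lemma real_embedding (tau : {rmorphism k -> C}) :
  (forall z, complex.Im (tau z) = 0) ->
  exists phi : {rmorphism k -> R}, forall z, tau z = (phi z)%:C.
Proof.
move=> im0; pose phi z := complex.Re (tau z).
have phiE z : tau z = (phi z)%:C.
  by have := im0 z; rewrite /phi; case: (tau z) => r i /= ->.
have phiB : {morph phi : y z / y - z}.
  by move=> y z; apply: complexI; rewrite -phiE !rmorphB /= !phiE.
have phiM : GRing.monoid_morphism phi.
  split=> [|y z]; apply: complexI; first by rewrite -phiE !rmorph1.
  by rewrite -phiE !rmorphM /= !phiE.
pose phiA := GRing.isZmodMorphism.Build _ _ phi phiB.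
pose phiR := GRing.isMonoidMorphism.Build _ _ phi phiM.
by exists (HB.pack_for {rmorphism k -> R} phi phiA phiR).
Qed.

(** All conjugates of [xi] come from embeddings of [k], and these are real except for [iota] and its
    complex conjugate. *)
Lemma restricted_integer (xi : k) (x : C) : unique_complex_place iota ->
  iota xi = x -> algebraic_integer xi ->
  (forall phi : {rmorphism k -> R}, -1 <= phi xi <= 2) ->
  exists p : {poly int}, [/\ p \is monic,
    irreducible_poly (map_poly intr p : {poly rat}), root (map_poly intr p) x &
    forall y : C, root (map_poly intr p) y ->
      [\/ exists2 r : R, -1 <= r <= 2 & y = r%:C, y = x | y = x^*]].
Proof.
move=> [_ places] xiE int_xi bounds.
have [p [p_monic p_irr p_xi roots]] := int_min_poly int_xi.
exists p; split=> //.
  rewrite -xiE; have := rmorph_root iota p_xi; rewrite -map_poly_comp.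
  by rewrite (eq_map_poly (g := intr))// => z /=; rewrite rmorph_int.
move=> y /roots [tau tauE]; case: (places tau) => [im0|tauI|tauJ].
- have [phi phiE] := real_embedding im0; constructor 1.
  by exists (phi xi); rewrite -?phiE.
- by constructor 2; rewrite -tauE tauI.
- by constructor 3; rewrite -tauE tauJ xiE.
Qed.

End ArithmeticTrace.

Section TriangleTrace.
Variables (R : realType) (A B D : SL2 R) (x : R[i]).
Local Notation C := R[i].
Hypothesis tr0 :
  [/\ \tr (sl2_mx A) = 0, \tr (sl2_mx B) = 0 & \tr (sl2_mx D) = 0].
Hypothesis trx : [/\ \tr (sl2_mx (A * B)%g) = - x,
  \tr (sl2_mx (A * D)%g) = - x & \tr (sl2_mx (B * D)%g) = - x].
Local Notation G := (generated [set psl2_proj A; psl2_proj B; psl2_proj D]).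

(** A power of [A B] lies in [O] and has integral eigenvalues, so those of [A B] are integral, and
    their sum is [- x]. *)
Lemma triangle_trace_integral (k : fieldExtType rat) (iota : {rmorphism k -> R[i]})
    (a b : k) (theta : {lrmorphism quat (iota a) (iota b) -> 'M[R[i]]_2})
    (O0 : set (quat a b)) (H : set (PSL2 R)) : is_order O0 ->
  finite_index_subgroup H G -> H `<=` norm_one_group theta O0 ->
  integralOver (intr : int -> C) x.
Proof.
move=> order_O HG HN; case: trx => tAB _ _.
have [GA GB] : G (psl2_proj A) /\ G (psl2_proj B).
  by split; apply: generated_sub; [left; left|left; right].
have sG : is_subgroup G := generated_subgroup _.
have GAB n : G ((psl2_proj (A * B)%g) ^+ n)%g.
  by rewrite psl2_projM; exact: (subgroupX n sG (subgroupM sG GA GB)).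
have [N N0] := finite_index_power HG GAB.
rewrite -psl2_projX => /HN/(norm_one_lift order_O) [h [Oh _]]; rewrite sl2_mxX => hE.
have int_root e : e ^+ 2 + x * e + 1 = 0 -> integralOver (intr : int -> C) e.
  move=> eE; have := @sl2_eigenvector _ (sl2_mx (A * B)%g) e.
  rewrite tAB det_sl2 mulNr opprK => /(_ eE) [u u0 Mu].
  apply: (integral_of_power N0); apply: (order_eigenvalue_integral (theta := theta) order_O Oh u0).
  by rewrite -hE; apply: eigenvectorX.
have [e] := sl2_eigenvalue (sl2_mx (A * B)%g); rewrite tAB det_sl2 mulNr opprK => eE.
have fE : (- x - e) ^+ 2 + x * (- x - e) + 1 = 0 by rewrite -eE; ring.
have -> : x = - (e + (- x - e)) by ring.
by apply: integral_opp; apply: integral_add; apply: int_root.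
Qed.

Lemma arithmetic_triangle_trace (s w : C) (P : 'M[C]_2) : arithmetic_group G ->
  ~ elementary G -> x = -1 - 3 * s ^+ 2 ->
  w ^+ 2 + w + 1 = 0 -> \det P = 1 ->
  [/\ sl2_mx A *m P = P *m std_mx s 1, sl2_mx B *m P = P *m std_mx s w &
      sl2_mx D *m P = P *m std_mx s (w ^+ 2)] ->
  `|x| <= 5%:R /\ exists p : {poly int}, [/\ p \is monic,
    irreducible_poly (map_poly intr p : {poly rat}), root (map_poly intr p) x &
    forall y : C, root (map_poly intr p) y ->
      [\/ exists2 r : R, -1 <= r <= 2 & y = r%:C, y = x | y = x^*]].
Proof.
move=> [k [iota [a [b [theta [ord [places [a0 b0] ram bij_theta]]]]]]].
move=> [order_O [H HG HN]] nel xE w0 detP normal.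
have HsubN : H `<=` norm_one_group theta ord by case: HN.
have x2 : x != 2 by apply/eqP => /(asymptotic_triangle_elementary tr0 trx).
have noeig u (u0 : u != 0) := triangle_no_common_eigenvector tr0 trx x2 u0.
have sG : is_subgroup G := generated_subgroup _.
have in_alg g : g = A \/ g = B \/ g = D ->
    exists2 c : C, c != 0 & exists z, quat_mx theta z = c *: sl2_mx g.
  move=> gE; have Gg : G (psl2_proj g).
    by apply: generated_sub; case: gE => [->|[->|->]]; [left; left|left; right|right].
  exact: (commensurable_normalizer a0 b0 bij_theta order_O sG nel noeig HG HsubN Gg).
have [xi [xiE bounds]] := triangle_trace_in_field a0 b0 bij_theta ram tr0 trx in_alg.
have int_xi : algebraic_integer xi.
  by apply/(integral_iota iota); rewrite xiE; apply: triangle_trace_integral HG HsubN.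
split; last exact: restricted_integer places xiE int_xi bounds.
have := triangle_trace_bound places.1 bij_theta order_O w0 detP normal tr0 HG HN.
rewrite -real_leNgt ?ger0_real// ?normr_ge0// => s4.
(* The constant 5 is [1 + 4], from [x = -1 - 3 s^2] and the ping-pong bound. *)
rewrite xE -[-1 - _]opprK normrN opprB opprK.
have -> : 5%:R = 1 + 4 :> C by ring.
by rewrite addrC (le_trans (ler_normD _ _))// normr1 lerD2l.
Qed.

End TriangleTrace.

(** * Conclusion *)

Section Conjugation.
Variable gT : groupType.
Local Open Scope group_scope.
Implicit Types (S : set gT) (g : gT).

Lemma conj_subgroup (G : set gT) g : is_subgroup G -> is_subgroup [set x ^ g | x in G].
Proof.
move=> [G1 GV]; split; first by exists 1; rewrite ?conj1g.
by move=> _ _ [x Gx <-] [y Gy <-]; exists (x * y^-1); [exact: GV|rewrite conjMg conjVg].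
Qed.

Lemma conj_generated_sub S g :
  generated [set x ^ g | x in S] `<=` [set x ^ g | x in generated S].
Proof.
apply: smallest_sub; first exact: (conj_subgroup g (generated_subgroup S)).
by move=> _ [x Sx <-]; exists x => //; apply: generated_sub.
Qed.

Lemma conj_imageK S g : [set x ^ g^-1 | x in [set x ^ g | x in S]] = S.
Proof.
apply/seteqP; split=> [_ [_ [x Sx <-] <-]|x Sx]; first by rewrite conjgK.
by exists (x ^ g); [exists x|rewrite conjgK].
Qed.

Lemma conj_generated S g :
  [set x ^ g | x in generated S] = generated [set x ^ g | x in S].
Proof.
apply/seteqP; split; last exact: conj_generated_sub.
move=> _ [x Sx <-].
rewrite -[S](conj_imageK _ g) in Sx; have [y Gy <-] := conj_generated_sub Sx.
by rewrite conjgKV.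
Qed.

Lemma conj_class_conj (G : set gT) g : conj_class [set x ^ g | x in G] = conj_class G.
Proof.
have sub (K : set gT) h : conj_class [set x ^ h | x in K] `<=` conj_class K.
  move=> _ [y _ <-]; exists (h * y) => //; apply/seteqP; split.
    by move=> _ [x Kx <-]; exists (x ^ h); [exists x|rewrite conjgM].
  by move=> _ [_ [x Kx <-] <-]; exists x; rewrite ?conjgM.
apply/seteqP; split; first exact: sub.
by rewrite -{1}[G](conj_imageK _ g); apply: sub.
Qed.

End Conjugation.

Section StandardGroup.
Variable R : realType.
Local Notation C := R[i].

(** All cube roots of unity enter symmetrically, so the group depends on [s] alone and not on the
    primitive root [w] chosen in the normal form. *)
Definition std_group (s : C) : set (PSL2 R) :=
  generated [set g | exists u M, [/\ u ^+ 3 = 1, sl2_mx M = std_mx s u & g = psl2_proj M]].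

Lemma cube_roots (w u : C) : w ^+ 2 + w + 1 = 0 -> u ^+ 3 = 1 ->
  [\/ u = 1, u = w | u = w ^+ 2].
Proof.
move=> w0 u3.
have : (u - 1) * ((u - w) * (u - w ^+ 2)) = 0.
  have -> : (u - 1) * ((u - w) * (u - w ^+ 2)) =
    u ^+ 3 - 1 + (w ^+ 2 + w + 1) * (- u ^+ 2 + w * u - (w - 1)) by ring.
  by rewrite u3 w0 subrr mul0r addr0.
by move/eqP; rewrite !mulf_eq0 !subr_eq0 => /or3P[] /eqP;
  [constructor 1|constructor 2|constructor 3].
Qed.

Lemma triangle_group_standard (A B D : SL2 R) (s w : C) (P : 'M[C]_2) :
  w ^+ 2 + w + 1 = 0 -> \det P = 1 ->
  [/\ sl2_mx A *m P = P *m std_mx s 1, sl2_mx B *m P = P *m std_mx s w &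
      sl2_mx D *m P = P *m std_mx s (w ^+ 2)] ->
  conj_class (generated [set psl2_proj A; psl2_proj B; psl2_proj D]) =
    conj_class (std_group s).
Proof.
move=> w0 detP [AP BP DP].
have w3 := cube_root_unity w0.
have [Q QE] : exists Q : SL2 R, sl2_mx Q = P.
  by have dP : \det P == 1 by [apply/eqP]; exists (MkSL2 dP).
have conjE (M : SL2 R) X : sl2_mx M *m P = P *m X -> sl2_mx (M ^ Q)%g = X.
  by move=> MP; rewrite conjgE !sl2_mulE sl2_invE QE MP mulKmx// -QE unitmx_sl2.
have projJ (M : SL2 R) : (psl2_proj M ^ psl2_proj Q)%g = psl2_proj (M ^ Q)%g.
  by rewrite !conjgE !psl2_projM psl2_projV.
rewrite -(conj_class_conj _ (psl2_proj Q)) conj_generated; congr (conj_class (generated _)).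
apply/seteqP; split=> [_ [g gE <-]|_ [u [M [u3 ME ->]]]].
  case: gE => [[->|->]|->]; rewrite projJ.
  - by exists 1, (A ^ Q)%g; split; rewrite ?expr1n ?(conjE _ _ AP).
  - by exists w, (B ^ Q)%g; split; rewrite ?(conjE _ _ BP).
  - by exists (w ^+ 2), (D ^ Q)%g; split; rewrite ?(conjE _ _ DP)// -exprM mulnC exprM w3 expr1n.
have inj (N : SL2 R) : sl2_mx N *m P = P *m std_mx s u ->
    psl2_proj M = (psl2_proj N ^ psl2_proj Q)%g.
  by move=> /conjE NE; rewrite projJ; congr psl2_proj; apply: sl2_inj; rewrite NE.
case: (cube_roots w0 u3) => uE; rewrite uE in inj.
- by exists (psl2_proj A); [left; left|rewrite -inj].
- by exists (psl2_proj B); [left; right|rewrite -inj].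
- by exists (psl2_proj D); [right|rewrite -inj].
Qed.

End StandardGroup.

Lemma finite_sqr_preimage (R : realType) (S : set R[i]) : finite_set S ->
  finite_set [set s : R[i] | S (-1 - 3 * s ^+ 2)].
Proof.
move=> finS.
pose f (x : R[i]) := sqrtC ((-1 - x) / 3).
apply: (@sub_finite_set _ _ (f @` S `|` (fun x => - f x) @` S)); last first.
  by rewrite finite_setU; split; apply: finite_image.
move=> s /= Ss; have : s ^+ 2 = f (-1 - 3 * s ^+ 2) ^+ 2 by rewrite sqrtCK; field.
move/eqP; rewrite eqf_sqr => /orP[] /eqP sE; [left|right].
  by exists (-1 - 3 * s ^+ 2).
by exists (-1 - 3 * s ^+ 2).
Qed.

Theorem corollary5p3 (R : realType) :
  finite_set [set conj_class G | G in
    [set G : set (PSL2 R) |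
      [/\ kleinian G, regular_triangle_group G & arithmetic_group G]]].
Proof.
have /finite_sqr_preimage fin := finite_restricted_integers R 5.
(* Each admissible [x] comes from at most two values of [s], and [s] determines the conjugacy
   class. *)
apply: sub_finite_set (finite_image (fun s => conj_class (std_group s)) fin).
move=> _ [G [[_ _ nel] /regular_triangle_lift tri arith] <-].
have [A [B [D [x [tr0 [tAB tAD tBD GE]]]]]] := tri.
move: nel arith; rewrite {}GE => nel arith.
have trx : [/\ \tr (sl2_mx (A * B)%g) = - x, \tr (sl2_mx (A * D)%g) = - x &
  \tr (sl2_mx (B * D)%g) = - x] by [].
have x2 : x != 2 by apply/eqP => /(asymptotic_triangle_elementary tr0 trx).
have [|s [w [P [w0 xE detP normal]]]] := triangle_normal_form tr0 _ trx x2.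
  by rewrite !det_sl2.
exists s; last exact/esym/(triangle_group_standard w0 detP normal).
have := arithmetic_triangle_trace tr0 trx arith nel xE w0 detP normal.
by rewrite xE.
Qed.
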